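(* Let $(X,d_X,\mu_X)$ and $(Y,d_Y,\mu_Y)$ be metric measure spaces (in the sense of the context) such that $(X,d_X)$ and $(Y,d_Y)$ are length spaces, $\mu_X(X)=\infty$ and $\mu_Y(Y)<\infty$, and let $1\le p<\infty$. Suppose that $\varphi:X\to[0,\infty)$ is a continuous function for which $\varphi(x)>0$ for $\mu_X$-a.e. $x\in X$. Moreover, suppose that all of the following conditions hold. 1. $X$ is a $(p,p)$-Sobolev--Poincaré space with constant $C_X$. 2. $Y$ is an $\infty$-weak local $(p,p)$-Poincaré space. 3. There exists a measurable set $E\subset X$ with $\mu_X(E)>0$ and $\varphi^{-p}\in L^\infty(E,\mu_X)$ and $\varphi^{-p}\notin L^1(E,\mu_X)$. Then $X\times_\varphi Y$, equipped with the measure $\mu_\varphi$ induced by the product measure $\mu_X\times\mu_Y$, is a $(p,p)$-Sobolev--Poincaré space with constant $C_X$, and therefore $$D^{1,p}(X\times_\varphi Y)=N^{1,p}(X\times_\varphi Y)+\mathbb{R}.$$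
   Context: **Metric measure spaces.** A metric measure space is a triple $(Z,d_Z,\mu_Z)$ where $(Z,d_Z)$ is a non-empty separable metric space, $\mu_Z$ is a Borel regular outer measure on $Z$ (defined on all subsets; measurable sets are those satisfying Carathéodory's criterion; Borel sets are measurable; $\mu_Z(A)=\inf\{\mu_Z(F): F\supset A \text{ Borel}\}$ for all $A\subset Z$), and $0<\mu_Z(B)<\infty$ for all (open) balls $B\subset Z$. Write $u_B$ for the $\mu_Z$-average of $u$ over $B$. **Paths.** A path in a (pseudo)metric space $(Z,d_Z)$ is a continuous map $\gamma:[a,b]\to Z$; $\operatorname{len}_{d_Z}(\gamma)$ is the supremum of $\sum_i d_Z(\gamma(t_{i-1}),\gamma(t_i))$ over partitions; $\gamma$ is rectifiable if this is finite, and a rectifiable $\gamma$ is absolutely continuous if $t\mapsto \operatorname{len}_{d_Z}(\gamma|_{[a,t]})$ is absolutely continuous. The metric speed is $|\gamma'(t)|=\lim_{u\to t} d_Z(\gamma(u),\gamma(t))/|u-t|$, which exists for a.e. $t$ if $\gamma$ is absolutely continuous. For Borel $\rho\ge 0$, $\int_\gamma\rho\,ds=\int\rho(\tilde\gamma(t))|\tilde\gamma'(t)|\,dt$ for any absolutely continuous reparametrization $\tilde\gamma$ of $\gamma$. $(Z,d_Z)$ is a length space if any two points are joined by a rectifiable path and $d_Z(x,y)$ is the infimum of lengths of rectifiable paths from $x$ to $y$. **Function spaces.** For measurable $u:Z\to[-\infty,\infty]$, a Borel function $g:Z\to[0,\infty]$ is an upper gradient of $u$ if $|u(\gamma(b))-u(\gamma(a))|\le\int_\gamma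 g\,ds$ for each non-constant absolutely continuous curve $\gamma:[a,b]\to Z$. A function is integrable over balls if it is in $L^1(B,\mu_Z)$ for every ball $B$. $D^{1,p}(Z)$ is the set of measurable $u:Z\to[-\infty,\infty]$ that are integrable over balls and have an upper gradient $g\in L^p(Z,\mu_Z)$. $N^{1,p}(Z)$ is the set of $u\in D^{1,p}(Z)$ with $\int_Z|u|^p\,d\mu_Z<\infty$. $N^{1,p}(Z)+\mathbb{R}$ is the set of functions $v+c$ with $v\in N^{1,p}(Z)$, $c\in\mathbb{R}$ constant. **Poincaré conditions.** $Z$ is a $(p,q)$-Sobolev--Poincaré space with constant $C>0$ if for all $u\in D^{1,q}(Z)$ and all upper gradients $g\in L^q(Z)$ of $u$ there is $c_u\in\mathbb{R}$ with $\|u-c_u\|_{L^p(Z,\mu_Z)}\le C\|g\|_{L^q(Z,\mu_Z)}$. $Z$ is an $\infty$-weak local $(p,q)$-Poincaré space if for every $x\in Z$ there are $C_x,r_x>0$ such that for every $u$ that is integrable over balls and every upper gradient $g$ of $u$ on $Z$, $\|u-u_{B_Z(x,r_x)}\|_{L^p(B_Z(x,r_x),\mu_Z)}\le C_x\|g\|_{L^q(Z,\mu_Z)}$. **Warped products.** Fix a norm $\|\cdot\|$ on $\mathbb{R}^2$ that is unitary ($\|(1,0)\|=\|(0,1)\|=1$) and coordinate-increasing ($\|(a,c)\|\le\|(b,d)\|$ whenever $0\le a\le b$, $0\le c\le d$); the choice is arbitrary. For length spaces $X,Y$ and continuous $\varphi:X\to[0,\infty)$, and for a path $\gamma=(\gamma_X,\gamma_Y):[a,b]\to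 X\times Y$ absolutely continuous with respect to the $\ell^1$-product metric, set $\ell_\varphi(\gamma)=\int_a^b\|(|\gamma_X'(t)|,\varphi(\gamma_X(t))|\gamma_Y'(t)|)\|\,dt$. Let $d_\varphi((x,y),(x',y'))=\inf_\gamma\ell_\varphi(\gamma)$ over absolutely continuous paths from $(x,y)$ to $(x',y')$ (a pseudometric). $X\times_\varphi Y$ is the quotient of $X\times Y$ identifying points at $d_\varphi$-distance $0$, with the induced metric $d_\varphi$, and $P_\varphi:X\times Y\to X\times_\varphi Y$ is the projection. The measure on $X\times_\varphi Y$ is $\mu_\varphi(A)=(\mu_X\times\mu_Y)(P_\varphi^{-1}(A))$, where $\mu_X\times\mu_Y$ is the product outer measure. *)

(* Defs.v *)
From HB Require Import structures.
From mathcomp Require Import all_boot all_order all_algebra.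
From mathcomp Require Import all_classical all_reals all_analysis.
From mathcomp Require Import measurable_realfun.

Set Implicit Arguments.
Unset Strict Implicit.
Unset Printing Implicit Defensive.

Import Order.TTheory GRing.Theory Num.Theory.
Import numFieldNormedType.Exports.

Local Open Scope classical_set_scope.
Local Open Scope ring_scope.

(* A chosen point encodes non-emptiness; [caratheodory_type] requires it. *)
#[short(type="pointedMetricType")]
HB.structure Definition PointedMetric (R : numDomainType) :=
  { M of Metric R M & Pointed M }.

(* The notions below are parametrized by a distance function [d] rather than
   by a [metricType], since they are applied to the metrics of X and Y, to the
   l^1-product metric, and to the quotient metric of the warped product. *)

Section Paths.
Context {R : realType} {Z : Type} (d : Z -> Z -> R).
Implicit Types (a b t : R) (gamma : R -> Z).

(* A path [a, b] -> Z is a function on R of which only the restriction to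
   [a, b] matters. *)
Definition path_on a b gamma : Prop :=
  a <= b /\
  forall t, t \in `[a, b] ->
    d (gamma t) (gamma u) @[u --> within `[a, b] (nbhs t)] --> (0 : R).

Definition path_length a b gamma : \bar R :=
  ereal_sup [set (\sum_(0 <= i < size s)
      d (gamma (nth b (a :: s) i)) (gamma (nth b (a :: s) i.+1)))%:E
    | s in itv_partition a b].

Definition rectifiable a b gamma : Prop :=
  path_on a b gamma /\ (path_length a b gamma < +oo)%E.

Definition absolutely_continuous a b (f : R -> R) : Prop :=
  forall e : R, 0 < e -> exists2 delta : R, 0 < delta &
    forall n (I : 'I_n -> R * R),
      (forall i, [/\ a <= (I i).1, (I i).1 <= (I i).2 & (I i).2 <= b]) ->
      trivIset setT (fun i => [set` `](I i).1, (I i).2[ ]) ->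
      \sum_(i < n) ((I i).2 - (I i).1) < delta ->
      \sum_(i < n) `|f (I i).2 - f (I i).1| < e.

Definition ac_path a b gamma : Prop :=
  rectifiable a b gamma /\
  absolutely_continuous a b (fun t => fine (path_length a t gamma)).

Definition metric_speed gamma (t : R) : R :=
  lim (d (gamma u) (gamma t) / `|u - t| @[u --> t^']).

(* Used only for absolutely continuous [gamma], which then serves as its own
   reparametrization. *)
Definition line_integral a b gamma (rho : Z -> \bar R) : \bar R :=
  (\int[lebesgue_measure]_(t in `[a, b])
     (rho (gamma t) * (metric_speed gamma t)%:E))%E.

Definition length_space : Prop :=
  forall x y,
    (exists a b gamma,
       [/\ rectifiable a b gamma, gamma a = x & gamma b = y]) /\
    (d x y)%:E = ereal_inf [set l | exists a b gamma,
      [/\ rectifiable a b gamma, gamma a = x, gamma b = y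
        & l = path_length a b gamma]].

Definition dball (x : Z) (r : R) : set Z := [set z | d x z < r].

Definition dopen : set (set Z) :=
  [set U | forall x, U x -> exists2 r, 0 < r & dball x r `<=` U].

Definition borel : set (set Z) := <<s dopen >>.

Definition separable : Prop :=
  exists2 D : set Z, countable D &
    forall x r, 0 < r -> dball x r `&` D !=set0.

End Paths.

Lemma dball_mdist (R : realType) (Z : metricType R) (x : Z) (r : R) :
  dball (@mdist R Z) x r = ball x r.
Proof. by rewrite ballEmdist. Qed.

Lemma dopen_mdist (R : realType) (Z : metricType R) :
  dopen (@mdist R Z) = open.
Proof.
apply/seteqP; split=> U; rewrite openE => oU x /oU.
  by move=> [r r0 rU]; apply/nbhs_ballP; exists r; rewrite // -dball_mdist.
by move=> /nbhs_ballP[r r0 rU]; exists r; rewrite // dball_mdist.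
Qed.

Section MetricMeasureSpaces.
Context {R : realType} {Z : pointedType}.
Variables (d : Z -> Z -> R) (mu : {outer_measure set Z -> \bar R}).
Local Open Scope ereal_scope.

(* Metric axioms for [d] are not included: they are part of the
   [metricType]s to which this predicate is applied. *)
Definition metric_measure_space : Prop :=
  [/\ separable d,
      borel d `<=` mu.-caratheodory,
      forall A, mu A = ereal_inf [set mu F | F in [set F | A `<=` F /\ borel d F]]
    & forall x r, (0 < r)%R -> 0 < mu (dball d x r) < +oo].

Local Notation muZ := (mu : set (caratheodory_type mu) -> \bar R).

Definition mu_measurable (D : set Z) (u : Z -> \bar R) : Prop :=
  measurable_fun (D : set (caratheodory_type mu))
    (u : caratheodory_type mu -> \bar R).

Definition borel_fun (g : Z -> \bar R) : Prop :=
  measurable_fun [set: g_sigma_algebraType (dopen d)]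
    (g : g_sigma_algebraType (dopen d) -> \bar R).

Definition Lp_norm (D : set Z) (p : \bar R) (u : Z -> \bar R) : \bar R :=
  Lnorm muZ p (u \_ D).

Definition in_Lp (D : set Z) (p : \bar R) (u : Z -> \bar R) : Prop :=
  mu_measurable D u /\ Lp_norm D p u < +oo.

(* In \bar R, |x - y| = +oo as soon as x or y is infinite, the usual
   convention in this inequality. *)
Definition upper_gradient (u g : Z -> \bar R) : Prop :=
  [/\ borel_fun g, forall z, 0 <= g z
    & forall a b gamma, ac_path d a b gamma ->
        (exists s t, [/\ s \in `[a, b]%R, t \in `[a, b]%R
                       & gamma s <> gamma t]) ->
        `|u (gamma b) - u (gamma a)| <= line_integral d a b gamma g].

Definition integrable_over_balls (u : Z -> \bar R) : Prop :=
  forall x r, (0 < r)%R -> integrable muZ (dball d x r) u.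

Definition D1 (p : R) : set (Z -> \bar R) :=
  [set u | [/\ mu_measurable setT u, integrable_over_balls u
    & exists2 g, upper_gradient u g & in_Lp setT p%:E g]].

Definition N1 (p : R) : set (Z -> \bar R) :=
  [set u | D1 p u /\ \int[muZ]_z (`|u z| `^ p) < +oo].

Definition N1_plus_constants (p : R) : set (Z -> \bar R) :=
  [set u | exists v (c : R), N1 p v /\ u = (fun z => v z + c%:E)].

Definition sobolev_poincare (p q C : R) : Prop :=
  (0 < C)%R /\
  forall u g, D1 q u -> upper_gradient u g -> in_Lp setT q%:E g ->
    exists c : R, Lp_norm setT p%:E (fun z => u z - c%:E)
                    <= C%:E * Lp_norm setT q%:E g.

Definition average (B : set Z) (u : Z -> \bar R) : \bar R :=
  (fine (mu B))^-1%:E * \int[muZ]_(z in B) u z.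

Definition weak_local_poincare (p q : R) : Prop :=
  forall x, exists C r : R, [/\ (0 < C)%R, (0 < r)%R
    & forall u g, mu_measurable setT u -> integrable_over_balls u ->
        upper_gradient u g ->
        Lp_norm (dball d x r) p%:E (fun z => u z - average (dball d x r) u)
          <= C%:E * Lp_norm setT q%:E g].

End MetricMeasureSpaces.

Section ProductOuterMeasure.
Context {R : realType} {X Y : Type}.
Variables (muX : {outer_measure set X -> \bar R})
          (muY : {outer_measure set Y -> \bar R}).
Local Open Scope ereal_scope.

(* The product outer measure on all subsets, from covers by countably many
   rectangles with Caratheodory measurable sides, where 0 * oo = 0. *)
Definition rectangle_cover (A : set (X * Y)) : set (nat -> set X * set Y) :=
  [set F | (forall k, muX.-caratheodory (F k).1 /\ muY.-caratheodory (F k).2) /\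
           A `<=` \bigcup_k ((F k).1 `*` (F k).2)].

Definition prod_outer_measure (A : set (X * Y)) : \bar R :=
  ereal_inf [set \sum_(k <oo) (muX (F k).1 * muY (F k).2)
            | F in rectangle_cover A].

Let rect_ge0 (B : set X * set Y) : 0 <= muX B.1 * muY B.2.
Proof. by apply: mule_ge0; exact: outer_measure_ge0. Qed.

Let prod_outer_measure_ge0 A : 0 <= prod_outer_measure A.
Proof.
by apply: le_ereal_inf_tmp => _ [F _ <-]; apply: nneseries_ge0 => k _ _.
Qed.

Let prod_outer_measure0 : prod_outer_measure set0 = 0.
Proof.
apply/eqP; rewrite eq_le prod_outer_measure_ge0 andbT.
apply: ereal_inf_lbound; exists (fun=> (set0, set0)) => /=.
  by split => // k; split; exact: caratheodory_measurable_set0.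
by apply: eseries0 => k _ _; rewrite outer_measure0 mul0e.
Qed.

Let prod_outer_measure_le :
  {homo prod_outer_measure : A B / A `<=` B >-> A <= B}.
Proof.
move=> A B AB; apply/ereal_inf_le_tmp => _ [F [mF BF] <-]; exists F => //.
by split => //; exact: subset_trans BF.
Qed.

Let prod_outer_measure_sigma_subadditive :
  sigma_subadditive prod_outer_measure.
Proof.
move=> A.
have [[i ioo]|] := pselect (exists i, prod_outer_measure (A i) = +oo).
  rewrite (eseries_pinfty _ _ ioo) ?leey// => n _.
  by rewrite -ltNye (lt_le_trans _ (prod_outer_measure_ge0 _)).
rewrite -forallNE => Aoo.
suff add2e (e : {posnum R}) : prod_outer_measure (\bigcup_n A n) <=
    \sum_(i <oo) prod_outer_measure (A i) + e%:num%:E.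
  by apply/lee_addgt0Pr => _/posnumP[].
rewrite (le_trans _ (epsilon_trick _ _ _))//.
pose P n (F : nat -> set X * set Y) := rectangle_cover (A n) F /\
  \sum_(k <oo) (muX (F k).1 * muY (F k).2)
    <= prod_outer_measure (A n) + (e%:num / (2 ^ n.+1)%:R)%:E.
have [G PG] : {G : nat -> nat -> set X * set Y & forall n, P n (G n)}.
  apply: (@choice _ _ P) => n; rewrite /P.
  have fA : prod_outer_measure (A n) \is a fin_num.
    by rewrite ge0_fin_numE// ltey; exact/eqP/Aoo.
  have en1 : (0 < e%:num / (2 ^ n.+1)%:R)%R by [].
  have [x [F cF <-] xS] := lb_ereal_inf_adherent en1 fA.
  by exists F; split => //; exact/ltW.
pose m (ij : nat * nat) := muX (G ij.1 ij.2).1 * muY (G ij.1 ij.2).2.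
have m_ge0 ij : 0 <= m ij by exact: rect_ge0.
apply: (@le_trans _ _ (\esum_(i in setT) m i)).
  apply: ereal_inf_lbound => /=.
  have /card_esym/ppcard_eqP[f] := card_nat2.
  exists (fun k => G (f k).1 (f k).2).
    split => [k|t [i _ /(PG i).1.2[j _ Gijt]]]; first exact: (PG (f k).1).1.1.
    by exists (f^-1%FUN (i, j)) => //=; rewrite invK ?inE.
  rewrite -(esum_pred_image m _ xpredT) ?[fun=> _]set_true//.
  by rewrite image_eq.
rewrite (_ : esum _ _ = \sum_(i <oo) \sum_(j <oo) m (i, j)); last first.
  pose J : nat -> set (nat * nat) := fun i => [set (i, j) | j in setT].
  rewrite (_ : setT = \bigcup_k J k); last first.
    by rewrite predeqE => -[a b]; split => // _; exists a => //; exists b.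
  rewrite esum_bigcupT /=; last 2 first.
    - apply/trivIsetP => i j _ _ ij.
      rewrite predeqE => -[n k] /=; split => //= -[] [_] _ [<-{n} _].
      by move=> [k' _] [] /esym/eqP; rewrite (negbTE ij).
    - by [].
  rewrite -(image_id [set: nat]) -fun_true esum_pred_image//; last first.
    by move=> n _; exact: esum_ge0.
  apply: eq_eseriesr => /= j _.
  rewrite -(esum_pred_image m (pair j) predT)//=; last by move=> ? ? _ _ [].
  by congr esum; rewrite predeqE => -[a b]; split; move=> [i _ <-]; exists i.
by apply: lee_nneseries => n *; [exact: nneseries_ge0|have [] := PG n].
Qed.

HB.instance Definition _ := isOuterMeasure.Build R (X * Y)%type
  prod_outer_measure prod_outer_measure0 prod_outer_measure_ge0
  prod_outer_measure_le prod_outer_measure_sigma_subadditive.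

End ProductOuterMeasure.

Section WarpedProducts.
Context {R : realType}.

Definition is_norm2 (N : R * R -> R) : Prop :=
  [/\ forall v, N v = 0 -> v = (0, 0),
      forall (a : R) v, N (a * v.1, a * v.2) = `|a| * N v
    & forall v w, N (v.1 + w.1, v.2 + w.2) <= N v + N w].

Definition unitary (N : R * R -> R) : Prop := N (1, 0) = 1 /\ N (0, 1) = 1.

Definition coordinate_increasing (N : R * R -> R) : Prop :=
  forall a b c e, 0 <= a <= b -> 0 <= c <= e -> N (a, c) <= N (b, e).

Definition l1_dist {X Y : metricType R} (p q : X * Y) : R :=
  mdist p.1 q.1 + mdist p.2 q.2.

Definition warped_length {X Y : metricType R} (N : R * R -> R) (phi : X -> R)
    (a b : R) (gamma : R -> X * Y) : \bar R :=
  let gX t := (gamma t).1 in let gY t := (gamma t).2 in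
  (\int[lebesgue_measure]_(t in `[a, b])
     (N (metric_speed mdist gX t,
         phi (gX t) * metric_speed mdist gY t))%:E)%E.

(* The infimum is finite when X and Y are length spaces, so [fine] loses
   nothing there. *)
Definition warped_dist {X Y : metricType R} (N : R * R -> R) (phi : X -> R)
    (p q : X * Y) : R :=
  fine (ereal_inf [set l | exists a b gamma,
    [/\ ac_path l1_dist a b gamma, gamma a = p, gamma b = q
      & l = warped_length N phi a b gamma]]).

(* The points of the quotient are the classes {q | d_phi(p, q) = 0}. *)
Definition warped_class {X Y : metricType R} (N : R * R -> R) (phi : X -> R)
    (p : X * Y) : set (X * Y) :=
  [set q | warped_dist N phi p q = 0].

Definition warped_product (X Y : metricType R) (N : R * R -> R)
    (phi : X -> R) : Type :=
  {A : set (X * Y) | exists p, A = warped_class N phi p}.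

Definition warped_proj {X Y : metricType R} (N : R * R -> R) (phi : X -> R)
    (p : X * Y) : warped_product Y N phi :=
  exist _ (warped_class N phi p) (ex_intro _ p erefl).

Definition warped_repr {X Y : metricType R} {N : R * R -> R} {phi : X -> R}
    (A : warped_product Y N phi) : X * Y :=
  sval (cid (svalP A)).

(* Independent of the representatives, [warped_dist] being a pseudometric. *)
Definition warped_mdist {X Y : metricType R} {N : R * R -> R} {phi : X -> R}
    (A B : warped_product Y N phi) : R :=
  warped_dist N phi (warped_repr A) (warped_repr B).

HB.instance Definition _ (X Y : metricType R) (N : R * R -> R) (phi : X -> R) :=
  gen_eqMixin (warped_product Y N phi).
HB.instance Definition _ (X Y : metricType R) (N : R * R -> R) (phi : X -> R) :=
  gen_choiceMixin (warped_product Y N phi).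
HB.instance Definition _ (X Y : pointedMetricType R) (N : R * R -> R)
    (phi : X -> R) :=
  isPointed.Build (warped_product Y N phi) (warped_proj N phi (point, point)).

End WarpedProducts.

Section WarpedMeasure.
Context {R : realType} {X Y : pointedMetricType R}.
Variables (N : R * R -> R) (phi : X -> R).
Variables (muX : {outer_measure set X -> \bar R})
          (muY : {outer_measure set Y -> \bar R}).
Local Open Scope ereal_scope.

Definition warped_measure (A : set (warped_product Y N phi)) : \bar R :=
  prod_outer_measure muX muY (warped_proj N phi @^-1` A).

Let warped_measure0 : warped_measure set0 = 0.
Proof. by rewrite /warped_measure preimage_set0 outer_measure0. Qed.

Let warped_measure_ge0 A : 0 <= warped_measure A.
Proof. exact: outer_measure_ge0. Qed.

Let warped_measure_le : {homo warped_measure : A B / A `<=` B >-> A <= B}.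
Proof. by move=> A B AB; apply: le_outer_measure; exact: preimage_subset. Qed.

Let warped_measure_sigma_subadditive : sigma_subadditive warped_measure.
Proof.
move=> F; rewrite /warped_measure preimage_bigcup.
exact: outer_measure_sigma_subadditive.
Qed.

HB.instance Definition _ := isOuterMeasure.Build R (warped_product Y N phi)
  warped_measure warped_measure0 warped_measure_ge0 warped_measure_le
  warped_measure_sigma_subadditive.

End WarpedMeasure.

Arguments warped_measure {R X Y} N phi muX muY A.
Arguments warped_mdist {R} X Y N phi A B.

(* Main.v *)
Require Import Defs.
From HB Require Import structures.
From mathcomp Require Import all_boot all_order all_algebra.
From mathcomp Require Import all_classical all_reals all_analysis.
From mathcomp Require Import measurable_realfun.
From mathcomp Require Import ess_sup_inf.
From mathcomp Require Import lra ring.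

(** The argument slices the warped product. Write P for the projection of
    X * Y onto the warped product, let u be a function on the latter with an
    upper gradient g in L^p, and pull both back to X * Y.

    The slice at y in Y is an isometric copy of X ([warped_proj_horizontal]), so
    that g restricts to an upper gradient of u there
    ([upper_gradient_pullback]); by Fubini, the Sobolev-Poincare inequality of X
    provides, for almost every y, a constant c(y) with
      int_X |u(x, y) - c(y)|^p dx <= C^p int_X g(x, y)^p dx.
    All that remains is to show that c(y) is the same constant for almost every
    y, after which integration over y concludes.

    The slice at x in X is a copy of Y in which distances are multiplied by at
    most phi(x) ([warped_proj_vertical]). Hence on a ball B of Y that supports a
    Poincare inequality, the average A(x) of u(x, .) over B satisfies
      int_B |u(x, y) - A(x)|^p dy <= K^p phi(x)^p int_Y g(x, y)^p dy.
    Multiplied by the weight W = phi^(-p) 1_E and integrated over x, the right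
    hand side stays finite, so that W |u(., y) - A|^p is integrable over X for
    almost every y in B. Since W is bounded, W |u(., y) - c(y)|^p is integrable
    as well, and W |A - c(y)|^p is too. For two such points y and y' of B, the
    constant |c(y) - c(y')|^p is then integrable against W, whose integral is
    infinite, whence c(y) = c(y') ([weighted_constants_eq]). Thus c is almost
    everywhere constant near every point of Y, and Y, being a separable length
    space, has these local constants agree globally ([ae_locally_constant]).

    Two bodies of theory support this. Geometrically, the metric of the warped
    product is an infimum of integrals of metric speeds of absolutely continuous
    paths, so one needs that the metric speed exists almost everywhere and that
    its integral bounds the distance ([metric_speed_integral]), which rests on
    absolutely continuous functions being integrals
    ([nondecreasing_absolutely_continuous_integral]). Measure-theoretically, the
    product outer measure is identified with the product of the Caratheodory
    restrictions on the product sigma-algebra, up to null sets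
    ([prod_outer_measureE], [caratheodory_fun_prod_measurable]); as P is
    injective off the null set where phi vanishes, integrals over the warped
    product are integrals over X * Y ([transfer_integral]). *)

Set Implicit Arguments.
Unset Strict Implicit.
Unset Printing Implicit Defensive.

Import Order.TTheory GRing.Theory Num.Theory.
Import numFieldNormedType.Exports.

Local Open Scope classical_set_scope.
Local Open Scope ring_scope.

(** * Absolutely continuous functions of a real variable *)

Section AbsolutelyContinuousFunctions.
Context {R : realType}.
Implicit Types (a b s t : R) (f g F : R -> R).

(** The case of a single interval: absolute continuity is uniform continuity. *)
Lemma absolutely_continuous_dist a b f : absolutely_continuous a b f ->
  forall e, 0 < e -> exists2 r, 0 < r &
    forall s t, a <= s <= b -> a <= t <= b -> `|t - s| < r -> `|f t - f s| < e.
Proof.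
move=> acf e /acf[r r0 fr]; exists r => // s t.
wlog st : s t / s <= t => [hw /andP[a_s sb] /andP[a_t tb] str|].
  have [|ts] := leP s t => [/hw|]; first by apply; rewrite ?a_s ?a_t.
  rewrite distrC; apply: hw; rewrite ?a_s ?a_t ?sb ?tb//; first exact: ltW.
  by rewrite distrC.
move=> /andP[a_s sb] /andP[a_t tb] str.
have := fr 1%N (fun=> (s, t)); rewrite !big_ord1 /=; apply => //.
- by apply/trivIsetP => i j _ _; rewrite !ord1 eqxx.
- by rewrite (le_lt_trans _ str)// ler_norm.
Qed.

(** Distances, arc lengths and metric speeds are all compared with one monotone
    absolutely continuous function through this criterion. *)
Lemma absolutely_continuous_dominated a b f F (c : R) :
  (forall s t, a <= s -> s <= t -> t <= b -> `|f t - f s| <= c * (F t - F s)) ->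
  absolutely_continuous a b F -> absolutely_continuous a b f.
Proof.
move=> fF acF e e0.
have c1 : 0 < `|c| + 1 by rewrite ltr_wpDl.
have [r r0 Fr] := acF _ (divr_gt0 e0 c1); exists r => // n I abI tI Ir.
apply: (@le_lt_trans _ _ (\sum_(i < n) (`|c| + 1) * `|F (I i).2 - F (I i).1|)).
  apply: ler_sum => i _; have [a1 I12 b2] := abI i.
  apply: (le_trans (fF _ _ a1 I12 b2)).
  rewrite (le_trans (ler_norm _))// normrM ler_wpM2r// lerDl//.
by rewrite -mulr_sumr -ltr_pdivlMl// mulrC; exact: Fr.
Qed.

Lemma absolutely_continuousD a b f g : absolutely_continuous a b f ->
  absolutely_continuous a b g -> absolutely_continuous a b (f \+ g).
Proof.
move=> acf acg e e0; have e20 : 0 < e / 2 by rewrite divr_gt0.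
have [r r0 fr] := acf _ e20; have [q q0 gq] := acg _ e20.
exists (Num.min r q); first by rewrite lt_min r0.
move=> n I abI tI; rewrite lt_min => /andP[Ir Iq].
rewrite [e]splitr; apply: le_lt_trans (ltrD (fr n I abI tI Ir) (gq n I abI tI Iq)).
rewrite -big_split; apply: ler_sum => i _ /=.
by rewrite (_ : _ - _ = (f (I i).2 - f (I i).1) + (g (I i).2 - g (I i).1)) ?ler_normD//; ring.
Qed.

(** The retraction of the line onto [a, b], which extends functions on an
    interval to the line. *)
Definition clamp a b t := Num.max a (Num.min b t).

Lemma clamp_itv a b t : a <= b -> a <= clamp a b t <= b.
Proof. by move=> ab; rewrite /clamp le_max lexx/= ge_max ab ge_min lexx. Qed.

Lemma clamp_id a b t : a <= t <= b -> clamp a b t = t.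
Proof. by move=> /andP[at_ tb]; rewrite /clamp (min_idPr tb) (max_idPr at_). Qed.

Lemma le_clamp a b s t : s <= t -> clamp a b s <= clamp a b t.
Proof.
move=> st; rewrite /clamp ge_max !le_max lexx/=; apply/orP; right.
by rewrite le_min !ge_min lexx st orbT.
Qed.

Lemma clampB_le a b s t : s <= t -> clamp a b t - clamp a b s <= t - s.
Proof.
move=> st; rewrite lerBlDr {1}/clamp ge_max; apply/andP; split.
  by rewrite ler_wpDl ?subr_ge0// /clamp le_max lexx.
apply: (@le_trans _ _ (t - s + Num.min b s)); last first.
  by rewrite lerD2l /clamp le_max lexx orbT.
by rewrite addr_minr le_min !ge_min ler_wpDl ?subr_ge0//= subrK lexx orbT.
Qed.

Lemma clamp_dist a b s t : `|clamp a b t - clamp a b s| <= `|t - s|.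
Proof.
have [st|/ltW ts] := leP s t.
  by rewrite !ger0_norm ?subr_ge0 ?le_clamp// clampB_le.
by rewrite !ler0_norm ?subr_le0 ?le_clamp// !opprB clampB_le.
Qed.

(** Clamping an interval to [a, b] shortens it and keeps intervals disjoint. *)
Lemma absolutely_continuous_clamp a b F : a <= b ->
  absolutely_continuous a b F -> forall e, 0 < e -> exists2 r, 0 < r &
    forall n (I : 'I_n -> R * R), (forall i, (I i).1 <= (I i).2) ->
      trivIset setT (fun i => [set` `](I i).1, (I i).2[ ]) ->
      \sum_(i < n) ((I i).2 - (I i).1) < r ->
      \sum_(i < n) `|F (clamp a b (I i).2) - F (clamp a b (I i).1)| < e.
Proof.
move=> ab acF e e0; have [r r0 Fr] := acF _ e0; exists r => // n I I12 tI Ir.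
apply: (Fr n (fun i => (clamp a b (I i).1, clamp a b (I i).2))) => /=.
- move=> i; split; last by have /andP[] := clamp_itv (I i).2 ab.
    by have /andP[] := clamp_itv (I i).1 ab.
  exact: le_clamp.
- move/trivIsetP : tI => tI; apply/trivIsetP => i j _ _ ij.
  have clampI k : `]clamp a b (I k).1, clamp a b (I k).2[%classic `<=`
      `](I k).1, (I k).2[%classic.
    move=> x /=; rewrite !in_itv/= => /andP[x1 x2].
    have abx : a <= x <= b.
      have /andP[a1 _] := clamp_itv (I k).1 ab.
      have /andP[_ b2] := clamp_itv (I k).2 ab.
      by rewrite (le_trans a1 (ltW x1)) (le_trans (ltW x2) b2).
    rewrite !ltNge; apply/andP; split; apply/negP => /(@le_clamp a b).
      by rewrite (clamp_id abx) leNgt x1.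
    by rewrite (clamp_id abx) leNgt x2.
  exact: (subsetI_eq0 (clampI i) (clampI j) (tI _ _ Logic.I Logic.I ij)).
- apply: le_lt_trans Ir; apply: ler_sum => i _; exact: clampB_le.
Qed.
End AbsolutelyContinuousFunctions.

(** * Monotone absolutely continuous functions are integrals *)

Section Stieltjes.
Context {R : realType}.
Variables (a b : R) (F : R -> R).
Hypotheses (ab : a <= b)
  (ndF : forall s t, a <= s -> s <= t -> t <= b -> F s <= F t)
  (acF : absolutely_continuous a b F).
Local Notation mu := (@lebesgue_measure R).

(* The Stieltjes measure of F needs a function on the whole line. *)
Let G := F \o clamp a b.

Let nd_G : nondecreasing G.
Proof.
move=> s t st; rewrite /G /=; have /andP[? ?] := clamp_itv s ab.
have /andP[? ?] := clamp_itv t ab.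
by apply: ndF => //; exact: le_clamp.
Qed.

Let continuous_G : continuous G.
Proof.
move=> t; apply/(@cvgrPdist_lt _ R^o) => e e0.
have [r r0 Fr] := absolutely_continuous_dist acF e0.
near=> u; rewrite distrC; apply: Fr; rewrite ?clamp_itv//.
by rewrite (le_lt_trans (clamp_dist _ _ _ _))// distrC.
Unshelve. all: by end_near. Qed.

Let GR : cumulative R R :=
  HB.pack G (isCumulative.Build R _ R G nd_G (right_continuousW continuous_G)).

Let nu : {measure set (measurableTypeR R) -> \bar R} :=
  lebesgue_stieltjes_measure GR.

Let nu_itv s t : s <= t -> nu `]s, t]%classic = (G t - G s)%:E.
Proof.
move=> st.
transitivity (wlength GR `]s, t]%classic); last exact: wlength_itv_bnd.
exact: (@measurable_mu_extE _ R _ (wlength GR) _ (is_ocitv s t)).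
Qed.

Let nu_finite : (nu setT <= (F b - F a)%:E)%E.
Proof.
have mI (n : nat) : measurable `](- n%:R : R), n%:R]%classic by exact: measurable_itv.
have ndI : nondecreasing_seq (fun n : nat => `](- n%:R : R), n%:R]%classic).
  move=> n m nm; apply/subsetPset => x /=; rewrite !in_itv/= => /andP[nx xn].
  have nmR : (n%:R : R) <= m%:R by rewrite ler_nat.
  by rewrite (le_trans xn)// andbT (le_lt_trans _ nx)// lerN2.
have := @nondecreasing_cvg_mu _ _ _ nu _ mI (bigcup_measurable (fun k _ => mI k)) ndI.
rewrite bigcup_itvT => /cvg_lim nuE; rewrite -[X in (X <= _)%E]nuE//.
apply: lime_le; first by apply: ereal_nondecreasing_is_cvgn => n m nm;
  apply: le_measure; rewrite ?inE//; apply/subsetPset/ndI.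
apply: nearW => n /=; rewrite nu_itv; last by rewrite (@le_trans _ _ 0)// oppr_le0.
rewrite lee_fin; have /andP[? ?] := clamp_itv n%:R ab.
have /andP[? ?] := clamp_itv (- n%:R) ab.
by apply: lerB; apply: ndF.
Qed.

(* The intervals ]mesh n i, mesh n i.+1] have length 1/(n+1) and, for
   i < 2 (n+1)^2, exhaust ]-(n+1), n+1]. *)
Let mesh n i : R := i%:R / n.+1%:R - n.+1%:R.

Let mesh_itv n i := `]mesh n i, mesh n i.+1]%classic.

Let mesh_lt n i : mesh n i < mesh n i.+1.
Proof. by rewrite /mesh ltrD2r ltr_pM2r ?invr_gt0// ltr_nat. Qed.

Let mesh_le n i j : (i <= j)%N -> mesh n i <= mesh n j.
Proof. by move=> ij; rewrite /mesh lerD2r ler_wpM2r ?invr_ge0// ler_nat. Qed.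

Let meshB n i : mesh n i.+1 - mesh n i = n.+1%:R^-1.
Proof. by rewrite /mesh -(natr1 i) mulrDl mul1r opprB addrA subrK addrC addKr. Qed.

Let trivIset_mesh n : trivIset setT (mesh_itv n).
Proof.
apply/trivIsetP => i j _ _; wlog ij : i j / (i < j)%N => [hw|_].
  by case: (ltngtP i j) => // ij _; [|rewrite setIC]; apply: hw => //; rewrite neq_ltn ij.
apply/seteqP; split => // x []; rewrite /mesh_itv /= !in_itv/= => /andP[_ xi] /andP[jx _].
by have := lt_le_trans jx xi; rewrite ltNge mesh_le.
Qed.

Let mesh_cover n x : `|x| < n.+1%:R ->
  exists2 i, (i < (n.+1 * n.+1).*2)%N & mesh_itv n i x.
Proof.
rewrite ltr_norml => /andP[nx xn]; pose y := (x + n.+1%:R) * n.+1%:R.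
have n0 : 0 < n.+1%:R :> R by [].
have yK : y <= (n.+1 * n.+1).*2%:R.
  rewrite -muln2 !natrM -mulrA /y [n.+1%:R * 2]mulrC mulrA ler_pM2r// mulr_natr mulr2n.
  by rewrite lerD2r ltW.
have exk : exists k, y <= k%:R by eexists; exact: yK.
case: (ex_minnP exk) => -[|k] yk mink.
  move: yk; rewrite leNgt mulr_gt0//; lra.
have kK : (k.+1 <= (n.+1 * n.+1).*2)%N by exact: mink.
exists k => //; rewrite /mesh_itv /= in_itv/= /mesh ltrBlDr lerBrDr.
rewrite ltr_pdivrMr// ler_pdivlMr// -/y yk andbT ltNge.
by apply/negP => /mink; rewrite ltnn.
Qed.

(** A Lebesgue null set lies in an open set U of small measure. U is the limit
    inferior of the unions M n of the mesh intervals that it contains, and F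
    varies little on M n by absolute continuity, so that the Stieltjes measure
    of U is small. *)
Let nu_dominated : nu `<< mu.
Proof.
apply/null_content_dominatesP => A mA muA.
apply/eqP; rewrite eq_le measure_ge0 andbT; apply/lee_addgt0Pr => e e0.
rewrite add0e.
have [r r0 Fr] := absolutely_continuous_clamp ab acF e0.
have muAoo : (mu A < +oo)%E by rewrite [mu A]muA.
have [U [oU AU UAr]] := lebesgue_regularity_outer mA muAoo r0.
have mU : measurable (U : set (measurableTypeR R)) by exact: open_measurable.
have {UAr} Ur : (mu U < r%:E)%E.
  apply: le_lt_trans UAr; rewrite -[in leLHS](setDUK AU).
  by rewrite (le_trans (measureU2 _ _ _))//= ?muA ?add0e//; exact: measurableD.
pose ok n (i : nat) := `[< mesh_itv n i `<=` U >].
pose D n i := if ok n i then mesh_itv n i else set0.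
pose K n := (n.+1 * n.+1).*2.
pose M n := \big[setU/set0]_(i < K n) D n i.
have mD n i : measurable (D n i : set (measurableTypeR R)).
  by rewrite /D; case: ifP => _ //; exact: measurable_itv.
have trivD n : trivIset setT (D n).
  have /trivIsetP tI := @trivIset_mesh n; apply/trivIsetP => i j _ _ ij.
  by rewrite /D; case: ifP => _; case: ifP => _; rewrite ?set0I ?setI0//; exact: tI.
have MU n : M n `<=` U.
  rewrite /M -bigcup_mkord => x [i _].
  by rewrite /D; case: ifP => // /asboolP; apply.
have mM n : measurable (M n : set (measurableTypeR R)) by exact: bigsetU_measurable.
have nuM n : (nu (M n) <= e%:E)%E.
  pose I (i : 'I_(K n)) := if ok n i then (mesh n i, mesh n i.+1) else (0, 0).
  have I12 i : (I i).1 <= (I i).2.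
    by rewrite /I; case: ifP => //= _; rewrite ltW// mesh_lt.
  rewrite /M (measure_bigsetU nu (mD n) (trivD n)).
  have -> : (\sum_(i < K n) nu (D n i) =
      (\sum_(i < K n) `|F (clamp a b (I i).2) - F (clamp a b (I i).1)|)%:E)%E.
    rewrite -sumEFin; apply: eq_bigr => i _; rewrite /D /I.
    case: ifP => _ /=; last by rewrite subrr normr0 measure0.
    rewrite nu_itv ?ltW ?mesh_lt//= ger0_norm// subr_ge0.
    by apply: nd_G; rewrite ltW// mesh_lt.
  rewrite lee_fin ltW//; apply: Fr => //.
    have /trivIsetP tD := trivD n; apply/trivIsetP => i j _ _ ij.
    have ID k : `](I k).1, (I k).2[%classic `<=` D n k.
      rewrite /I /D; case: ifP => _ /=; last by rewrite set_itvE.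
      by apply: subset_itvl; rewrite bnd_simp.
    exact: (subsetI_eq0 (ID i) (ID j) (tD i j Logic.I Logic.I ij)).
  rewrite -lte_fin (le_lt_trans _ Ur)// (@le_trans _ _ (mu (M n)))//; last first.
    by apply: le_measure; rewrite ?inE; [exact: mM|exact: mU|exact: MU].
  rewrite /M (measure_bigsetU mu (mD n) (trivD n)).
  rewrite -sumEFin lee_sum// => i _.
  rewrite /D /I; case: ifP => _ /=; last by rewrite subrr measure0.
  by rewrite lebesgue_measure_itv/= lte_fin mesh_lt.
pose V n := \bigcap_(m in [set m | (n <= m)%N]) M m.
have UV : U `<=` \bigcup_n V n.
  move=> x Ux; have /nbhs_ballP[d /= d0 xdU] : nbhs x U by exact: open_nbhs_nbhs.
  have [n nx nd] : exists2 n : nat, `|x| < n%:R & d^-1 < n%:R.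
    exists (Num.bound (Num.max `|x| d^-1)).
      by rewrite (le_lt_trans _ (archi_boundP _))// ?le_max ?lexx// normr_ge0.
    by rewrite (le_lt_trans _ (archi_boundP _))// ?le_max ?lexx ?orbT// normr_ge0.
  exists n => // m /= nm.
  have nmR : n%:R < m.+1%:R :> R by rewrite ltr_nat ltnS.
  have [i iK xi] := mesh_cover (lt_trans nx nmR).
  rewrite /M -bigcup_mkord; exists i => //.
  rewrite /D ifT//; apply/asboolP => z zi; apply: xdU; move: zi.
  move: xi; rewrite /mesh_itv/= !in_itv/= => /andP[ix xi] /andP[iz zi].
  have md : mesh m i.+1 - mesh m i < d.
    by rewrite meshB invf_plt ?posrE// (lt_trans nd).
  by rewrite /ball/= ltr_norml; move: (mesh m i) (mesh m i.+1) ix xi iz zi md => *; lra.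
have mV n : measurable (V n : set (measurableTypeR R)).
  by apply: bigcap_measurable => //; exists n => /=.
have nuV n : (nu (V n) <= e%:E)%E.
  apply: le_trans (nuM n); apply: le_measure; rewrite ?inE//.
  by apply: bigcap_inf => /=.
apply: (@le_trans _ _ (nu (\bigcup_n V n))).
  apply: le_measure; rewrite ?inE//; first exact: bigcup_measurable.
  exact: subset_trans UV.
have ndV : nondecreasing_seq V.
  move=> n m nm; apply/subsetPset => x Vx k /= mk; apply: Vx => /=.
  exact: leq_trans mk.
have := @nondecreasing_cvg_mu _ _ _ nu _ mV (bigcup_measurable (fun k _ => mV k)) ndV.
move=> /cvg_lim <- //.
apply: lime_le; last exact: nearW.
by apply: ereal_nondecreasing_is_cvgn => n m nm;
  apply: le_measure; rewrite ?inE//; apply/subsetPset/ndV.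
Qed.

(** The density is the Radon-Nikodym derivative of the Stieltjes measure of F,
    which Lebesgue measure dominates. *)
Lemma nondecreasing_absolutely_continuous_integral :
  exists2 h : R -> R, mu.-integrable setT (EFin \o h) &
    forall s t, a <= s -> s <= t -> t <= b ->
      F t - F s = (\int[mu]_(x in `[s, t]) h x)%R.
Proof.
have nufin : fin_num_fun nu.
  move=> U mU; rewrite ge0_fin_numE// (le_lt_trans _ (ltry (F b - F a)))//.
  by rewrite (le_trans _ nu_finite)// le_measure ?inE.
pose nu' : {finite_measure set (measurableTypeR R) -> \bar R} :=
  HB.pack (Measure.sort nu) (Measure_isFinite.Build _ _ _ (Measure.sort nu) nufin).
have [f [f0 ffin intf nuf]] :=
  @radon_nikodym_sigma_finite _ _ _ mu nu' nu_dominated.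
exists (fine \o f).
  by apply: eq_integrable intf => // x _ /=; rewrite fineK.
move=> s t as_ st tb.
rewrite /Rintegral -(@integral_itv_obnd_cbnd _ s).
  under eq_integral do rewrite /= fineK//.
  rewrite -nuf//= -/nu nu_itv//= /G/= !clamp_id// ?as_ ?tb ?andbT ?(le_trans as_)//.
  exact: le_trans tb.
by apply/measurable_EFinP; apply: (@measurableT_comp _ _ _ _ _ _ fine) => //;
  apply: measurable_funTS; exact: measurable_int intf.
Qed.

End Stieltjes.

(** * Integrals of functions that need not be measurable *)

Section NonmeasurableMonotonicity.
Context d (T : measurableType d) (R : realType).
Variable mu : {measure set T -> \bar R}.
Local Open Scope ereal_scope.
Import HBNNSimple.

(** Metric speeds along a path, and compositions with it, come without a proof
    of measurability. The integral of a nonnegative function being a supremum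
    over simple minorants, it is enough to cut such a minorant down to the
    complement of the null set. *)
Lemma le_integral_off_null (D S : set T) (f g : T -> \bar R) :
  measurable S -> mu S = 0 ->
  (forall x, D x -> 0 <= f x) -> (forall x, D x -> 0 <= g x) ->
  (forall x, D x -> ~ S x -> f x <= g x) ->
  \int[mu]_(x in D) f x <= \int[mu]_(x in D) g x.
Proof.
move=> mS muS f0 g0 fg; rewrite !ge0_integralE//.
apply/ge_ereal_sup => _ [h /= hf <-]; apply: ereal_sup_ubound => /=.
have mCS : measurable (~` S) by exact: measurableC.
exists (proj_nnsfun h mCS); last first.
  rewrite -mrestrict -(integral_nnsfun mu mCS h) -setTD.
  rewrite -(@ge0_negligible_integral _ _ _ mu _ S (EFin \o h))//=.
  - by rewrite integral_nnsfun// patch_setT.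
  - exact/measurable_EFinP.
  - by move=> x _; rewrite lee_fin.
move=> x; rewrite -mrestrict !patchE.
have := hf x; rewrite patchE; case: ifPn => xD hfx; case: ifPn => xS//=.
- apply: (le_trans hfx); apply: fg; first exact/set_mem.
  by move: xS; rewrite inE.
- by apply: g0; exact/set_mem.
Qed.

End NonmeasurableMonotonicity.

Section LebesgueDifferentiation.
Context {R : realType}.
Local Notation mu := (@lebesgue_measure R).

(** Lebesgue differentiation, with the two-sided difference quotient in the
    form in which metric speeds are defined. *)
Lemma integral_difference_quotient (a b : R) (F h : R -> R) :
  mu.-integrable setT (EFin \o h) ->
  (forall s t, a <= s -> s <= t -> t <= b ->
    F t - F s = (\int[mu]_(x in `[s, t]) h x)%R) ->
  {ae mu, forall t, a < t < b -> (F u - F t) / (u - t) @[u --> t^'] --> h t}.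
Proof.
move=> inth Fh.
have loch : locally_integrable setT h.
  by apply: open_integrable_locally => //; exact: openT.
have intI y : mu.-integrable [set` Interval (BLeft a) (BRight y)] (EFin \o h).
  by apply: integrableS inth => //; exact: measurable_itv.
have := FTC1 intI loch.
apply: filterS; first exact: (ae_filter_ringOfSetsType mu).
move=> t /(_ _) H /andP[at_ tb].
have /= := H at_; set G := fun x : R => _ => -[dG Gt].
have {}dG : v^-1 *: (G (v + t) - G t) @[v --> 0^'] --> h t.
  rewrite (_ : (fun v => _) = fun v => v^-1 *: ((G \o shift t) (v *: 1) - G t)).
    by rewrite -Gt derive1E; exact: dG.
  by apply/funext => v /=; rewrite [_ *: 1]mulr1.
apply/(@cvgrPdist_lt _ R^o) => e e0.
move/(@cvgrPdist_lt _ R^o) : dG => /(_ e e0).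
rewrite near_withinE => /nbhs_ballP[r /= r0 rP].
rewrite near_withinE; near=> u => ut.
have ut0 : u - t != 0 by rewrite subr_eq0.
have uab : a < u < b.
  by apply/andP; split; near: u; [exact: lt_nbhsr|exact: lt_nbhsl].
have GF v : a < v < b -> G v = F v - F a.
  by move=> /andP[av vb]; rewrite Fh// ltW.
have := rP (u - t).
rewrite /ball/= sub0r normrN distrC => /(_ _ ut0).
rewrite subrK (GF u uab) (GF t) ?at_ ?tb// [_ *: _]mulrC.
rewrite opprB addrA subrK; apply.
by near: u; apply: (@cvgr_dist_lt _ R^o).
Unshelve. all: by end_near. Qed.

End LebesgueDifferentiation.

(** * Existence and integration of the metric speed *)

Section MetricSpeed.
Context {R : realType} {X : metricType R}.
Local Notation mu := (@lebesgue_measure R).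
Local Notation dist := (@mdist R X).
Variables (a b : R) (gamma : R -> X) (F : R -> R).
Hypotheses (ab : a <= b)
  (acF : absolutely_continuous a b F)
  (gF : forall s t, a <= s -> s <= t -> t <= b ->
    dist (gamma s) (gamma t) <= F t - F s).

Let ndF s t : a <= s -> s <= t -> t <= b -> F s <= F t.
Proof.
by move=> as_ st tb; rewrite -subr_ge0 (le_trans _ (gF as_ st tb))// mdist_ge0.
Qed.

(* A dense sequence of parameters. The distances phi n t to the points gamma (q n)
   recover the metric along gamma, and are real functions dominated by F. *)
Let q n := clamp a b (ratr (odflt 0%Q (unpickle n))).

Let q_itv n : a <= q n <= b. Proof. exact: clamp_itv. Qed.

Let q_dense t e : a <= t <= b -> 0 < e -> exists n, `|q n - t| < e.
Proof.
move=> abt e0; have te : t - e < t + e by rewrite ltrBlDr; lra.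
have [r /[!in_itv]/= /andP[r1 r2]] := rat_in_itvoo te.
exists (pickle r); rewrite /q pickleK /= -[X in _ - X](clamp_id abt).
rewrite (le_lt_trans (clamp_dist _ _ _ _))// ltr_norml; lra.
Qed.

Let dist_sym x y : dist x y = dist y x. Proof. exact: metric_sym. Qed.

Let phi n t := dist (gamma t) (gamma (q n)).

Let phi_dist n s t : `|phi n t - phi n s| <= dist (gamma s) (gamma t).
Proof.
have := metric_triangle (gamma t) (gamma s) (gamma (q n)).
have := metric_triangle (gamma s) (gamma t) (gamma (q n)).
by rewrite [mdist (gamma t) (gamma s)]metric_sym /phi ler_norml; lra.
Qed.

Let phiF n s t : a <= s -> s <= t -> t <= b -> `|phi n t - phi n s| <= F t - F s.
Proof. by move=> as_ st tb; rewrite (le_trans (phi_dist n s t))// gF. Qed.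

Let F_integral : exists2 h : R -> R, mu.-integrable setT (EFin \o h) &
    forall s t, a <= s -> s <= t -> t <= b ->
      F t - F s = (\int[mu]_(x in `[s, t]) h x)%R.
Proof. exact: nondecreasing_absolutely_continuous_integral. Qed.

(* phi n is the difference of the nondecreasing functions F + phi n and F. *)
Let phi_integral n : exists2 f : R -> R, mu.-integrable setT (EFin \o f) &
    forall s t, a <= s -> s <= t -> t <= b ->
      phi n t - phi n s = (\int[mu]_(x in `[s, t]) f x)%R.
Proof.
have [h ih Fh] := F_integral.
have ndG s t : a <= s -> s <= t -> t <= b -> (F \+ phi n) s <= (F \+ phi n) t.
  move=> as_ st tb; have := phiF n as_ st tb; rewrite ler_norml => /andP[+ _] /=; lra.
have acphi : absolutely_continuous a b (phi n).
  by apply: (absolutely_continuous_dominated (c := 1)) acF => s t *; rewrite mul1r phiF.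
have [g ig Gg] := nondecreasing_absolutely_continuous_integral ab ndG
  (absolutely_continuousD acF acphi).
exists (g \- h); first by apply: eq_integrable (integrableB measurableT ig ih).
move=> s t as_ st tb; rewrite RintegralB//; last 2 first.
  by apply: integrableS ig => //; exact: measurable_itv.
  by apply: integrableS ih => //; exact: measurable_itv.
by rewrite -Gg// -Fh//=; ring.
Qed.

(** The speed is the supremum of the absolute derivatives f n of the distances
    to the points gamma (q n). The f n bound it from below because these
    distances are 1-Lipschitz; their supremum m satisfies the integral
    inequality along each q n, hence for the metric by density, and the
    differentiation theorem for m bounds the speed from above. *)
Lemma metric_speed_integral : exists m : R -> R,
  [/\ mu.-integrable setT (EFin \o m), forall t, 0 <= m t,
      forall s t, a <= s -> s <= t -> t <= b ->
        dist (gamma s) (gamma t) <= \int[mu]_(x in `[s, t]) m x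
    & {ae mu, forall t, a < t < b ->
        dist (gamma u) (gamma t) / `|u - t| @[u --> t^'] --> m t}].
Proof.
have [h ih Fh] := F_integral.
have [f ff] : exists f : nat -> R -> R, forall n,
    mu.-integrable setT (EFin \o f n) /\ forall s t, a <= s -> s <= t -> t <= b ->
      phi n t - phi n s = (\int[mu]_(x in `[s, t]) f n x)%R.
  have /choice[f fP] : forall n, exists f : R -> R, mu.-integrable setT (EFin \o f) /\
      forall s t, a <= s -> s <= t -> t <= b ->
      phi n t - phi n s = (\int[mu]_(x in `[s, t]) f x)%R.
    by move=> n; have [f if_ fP] := phi_integral n; exists f.
  by exists f.
have dh := integral_difference_quotient ih Fh.
have df n := integral_difference_quotient (ff n).1 (ff n).2.
(* Truncating at |h| makes m real-valued and integrable everywhere; the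
   truncation is vacuous almost everywhere. *)
pose M t := mine (ereal_sup (range (fun n => `|f n t|%:E))) `|h t|%:E.
have M0 t : (0 <= M t)%E.
  rewrite /M le_min lee_fin normr_ge0 andbT.
  apply: (@le_trans _ _ `|f 0%N t|%:E); first by rewrite lee_fin.
  by apply: ereal_sup_ubound; exists 0%N.
have Mfin t : M t \is a fin_num.
  by rewrite ge0_fin_numE// (le_lt_trans _ (ltry `|h t|))// ge_min lexx orbT.
pose m t := fine (M t).
have mM t : (m t)%:E = M t by rewrite fineK.
have measm : measurable_fun setT (EFin \o m).
  rewrite (_ : EFin \o m = M); last by apply/funext => t /=; rewrite mM.
  apply: measurable_mine.
    rewrite (_ : (fun t => _) = fun t => esups (fun n => `|f n t|%:E) 0%N).
      apply: measurable_fun_esups => n; apply/measurable_EFinP.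
      apply: measurableT_comp => //.
      by apply/measurable_EFinP; exact: measurable_int (ff n).1.
    apply/funext => t; rewrite /esups /sdrop; congr (ereal_sup _).
    by apply/seteqP; split => _ [n _ <-]; exists n.
  apply/measurable_EFinP; apply: measurableT_comp => //.
  by apply/measurable_EFinP; exact: measurable_int ih.
have mh t : m t <= `|h t| by rewrite -lee_fin mM ge_min lexx orbT.
have m0 t : 0 <= m t by exact: fine_ge0.
have im : mu.-integrable setT (EFin \o m).
  apply: (le_integrable _ _ _ ih) => // t _ /=.
  by rewrite lee_fin [leLHS]ger0_norm.
have dfn : {ae mu, forall t, a < t < b -> forall n,
    (phi n u - phi n t) / (u - t) @[u --> t^'] --> f n t}.
  have := ae_foralln df.
  by apply: (@filterS _ _ (ae_filter_ringOfSetsType mu)) => t H abt n; exact: H.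
(* The difference quotients of phi n are dominated by those of F. *)
have fm : {ae mu, forall t, a < t < b ->
    (m t)%:E = ereal_sup (range (fun n => `|f n t|%:E))}.
  apply: (@filterS2 _ _ (ae_filter_ringOfSetsType mu) _ _ _ _ dh dfn) => t /[swap] fn /[swap] abt /(_ abt) hn; rewrite mM /M.
  apply/min_idPl; apply/ge_ereal_sup => _ [n _ <-]; rewrite lee_fin.
  apply: (@le_trans _ _ (h t)); last exact: ler_norm.
  have {}fn : `|(phi n u - phi n t) / (u - t)| @[u --> (t : R)^'] --> `|f n t|.
    by apply: cvg_norm; exact: fn.
  have /andP[lt_at lt_tb] := abt.
  apply: (ler_cvg_to fn hn); rewrite near_withinE; near=> u => /= ut.
  have [au ub] : a <= u /\ u <= b.
    by split; apply/ltW; near: u;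
      [exact: (@lt_nbhsr R _ _ lt_at)|exact: (@lt_nbhsl R _ _ lt_tb)].
  have [at_ tb] := (ltW lt_at, ltW lt_tb).
  move: ut; rewrite neq_lt => /orP[ut|ut].
    rewrite -[leRHS]mulrNN -invrN !opprB normrM normfV.
    rewrite [`|u - t|]ltr0_norm ?subr_lt0// opprB distrC.
    by apply: ler_wpM2r; [rewrite invr_ge0 subr_ge0 ltW|apply: phiF => //; exact: ltW].
  rewrite normrM normfV [`|u - t|]gtr0_norm ?subr_gt0//.
  by apply: ler_wpM2r; [rewrite invr_ge0 subr_ge0 ltW|apply: phiF => //; exact: ltW].
have itvI (g : R -> R) s t : mu.-integrable setT (EFin \o g) ->
    mu.-integrable `[s, t] (EFin \o g).
  by move=> ig; apply: integrableS ig => //; exact: measurable_itv.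
have phim n s t : a <= s -> s <= t -> t <= b ->
   `|phi n t - phi n s| <= \int[mu]_(x in `[s, t]) m x.
  move=> as_ st tb; rewrite (ff n).2//.
  have mst : measurable (`[s, t]%classic : set (measurableTypeR R)) by exact: measurable_itv.
  have le1 := le_normr_Rintegral mst (itvI (f n) s t (ff n).1).
  apply: (le_trans le1).
  rewrite -lee_fin /Rintegral !fineK; last 2 first.
  - by apply: integrable_fin_num => //; exact: itvI.
  - apply: integrable_fin_num => //; have := itvI _ s t (ff n).1.
    by move=> /integrable_abse.
  have [S [mS muS nS]] := fm.
  have m1 x : measurable ([set x] : set (measurableTypeR R)) by exact: measurable_set1.
  have mab : measurable ([set a; b] : set (measurableTypeR R)) by exact: measurableU.
  have muab : mu [set a; b] = 0.
    rewrite measureU0//; [exact: lebesgue_measure_set1|exact: lebesgue_measure_set1].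
  apply: (@le_integral_off_null _ _ _ mu _ (S `|` [set a; b])) => //.
  - exact: measurableU.
  - by rewrite measureU0.
  - move=> x _; exact: m0.
  - move=> x /= xst /not_orP[nSx /not_orP[xa xb]].
    have {}nSx : (m x)%:E = ereal_sup (range (fun n => `|f n x|%:E)).
      apply: contrapT => mx; apply: nSx; apply: nS => /= H; apply: mx; apply: H.
      move: xst; rewrite in_itv/= => /andP[sx xt].
      by rewrite !lt_neqAle (le_trans as_ sx) (le_trans xt tb) !andbT;
        apply/andP; split; apply/eqP => // /esym.
    by rewrite nSx; apply: ereal_sup_ubound; exists n.
have dm s t : a <= s -> s <= t -> t <= b ->
   dist (gamma s) (gamma t) <= \int[mu]_(x in `[s, t]) m x.
  move=> as_ st tb; apply/ler_addgt0Pr => e e0.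
  have e20 : 0 < e / 2 by rewrite divr_gt0.
  have [r r0 Fr] := absolutely_continuous_dist acF e20.
  have abs : a <= s <= b by rewrite as_ (le_trans st).
  have [n qr] := q_dense abs r0.
  have gq : phi n s < e / 2.
    apply: le_lt_trans (Fr _ _ abs (q_itv n) qr); rewrite /phi.
    have /andP[aq qb] := q_itv n; have /andP[_ sb] := abs.
    have [sq|/ltW qs] := leP s (q n); last rewrite dist_sym distrC.
      by rewrite (le_trans (gF _ _ _)) ?ler_norm.
    by rewrite (le_trans (gF _ _ _)) ?ler_norm.
  have := phim n s t as_ st tb; rewrite ler_norml => /andP[_].
  have := metric_triangle (gamma s) (gamma (q n)) (gamma t).
  rewrite -/dist [dist (gamma (q n)) _]dist_sym -/(phi n s) -/(phi n t).
  lra.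
exists m; split => //.
have IB s t : a <= s -> s <= t -> t <= b ->
    \int[mu]_(x in `[a, t]) m x - \int[mu]_(x in `[a, s]) m x =
    \int[mu]_(x in `[s, t]) m x.
  move=> as_ st tb; rewrite Rintegral_itvB ?bnd_simp//; last exact: itvI.
  rewrite Rintegral_itv_obnd_cbnd//; by apply: integrableS im => //; exact: measurable_itv.
have dH := integral_difference_quotient im IB.
apply: (@filterS3 _ _ (ae_filter_ringOfSetsType mu) _ _ _ _ _ dfn fm dH) => t + mt + abt.
move=> /(_ abt) fn /(_ abt) Ht; have {}mt := mt abt.
apply/(@cvgrPdist_lt _ R^o) => e e0.
have e20 : 0 < e / 2 by rewrite divr_gt0.
have [n fnm] : exists n, m t - e / 2 < `|f n t|.
  have : ((m t - e / 2)%:E < ereal_sup (range (fun n => `|f n t|%:E)))%E.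
    by rewrite -mt lte_fin ltrBlDr ltrDl.
  by move=> /ereal_sup_gt[_ [n _ <-]]; rewrite lte_fin => ?; exists n.
have {}fn : `|(phi n u - phi n t) / (u - t)| @[u --> (t : R)^'] --> `|f n t|.
  by apply: cvg_norm; exact: fn.
move/(@cvgrPdist_lt _ R^o) : Ht => /(_ e e0) Hlt.
move/(@cvgrPdist_lt _ R^o) : fn => /(_ (e / 2) e20) flt.
have /andP[lt_at lt_tb] := abt; have [at_ tb] := (ltW lt_at, ltW lt_tb).
near=> u.
have ut : u != t by near: u; exact: nbhs_dnbhs_neq.
have [au ub] : a <= u /\ u <= b.
  by split; apply/ltW; near: u; apply: nbhs_dnbhs;
    [exact: (@lt_nbhsr R _ _ lt_at)|exact: (@lt_nbhsl R _ _ lt_tb)].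
have ut0 : 0 < `|u - t| by rewrite normr_gt0 subr_eq0.
have H1 : dist (gamma u) (gamma t) / `|u - t| <=
   (\int[mu]_(x in `[a, u]) m x - \int[mu]_(x in `[a, t]) m x) / (u - t).
  have [tu|ut'] := leP t u.
    rewrite [`|u - t|]ger0_norm ?subr_ge0// ler_wpM2r ?invr_ge0 ?subr_ge0//.
    by rewrite IB// dist_sym dm.
  rewrite -[leRHS]mulrNN -invrN !opprB [`|u - t|]ltr0_norm ?subr_lt0// opprB.
  by apply: ler_wpM2r; [rewrite invr_ge0 subr_ge0 ltW|rewrite IB ?dm// ltW].
have H2 : `|(phi n u - phi n t) / (u - t)| <= dist (gamma u) (gamma t) / `|u - t|.
  by rewrite normrM normfV ler_wpM2r ?invr_ge0// dist_sym phi_dist.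
have := near Hlt u; have := near flt u.
by rewrite !ltr_norml => /(_ _)/andP[//|_ H3] /(_ _)/andP[//|H4 _]; apply/andP; split; lra.
Unshelve. all: by end_near. Qed.

End MetricSpeed.

(** * Length of paths *)

Section PathLength.
Context {R : realType} {Z : Type} (d : Z -> Z -> R).
Implicit Types (a b s t : R) (gamma : R -> Z).

(** Symmetry is left out so that the warped distance qualifies without
    reversing paths, and separation because it only holds where phi is
    positive. *)
Definition hemimetric : Prop :=
  [/\ forall z, d z z = 0, forall z w, 0 <= d z w
    & forall x y z, d x z <= d x y + d y z].

Hypothesis pd : hemimetric.

Let hemimetric_ge0 z w : 0 <= d z w. Proof. by case: pd. Qed.

(** The recursive form of the sums that define [path_length]. *)
Fixpoint chain_length gamma a (l : seq R) : R :=
  if l is x :: l' then d (gamma a) (gamma x) + chain_length gamma x l' else 0.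

Lemma chain_lengthE gamma a b (l : seq R) :
  \sum_(0 <= i < size l)
    d (gamma (nth b (a :: l) i)) (gamma (nth b (a :: l) i.+1)) =
  chain_length gamma a l.
Proof.
elim: l a => [|x l IH] a; first by rewrite big_nil.
by rewrite /= big_nat_recl// -IH.
Qed.

Lemma chain_length_cat gamma a (l r : seq R) : chain_length gamma a (l ++ r) =
  chain_length gamma a l + chain_length gamma (last a l) r.
Proof.
by elim: l a => [|x l IH] a /=; rewrite ?add0r// IH addrA.
Qed.

Lemma itv_partition_cons a b x (l : seq R) :
  itv_partition a b (x :: l) <-> a < x /\ itv_partition x b l.
Proof.
rewrite /itv_partition /=; split; first by move=> [/andP[-> ->] ->].
by move=> [-> [-> ->]].
Qed.

Lemma itv_partition_exists a b : a <= b -> exists l, itv_partition a b l.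
Proof.
rewrite le_eqVlt => /predU1P[->|ab]; first by exists [::].
by exists [:: b]; exact: itv_partition1.
Qed.

Lemma path_length_chain gamma a b :
  path_length d a b gamma =
  ereal_sup [set (chain_length gamma a l)%:E | l in itv_partition a b].
Proof.
by congr ereal_sup; apply/seteqP; split => _ [l al <-]; exists l; rewrite // chain_lengthE.
Qed.

Lemma chain_length_le gamma a b l : itv_partition a b l ->
  ((chain_length gamma a l)%:E <= path_length d a b gamma)%E.
Proof. by move=> al; rewrite path_length_chain; apply: ereal_sup_ubound; exists l. Qed.

Lemma path_length_ub gamma a b (M : \bar R) :
  (forall l, itv_partition a b l -> ((chain_length gamma a l)%:E <= M)%E) ->
  (path_length d a b gamma <= M)%E.
Proof. by move=> H; rewrite path_length_chain; apply/ge_ereal_sup => _ [l al <-]; exact: H. Qed.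

Lemma path_length_ge0 gamma a b : a <= b -> (0 <= path_length d a b gamma)%E.
Proof.
move=> /itv_partition_exists[l al]; apply: le_trans (chain_length_le gamma al).
rewrite lee_fin; elim: l a {al} => //= x l IH a.
by rewrite addr_ge0 ?hemimetric_ge0.
Qed.

Lemma path_lengthxx gamma a : path_length d a a gamma = 0%E.
Proof.
apply/eqP; rewrite eq_le path_length_ge0// andbT; apply: path_length_ub => l.
by move=> /itv_partitionxx ->.
Qed.

Lemma dist_le_path_length gamma a b : a <= b ->
  ((d (gamma a) (gamma b))%:E <= path_length d a b gamma)%E.
Proof.
rewrite le_eqVlt => /predU1P[->|ab].
  by case: pd => -> _ _; rewrite path_length_ge0.
by have := chain_length_le gamma (itv_partition1 ab); rewrite /= addr0.
Qed.

(** Chains from a to s and from s to t concatenate to chains from a to t. *)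
Lemma path_lengthD_le gamma a s t : a <= s -> s <= t ->
  (path_length d a s gamma + path_length d s t gamma <=
   path_length d a t gamma)%E.
Proof.
move=> as_ st; set M := path_length d a t gamma.
have key l r : itv_partition a s l -> itv_partition s t r ->
    ((chain_length gamma a l + chain_length gamma s r)%:E <= M)%E.
  move=> al sr; have := chain_length_le gamma (itv_partition_cat al sr).
  by rewrite chain_length_cat; case: al => _ /eqP ->.
have [[l al] [r sr]] := (itv_partition_exists as_, itv_partition_exists st).
have [->|Moo] := eqVneq M +oo%E; first by rewrite leey.
have Mfin : M \is a fin_num.
  by rewrite ge0_fin_numE ?path_length_ge0 ?ltey// (le_trans as_).
rewrite -leeBrDr//; last first.
  rewrite ge0_fin_numE ?path_length_ge0//.
  apply: (@le_lt_trans _ _ (M - (chain_length gamma a l)%:E)%E); last first.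
    by rewrite -(fineK Mfin) -EFinB ltry.
  apply: path_length_ub => r' sr'; rewrite leeBrDl// -EFinD; exact: key.
apply: path_length_ub => l' al'; rewrite leeBrDr; last first.
  rewrite ge0_fin_numE ?path_length_ge0//.
  apply: (@le_lt_trans _ _ (M - (chain_length gamma a l)%:E)%E); last first.
    by rewrite -(fineK Mfin) -EFinB ltry.
  apply: path_length_ub => r' sr'; rewrite leeBrDl// -EFinD; exact: key.
rewrite -leeBrDl//; apply: path_length_ub => r' sr'.
by rewrite leeBrDl// -EFinD; exact: key.
Qed.

(** A chain from a to t is lengthened by inserting s. *)
Lemma le_path_lengthD gamma a s t : a <= s -> s <= t ->
  (path_length d a t gamma <=
   path_length d a s gamma + path_length d s t gamma)%E.
Proof.
move=> as_ st; apply: path_length_ub => l; elim: l a as_ => [|x l IH] a as_.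
  move=> _; rewrite adde_ge0// path_length_ge0//.
move=> /itv_partition_cons[ax xl]; rewrite /= EFinD.
have [xs|sx] := leP x s.
  apply: (le_trans (leeD (dist_le_path_length gamma (ltW ax)) (IH x xs xl))).
  by rewrite addeA; apply: leeD => //; exact: path_lengthD_le (ltW ax) xs.
have sl : itv_partition s t (x :: l) by apply/itv_partition_cons.
apply: le_trans (leeD (dist_le_path_length gamma as_) (chain_length_le gamma sl)).
by rewrite -!EFinD lee_fin /= addrA lerD2r; case: pd => _ _; exact.
Qed.

Lemma path_lengthD gamma a s t : a <= s -> s <= t ->
  path_length d a t gamma =
  (path_length d a s gamma + path_length d s t gamma)%E.
Proof.
by move=> as_ st; apply/eqP; rewrite eq_le le_path_lengthD ?path_lengthD_le.
Qed.

Section Rectifiable.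
Variables (a b : R) (gamma : R -> Z).
Hypothesis lfin : (path_length d a b gamma < +oo)%E.

Lemma sub_path_length_fin s t : a <= s -> s <= t -> t <= b ->
  path_length d s t gamma \is a fin_num.
Proof.
move=> as_ st tb; rewrite ge0_fin_numE ?path_length_ge0//; apply: le_lt_trans lfin.
rewrite (path_lengthD gamma as_ (le_trans st tb)) (path_lengthD gamma st tb).
rewrite addeCA leeDl// adde_ge0 ?path_length_ge0//.
Qed.

Local Notation L t := (fine (path_length d a t gamma)).

Lemma arc_lengthB s t : a <= s -> s <= t -> t <= b ->
  path_length d s t gamma = (L t - L s)%:E.
Proof.
move=> as_ st tb; rewrite (path_lengthD gamma as_ st) fineD.
- by rewrite addrAC subrr add0r fineK// sub_path_length_fin.
- exact: sub_path_length_fin (le_trans st tb).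
- exact: sub_path_length_fin.
Qed.

Lemma dist_le_arc_length s t : a <= s -> s <= t -> t <= b ->
  d (gamma s) (gamma t) <= L t - L s.
Proof.
by move=> as_ st tb; rewrite -lee_fin -arc_lengthB//; exact: dist_le_path_length.
Qed.

Lemma le_arc_length s t : a <= s -> s <= t -> t <= b -> L s <= L t.
Proof.
move=> as_ st tb; rewrite -subr_ge0.
by rewrite (le_trans _ (dist_le_arc_length as_ st tb))// hemimetric_ge0.
Qed.

End Rectifiable.

(** The length of any piece of the path is at most the variation of F, from
    which finiteness of the length, continuity and absolute continuity
    follow. The bound in both directions replaces symmetry of d. *)
Lemma ac_path_dominated a b gamma (F : R -> R) : a <= b ->
  absolutely_continuous a b F ->
  (forall s t, a <= s -> s <= t -> t <= b ->
    d (gamma s) (gamma t) <= F t - F s /\ d (gamma t) (gamma s) <= F t - F s) ->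
  ac_path d a b gamma.
Proof.
move=> ab acF gF.
have lF s t : a <= s -> s <= t -> t <= b ->
    (path_length d s t gamma <= (F t - F s)%:E)%E.
  move=> + + tb; move=> as_ st; apply: path_length_ub => l.
  elim: l s as_ st => [|x l IH] s as_ st.
    by move=> /itv_partition_nil ->; rewrite subrr.
  move=> /itv_partition_cons[sx xl]; have xt := itv_partition_le xl.
  have := IH x (le_trans as_ (ltW sx)) xt xl; rewrite !lee_fin /=.
  have [+ _] := gF s x as_ (ltW sx) (le_trans xt tb); lra.
have lfin : (path_length d a b gamma < +oo)%E.
  by rewrite (le_lt_trans (lF a b _ _ _))// ltry.
split; last first.
  apply: (absolutely_continuous_dominated (c := 1)) acF => s t as_ st tb.
  rewrite mul1r -lee_fin ger0_norm; last by rewrite subr_ge0 (le_arc_length lfin).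
  by rewrite -(arc_lengthB lfin)// lF.
split=> //; split=> // t; rewrite in_itv/= => abt.
apply/(@cvgrPdist_lt _ R^o) => e e0.
have [r r0 Fr] := absolutely_continuous_dist acF e0.
rewrite near_withinE; near=> u => abu.
rewrite sub0r normrN ger0_norm ?hemimetric_ge0//.
have utr : `|u - t| < r.
  by rewrite distrC; near: u; apply: (@cvgr_dist_lt _ R^o).
move: abu; rewrite /= in_itv/= => abu.
apply: le_lt_trans (Fr _ _ abt abu utr).
have [[a_t tb] [au ub]] := (andP abt, andP abu).
have [tu|/ltW ut] := leP t u.
  by have [+ _] := gF _ _ a_t tu ub; move=> /le_trans; apply; exact: ler_norm.
rewrite distrC; have [_ +] := gF _ _ au ut tb.
by move=> /le_trans; apply; exact: ler_norm.
Unshelve. all: by end_near. Qed.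

End PathLength.

(** * Parametrization by arc length *)

Section ArcLengthParametrization.
Context {R : realType} {X : metricType R}.
Local Notation dist := (@mdist R X).

Lemma hemimetric_mdist : hemimetric dist.
Proof.
by split; [exact: mdistxx|exact: mdist_ge0|move=> x y z; exact: metric_triangle].
Qed.

Section ArcLength.
Variables (a b : R) (gamma : R -> X).
Hypotheses (cg : path_on dist a b gamma) (lfin : (path_length dist a b gamma < +oo)%E).

Let pd := hemimetric_mdist.
Let L t := fine (path_length dist a t gamma).
Let ab : a <= b. Proof. by case: cg. Qed.

Let path_near t e : a <= t <= b -> 0 < e -> exists2 r, 0 < r &
  forall u, a <= u <= b -> `|u - t| < r -> dist (gamma t) (gamma u) < e.
Proof.
move=> abt e0; have [_ /(_ t)] := cg; rewrite in_itv/= => /(_ abt).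
move=> /(@cvgrPdist_lt _ R^o)/(_ e e0); rewrite near_withinE.
move=> /nbhs_ballP[r /= r0 rP]; exists r => // u abu utr.
have := rP u; rewrite /ball/= distrC => /(_ utr); rewrite in_itv/= => /(_ abu).
by rewrite sub0r normrN ger0_norm// mdist_ge0.
Qed.

(** A partition of [t, b] that realizes the length up to e / 2 still does so
    after inserting a point u next to t, up to the distance from t to u; hence
    the length of [t, u] is at most e. *)
Let arc_length_right t e : a <= t -> t < b -> 0 < e ->
  exists2 u, t < u & u <= b /\ L u <= L t + e.
Proof.
move=> a_t tb e0; have e20 : 0 < e / 2 by rewrite divr_gt0.
have tbfin := sub_path_length_fin pd lfin a_t (ltW tb) (lexx b).
have /ereal_sup_gt[_ [[|x l] tl <-] Hl] :
    ((fine (path_length dist t b gamma) - e / 2)%:E <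
      ereal_sup [set (chain_length dist gamma t l)%:E | l in itv_partition t b])%E.
  by rewrite -path_length_chain -[ltRHS]fineK// lte_fin ltrBlDr ltrDl.
  by have := itv_partition_nil tl => tb'; rewrite tb' ltxx in tb.
have abt : a <= t <= b by rewrite a_t ltW.
have [r r0 rP] := path_near abt e20.
have /itv_partition_cons[tx xl] := tl; have xb := itv_partition_le xl.
pose u := Num.min ((t + x) / 2) (t + r / 2).
have tu : t < u by rewrite lt_min; apply/andP; split; lra.
have ux : u < x by rewrite gt_min; apply/orP; left; lra.
have ub : u <= b by rewrite (le_trans (ltW ux)).
exists u => //; split => //; rewrite -lerBlDl -lee_fin.
rewrite -(arc_lengthB pd lfin a_t (ltW tu) ub).
have ul : itv_partition u b (x :: l) by apply/itv_partition_cons.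
have := chain_length_le dist gamma ul.
have utfin := sub_path_length_fin pd lfin a_t (ltW tu) ub.
have ubfin := sub_path_length_fin pd lfin (le_trans a_t (ltW tu)) ub (lexx b).
rewrite -(fineK ubfin) -(fineK utfin) !lee_fin.
move: Hl; rewrite (path_lengthD pd gamma (ltW tu) ub) fineD// lte_fin /=.
have : dist (gamma t) (gamma u) < e / 2.
  apply: rP; first by rewrite (le_trans a_t (ltW tu)).
  rewrite ger0_norm ?subr_ge0 ?ltW//.
  have : u <= t + r / 2 by rewrite ge_min lexx orbT.
  lra.
have := metric_triangle (gamma t) (gamma u) (gamma x).
lra.
Qed.

Let arc_length_left t e : a < t -> t <= b -> 0 < e ->
  exists2 u, u < t & a <= u /\ L t <= L u + e.
Proof.
move=> a_t tb e0; have e20 : 0 < e / 2 by rewrite divr_gt0.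
have tfin := sub_path_length_fin pd lfin (lexx a) (ltW a_t) tb.
have /ereal_sup_gt[_ [l tl <-] Hl] :
    ((L t - e / 2)%:E <
      ereal_sup [set (chain_length dist gamma a l)%:E | l in itv_partition a t])%E.
  by rewrite -path_length_chain -[ltRHS]fineK// lte_fin ltrBlDr ltrDl.
case/lastP: l tl Hl => [|l x] tl.
  by have := itv_partition_nil tl => tb'; rewrite tb' ltxx in a_t.
case: (tl) => pl /eqP; rewrite last_rcons => xt; rewrite {x}xt in tl pl *.
move: pl; rewrite rcons_path => /andP[pl yt]; set y := last a l in yt.
have ay : a <= y by have := @itv_partition_le _ _ a y l; apply.
rewrite -cats1 chain_length_cat /= addr0 -/y lte_fin => Hl.
have abt : a <= t <= b by rewrite tb ltW.
have [r r0 rP] := path_near abt e20.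
pose u := Num.max ((y + t) / 2) (t - r / 2).
have ut : u < t by rewrite gt_max; apply/andP; split; lra.
have yu : y < u by rewrite lt_max; apply/orP; left; lra.
have au : a <= u by rewrite (le_trans ay (ltW yu)).
exists u => //; split => //.
have ul : itv_partition a u (l ++ [:: u]).
  by apply: (@itv_partition_cat _ _ _ y) => //; exact: itv_partition1.
have := chain_length_le dist gamma ul.
have ufin := sub_path_length_fin pd lfin (lexx a) au (le_trans (ltW ut) tb).
rewrite -(fineK ufin) lee_fin -/(L u) chain_length_cat /= addr0 -/y.
have : dist (gamma t) (gamma u) < e / 2.
  apply: rP; first by rewrite au (le_trans (ltW ut)).
  rewrite ler0_norm ?subr_le0 ?ltW//.
  have : t - r / 2 <= u by rewrite le_max lexx orbT.
  lra.
have := metric_triangle (gamma y) (gamma u) (gamma t).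
rewrite [mdist (gamma u) (gamma t)]metric_sym; lra.
Qed.

Let L_le s t : a <= s -> s <= t -> t <= b -> L s <= L t.
Proof. exact: (le_arc_length pd lfin). Qed.

Let continuous_arc_length : continuous (L \o clamp a b).
Proof.
move=> t; apply/(@cvgrPdist_le _ R^o) => e e0 /=.
set c := clamp a b t; have /andP[ac cb] : a <= c <= b := clamp_itv t ab.
have Hr : \forall u \near nbhs t, L (clamp a b u) <= L c + e.
  have [c_b|bc] := ltP c b; last first.
    apply: nearW => u; have /andP[au ub] := clamp_itv u ab.
    by rewrite (le_trans (L_le au (le_trans ub bc) cb))// lerDl ltW.
  have [v cv [vb Lv]] := arc_length_right ac c_b e0.
  near=> u; apply: le_trans Lv; have /andP[au _] := clamp_itv u ab.
  apply: L_le => //; rewrite -(@clamp_id _ a b v) ?vb ?(le_trans ac (ltW cv))//.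
  apply: le_clamp; apply: ltW; near: u.
  apply: (@lt_nbhsl R); rewrite ltNge; apply/negP => /(@le_clamp _ a b).
  by rewrite -/c clamp_id ?vb ?(le_trans ac (ltW cv))// leNgt cv.
have Hl : \forall u \near nbhs t, L c - e <= L (clamp a b u).
  have [a_c|ca] := ltP a c; last first.
    apply: nearW => u; have /andP[au ub] := clamp_itv u ab.
    by rewrite lerBlDr (le_trans (L_le ac (le_trans ca au) ub))// lerDl ltW.
  have [v cv [av Lv]] := arc_length_left a_c cb e0.
  have vb := le_trans (ltW cv) cb.
  near=> u; rewrite lerBlDr (le_trans Lv)// lerD2r.
  have /andP[_ ub] := clamp_itv u ab.
  apply: L_le => //; rewrite -(@clamp_id _ a b v) ?av//.
  apply: le_clamp; apply: ltW; near: u.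
  apply: (@lt_nbhsr R); rewrite ltNge; apply/negP => /(@le_clamp _ a b).
  rewrite -/c (@clamp_id _ a b v); last by rewrite av vb.
  by rewrite leNgt cv.
near=> u; rewrite ler_norml; apply/andP; split.
  have : L (clamp a b u) <= L c + e by near: u.
  lra.
have : L c - e <= L (clamp a b u) by near: u.
lra.
Unshelve. all: by end_near. Qed.

(** Arc length L is continuous, hence onto [0, L b]; composing gamma with any
    right inverse of L gives a 1-Lipschitz path, since gamma is constant on the
    fibers of L. *)
Lemma arc_length_parametrization : exists2 g : R -> X,
  g 0 = gamma a /\ g (L b) = gamma b &
  forall s t, 0 <= s <= L b -> 0 <= t <= L b -> dist (g s) (g t) <= `|t - s|.
Proof.
have La : L a = 0 by rewrite /L (path_lengthxx pd).
have Lsurj s : exists t, 0 <= s <= L b -> a <= t <= b /\ L t = s.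
  have [s0|] := boolP (0 <= s <= L b); last by exists 0.
  have cL : {within `[a, b], continuous (L \o clamp a b)}.
    exact: continuous_subspaceT continuous_arc_length.
  have [|t] := IVT (v := s) ab cL.
    rewrite /= !clamp_id ?lexx ?ab// La (min_idPl _) ?(max_idPr _)//.
      by case/andP: s0 => /le_trans; apply.
    by case/andP: s0 => /le_trans; apply.
  by rewrite in_itv/= => abt; rewrite clamp_id// => Lt; exists t.
have /choice[T TP] := Lsurj.
have key s t : a <= s <= b -> a <= t <= b -> dist (gamma s) (gamma t) <= `|L t - L s|.
  move=> /andP[as_ sb] /andP[a_t tb]; have [st|/ltW ts] := leP s t.
    by rewrite (le_trans (dist_le_arc_length pd lfin as_ st tb))// ler_norm.
  rewrite metric_sym distrC (le_trans (dist_le_arc_length pd lfin a_t ts sb))//.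
  exact: ler_norm.
have eq s t : a <= s <= b -> a <= t <= b -> L s = L t -> gamma s = gamma t.
  move=> abs abt Lst; apply: mdist_positivity; apply/eqP.
  by rewrite eq_le mdist_ge0 andbT (le_trans (key _ _ abs abt))// Lst subrr normr0.
have Lb0 : 0 <= L b by rewrite -La L_le.
exists (gamma \o T) => /=; first split.
- have [|abT LT] := TP 0; first by rewrite lexx.
  by apply: eq; rewrite ?lexx ?ab// LT La.
- have [|abT LT] := TP (L b); first by rewrite lexx andbT.
  by apply: eq; rewrite ?lexx ?ab.
- move=> s t /TP[abs Ls] /TP[abt Lt].
  by rewrite (le_trans (key _ _ abs abt))// Ls Lt.
Qed.

End ArcLength.

(** Almost shortest paths parametrized by arc length are Lipschitz, hence
    absolutely continuous, and so admissible in the definition of the warped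
    distance. *)
Lemma length_space_lipschitz_path x y e : length_space dist -> 0 < e ->
  exists l (g : R -> X), [/\ 0 <= l, l < dist x y + e, g 0 = x, g l = y &
    forall s t, 0 <= s <= l -> 0 <= t <= l -> dist (g s) (g t) <= `|t - s|].
Proof.
move=> /(_ x y)[_ dxy] e0.
have : ((dist x y)%:E < (dist x y + e)%:E)%E by rewrite lte_fin ltrDl.
rewrite {1}dxy => /ereal_inf_lt[_ [a [b [g [[cg lg] ga gb ->]]]]].
have ab : a <= b by case: cg.
have lfin : path_length dist a b g \is a fin_num.
  by rewrite ge0_fin_numE// (path_length_ge0 hemimetric_mdist).
rewrite -(fineK lfin) lte_fin => lxy.
have [h [h0 hl] hlip] := arc_length_parametrization cg lg.
exists (fine (path_length dist a b g)), h; split => //.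
- by rewrite fine_ge0// (path_length_ge0 hemimetric_mdist).
- by rewrite h0.
- by rewrite hl.
Qed.

End ArcLengthParametrization.

(** * Integrals of metric speeds *)

Section LowerIntegral.
Context d (T : measurableType d) (R : realType).
Variable mu : {measure set T -> \bar R}.
Local Open Scope ereal_scope.
Import HBNNSimple.

(** Reduces inequalities between integrals of arbitrary nonnegative functions to
    their measurable minorants. *)
Lemma integral_le_measurable_minorants (D : set T) (f : T -> \bar R) M :
  (forall x, D x -> 0 <= f x) ->
  (forall h : T -> \bar R, measurable_fun setT h -> (forall x, 0 <= h x) ->
    (forall x, D x -> h x <= f x) -> (forall x, ~ D x -> h x = 0) ->
    \int[mu]_x h x <= M) ->
  \int[mu]_(x in D) f x <= M.
Proof.
move=> f0 hM; rewrite ge0_integralE//; apply/ge_ereal_sup => _ [h /= hf <-].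
have -> : sintegral mu h = \int[mu]_x (h x)%:E.
  by rewrite integral_nnsfun// patch_setT.
apply: hM; first exact/measurable_EFinP.
- by move=> x; rewrite lee_fin.
- by move=> x Dx; have := hf x; rewrite patchE mem_set.
- move=> x nDx; apply/eqP; rewrite eq_le; apply/andP; split; last by rewrite lee_fin.
  by have := hf x; rewrite patchE memNset.
Qed.

Lemma le_integral_pointwise (D : set T) (f g : T -> \bar R) :
  (forall x, D x -> 0 <= f x) -> (forall x, D x -> f x <= g x) ->
  \int[mu]_(x in D) f x <= \int[mu]_(x in D) g x.
Proof.
move=> f0 fg; apply: (@le_integral_off_null _ _ _ mu D set0) => //.
- by move=> x Dx; exact: le_trans (f0 x Dx) (fg x Dx).
- by move=> x Dx _; exact: fg.
Qed.

(** Subadditivity is all that survives without measurability, and is what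
    bounds the warped length of a concatenation from above. *)
Lemma integral_setU_le (A B : set T) (f : T -> \bar R) :
  measurable A -> measurable B -> (forall x, (A `|` B) x -> 0 <= f x) ->
  \int[mu]_(x in A `|` B) f x <=
  \int[mu]_(x in A) f x + \int[mu]_(x in B) f x.
Proof.
move=> mA mB f0; apply: integral_le_measurable_minorants => // h mh h0 hf hn.
have mh' E : measurable_fun E h by exact: measurable_funTS.
have -> : \int[mu]_x h x = \int[mu]_(x in A `|` (B `\` A)) h x.
  rewrite setDE setUIr setUv setIT [RHS]integral_mkcond; apply: eq_integral => x _.
  by rewrite patchE; case: ifPn => //; rewrite notin_setE => /hn.
rewrite ge0_integral_setU//=; [|exact: measurableD|by rewrite disj_set2E setDIK].
apply: leeD; first by apply: le_integral_pointwise => // x Ax; apply: hf; left.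
apply: (@le_trans _ _ (\int[mu]_(x in B) h x)).
  by apply: ge0_subset_integral => //; exact: measurableD.
by apply: le_integral_pointwise => // x Bx; apply: hf; right.
Qed.

End LowerIntegral.

Section LebesgueTranslation.
Context {R : realType}.
Local Notation mu := (@lebesgue_measure R).

Let shiftR (k : R) : measurableTypeR R -> measurableTypeR R := fun t : R => t + k.

Let measurable_shift (k : R) : measurable_fun setT (shiftR k).
Proof. exact: measurable_funD. Qed.

(** Uniqueness of Lebesgue measure on intervals. *)
Lemma lebesgue_measure_shift (k : R) (A : set (measurableTypeR R)) :
  measurable A -> mu A = pushforward mu (fun t : R => t + k) A.
Proof.
move=> mA; apply: (@lebesgue_measure_unique _ (pushforward mu (shiftR k))) => //=.
move=> _ [[x y] _ <-]; rewrite /pushforward /=.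
rewrite (_ : _ @^-1` _ = `]x - k, y - k]%classic); last first.
  by apply/seteqP; split => t /=; rewrite !in_itv/= ltrBlDr lerBrDr.
rewrite !lebesgue_measure_itv/= !lte_fin ltrD2r; case: ifP => // _.
by rewrite -!EFinB; congr EFin; ring.
Qed.

Lemma integral_shift_le (k a b : R) (f : R -> \bar R) :
  (forall t, 0 <= f t)%E ->
  (\int[mu]_(t in `[a, b]) f (t + k)%R <= \int[mu]_(t in `[(a + k)%R, (b + k)%R]) f t)%E.
Proof.
move=> f0; apply: integral_le_measurable_minorants => // h mh h0 hf hn.
pose g (t : R) := h (t - k).
have mg : measurable_fun [set: measurableTypeR R] (g : measurableTypeR R -> \bar R).
  exact: (measurableT_comp mh (measurable_shift (- k))).
have -> : (\int[mu]_x h x = \int[mu]_x g x)%E.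
  transitivity (\int[pushforward mu (shiftR k)]_x g x)%E.
    rewrite (ge0_integral_pushforward (measurable_shift k))//=.
      by apply: eq_integral => x _; rewrite /g /= addrK.
    by move=> t _; exact: h0.
  by apply: eq_measure_integral => A mA _; apply/esym/lebesgue_measure_shift.
have gn t : ~ (`[a + k, b + k]%classic t) -> g t = 0%E.
  move=> nt; apply: hn => /=; rewrite in_itv/= lerBrDr lerBlDr => abt.
  by apply: nt => /=; rewrite in_itv.
rewrite (_ : (\int[mu]_x g x)%E = (\int[mu]_(x in `[(a + k)%R, (b + k)%R]) g x)%E); last first.
  rewrite [RHS]integral_mkcond; apply: eq_integral => x _.
  by rewrite patchE; case: ifPn => //; rewrite notin_setE => /gn.
apply: le_integral_pointwise => t; first by move=> _; exact: h0.
rewrite /= in_itv/= => abt; rewrite -[in leRHS](subrK k t); apply: hf => /=.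
by rewrite in_itv/= lerBrDr lerBlDr.
Qed.

Lemma lebesgue_measure_set2 (a b : R) : mu [set a; b] = 0%E.
Proof.
have m1 x : measurable ([set x] : set (measurableTypeR R)) by exact: measurable_set1.
by rewrite measureU0//; exact: lebesgue_measure_set1.
Qed.

Lemma measurable_set2 (a b : R) : measurable ([set a; b] : set (measurableTypeR R)).
Proof. by apply: measurableU; exact: measurable_set1. Qed.

(** The endpoints of an interval form a null set. *)
Lemma le_integral_itv_interior (a b : R) (f g : R -> \bar R) :
  (forall t, 0 <= f t)%E -> (forall t, 0 <= g t)%E ->
  (forall t, a < t < b -> (f t <= g t)%E) ->
  (\int[mu]_(t in `[a, b]) f t <= \int[mu]_(t in `[a, b]) g t)%E.
Proof.
move=> f0 g0 fg; apply: (le_integral_off_null (@measurable_set2 a b)) => //.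
  exact: lebesgue_measure_set2.
move=> t /=; rewrite in_itv/= => /andP[at_ tb] /not_orP[ta tb'].
by apply: fg; rewrite !lt_neqAle at_ tb !andbT; apply/andP; split; apply/eqP => // /esym.
Qed.

End LebesgueTranslation.

Section MetricSpeedFacts.
Context {R : realType}.

(** The speed at t only depends on the path near t, which identifies the speeds
    of a concatenation with those of its two pieces. *)
Lemma eq_metric_speed {Z Z' : Type} (d : Z -> Z -> R) (d' : Z' -> Z' -> R)
    (g : R -> Z) (g' : R -> Z') (t : R) :
  (\forall u \near nbhs t, d (g u) (g t) = d' (g' u) (g' t)) ->
  metric_speed d g t = metric_speed d' g' t.
Proof.
move=> H; have H' : \forall u \near t^', d (g u) (g t) = d' (g' u) (g' t).
  exact: nbhs_dnbhs.
rewrite /metric_speed; congr lim; apply/seteqP; split => A; rewrite /fmap /=.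
  by apply: filterS2 H' => u /= ->.
by apply: filterS2 H' => u /= <-.
Qed.

Lemma metric_speed_shift {Z : Type} (d : Z -> Z -> R) (g : R -> Z) (k t : R) :
  metric_speed d (fun u => g (u + k)) t = metric_speed d g (t + k).
Proof.
rewrite /metric_speed; congr lim; apply/seteqP; split => A; rewrite /fmap /=.
  rewrite /dnbhs /within /=.
  move=> /nbhs_ballP[r /= r0 rP]; apply/nbhs_ballP; exists r => // u.
  rewrite /ball/= => ur ut; have := rP (u - k); rewrite /ball/= subrK.
  rewrite (_ : t - (u - k) = t + k - u); last by ring.
  rewrite (_ : u - k - t = u - (t + k)); last by ring.
  by move=> /(_ ur); apply; apply: contra ut => /eqP <-; rewrite subrK.
rewrite /dnbhs /within /=.
move=> /nbhs_ballP[r /= r0 rP]; apply/nbhs_ballP; exists r => // u.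
rewrite /ball/= => ur ut; have := rP (u + k); rewrite /ball/=.
rewrite (_ : t + k - (u + k) = t - u); last by ring.
rewrite (_ : u + k - (t + k) = u - t); last by ring.
by move=> /(_ ur); apply; apply: contra ut => /eqP /addIr ->.
Qed.

Variables (Z : Type) (d : Z -> Z -> R).
Hypothesis pd : hemimetric d.

Let d_ge0 z w : 0 <= d z w. Proof. by case: pd. Qed.

Lemma metric_speed_ge0 (g : R -> Z) (t : R) : 0 <= metric_speed d g t.
Proof.
rewrite /metric_speed; have [c|/dvgP->//] := pselect (cvg (d (g u) (g t) / `|u - t| @[u --> t^'])).
by apply: limr_ge => //; apply: nearW => u; rewrite divr_ge0.
Qed.

(** When the limit defining the speed does not exist, its default value is 0,
    which satisfies the bound too. *)
Lemma metric_speed_le (g : R -> Z) (t K : R) : 0 <= K ->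
  (\forall u \near nbhs t, d (g u) (g t) <= K * `|u - t|) -> metric_speed d g t <= K.
Proof.
move=> K0 H; rewrite /metric_speed.
have [c|/dvgP->//] := pselect (cvg (d (g u) (g t) / `|u - t| @[u --> t^'])).
apply: limr_le => //; rewrite near_withinE; near=> u => ut.
by rewrite ler_pdivrMr ?normr_gt0 ?subr_eq0//; near: u.
Unshelve. all: by end_near. Qed.

Lemma metric_speed_cst (z : Z) (t : R) : metric_speed d (fun=> z) t = 0.
Proof.
apply/eqP; rewrite eq_le metric_speed_ge0 andbT; apply: metric_speed_le => //.
by apply: (@nearW _ (nbhs t)) => u; case: pd => -> _ _; rewrite mul0r.
Qed.

Lemma ac_path_dominating (a b : R) (g : R -> Z) : ac_path d a b g ->
  a <= b /\ exists2 F : R -> R, absolutely_continuous a b F &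
    forall s t, a <= s -> s <= t -> t <= b -> d (g s) (g t) <= F t - F s.
Proof.
move=> [[[ab _] lfin] acF]; split => //; eexists; first exact: acF.
by move=> s t as_ st tb; exact: (dist_le_arc_length pd lfin).
Qed.

Lemma absolutely_continuous_id (a b : R) : absolutely_continuous a b id.
Proof.
move=> e e0; exists e => // n I abI _; apply: le_lt_trans.
by apply: ler_sum => i _; rewrite ger0_norm// subr_ge0; have [] := abI i.
Qed.

Lemma ac_path_lipschitz (a b K : R) (g : R -> Z) : a <= b ->
  (forall s t, a <= s <= b -> a <= t <= b -> d (g s) (g t) <= K * `|t - s|) ->
  ac_path d a b g.
Proof.
move=> ab gK; apply: (ac_path_dominated pd (F := fun t => K * t)) => //.
  apply: (absolutely_continuous_dominated (c := `|K|)) (absolutely_continuous_id a b).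
  by move=> s t _ st _; rewrite -mulrBr normrM [`|t - s|]ger0_norm// subr_ge0.
move=> s t as_ st tb; rewrite -mulrBr -[t - s]ger0_norm ?subr_ge0//.
have abs : a <= s <= b by rewrite as_ (le_trans st).
have abt : a <= t <= b by rewrite tb (le_trans as_).
by split; [exact: gK|rewrite distrC; exact: gK].
Qed.

End MetricSpeedFacts.

(** The distance travelled by a path is at most the integral of its speed; this
    is the source of all lower bounds on the warped distance. *)
Lemma speed_integral_ge (R : realType) (X : metricType R) (a b K t : R)
    (gamma : R -> X) (F : R -> R) (g : R -> \bar R) :
  absolutely_continuous a b F ->
  (forall s t, a <= s -> s <= t -> t <= b ->
    mdist (gamma s) (gamma t) <= F t - F s) ->
  a <= t <= b -> 0 <= K -> (forall t, 0 <= g t)%E ->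
  (forall t, a <= t <= b -> ((K * metric_speed mdist gamma t)%:E <= g t)%E) ->
  ((K * mdist (gamma a) (gamma t))%:E <=
   \int[lebesgue_measure]_(t in `[a, b]) g t)%E.
Proof.
move=> acF gF /andP[at_ tb] K0 g0 Kg.
have ab := le_trans at_ tb.
have [m [im m0 dm sm]] := metric_speed_integral ab acF gF.
have mm (E : set (measurableTypeR R)) : measurable_fun E (EFin \o m).
  by apply: measurable_funTS; exact: measurable_int im.
have mI (i : interval R) : measurable ([set` i] : set (measurableTypeR R)).
  exact: measurable_itv.
apply: (@le_trans _ _ (\int[lebesgue_measure]_(t in `[a, t]) (K * m t)%:E)%E).
  under eq_integral do rewrite EFinM.
  rewrite (ge0_integralZl lebesgue_measure (mI `[a, t]) (mm _)) ?lee_fin//; last first.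
    by move=> x _; rewrite /= lee_fin.
  apply: (@le_trans _ _ (K%:E * (mdist (gamma a) (gamma t))%:E)%E) => //.
  apply: lee_wpmul2l; rewrite ?lee_fin// -[leRHS]fineK; first by rewrite lee_fin dm.
  by apply: integrable_fin_num => //; apply: integrableS im.
apply: (@le_trans _ _ (\int[lebesgue_measure]_(t in `[a, b]) (K * m t)%:E)%E).
  apply: (ge0_subset_integral lebesgue_measure (mI `[a, t]) (mI `[a, b])).
  - apply/measurable_EFinP; apply: measurable_funM => //.
    by apply/measurable_EFinP; exact: mm.
  - by move=> x _; rewrite lee_fin mulr_ge0.
  - by apply: subset_itvl; rewrite bnd_simp.
have [S [mS muS nS]] := sm.
apply: (@le_integral_off_null _ _ _ lebesgue_measure _ (S `|` [set a; b])) => //.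
- by apply: measurableU => //; exact: measurable_set2.
- by rewrite (measureU0 mS (measurable_set2 a b) (lebesgue_measure_set2 a b)).
- by move=> x _; rewrite lee_fin mulr_ge0.
move=> x /=; rewrite in_itv/= => abx /not_orP[nSx /not_orP[xa xb]].
apply: le_trans (Kg _ abx); rewrite lee_fin ler_wpM2l//.
have -> // : m x = metric_speed mdist gamma x.
apply: contrapT => mx; apply: nSx; apply: nS => /= H; apply: mx; apply/esym/cvg_lim => //.
apply: H; move: abx => /andP[ax xb'].
by rewrite !lt_neqAle ax xb' !andbT; apply/andP; split; apply/eqP => // /esym.
Qed.

(** * The metric of the warped product *)

(** The infimum defining [warped_dist], before it is known to be finite. *)
Definition extended_warped_dist {R : realType} {X Y : metricType R}
    (N : R * R -> R) (phi : X -> R) (p q : X * Y) : \bar R :=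
  ereal_inf [set l | exists a b gamma,
    [/\ ac_path l1_dist a b gamma, gamma a = p, gamma b = q
      & l = warped_length N phi a b gamma]].

Section WarpedDistance.
Context {R : realType} {X Y : metricType R}.
Variables (N : R * R -> R) (phi : X -> R).
Hypotheses (normN : is_norm2 N) (unitN : unitary N)
  (incrN : coordinate_increasing N)
  (lsX : length_space (@mdist R X)) (lsY : length_space (@mdist R Y))
  (cphi : continuous phi) (phi0 : forall x, 0 <= phi x).

Local Notation mu := (@lebesgue_measure R).
Local Notation l1 := (@l1_dist R X Y).
Local Notation wl := (@warped_length R X Y N phi).

(* The values of the norm on the axes, and its monotonicity, are the only way
   in which it enters. *)
Let N_l s : 0 <= s -> N (s, 0) = s.
Proof.
move=> s0; have [_ NM _] := normN; have [N1 _] := unitN.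
by have := NM s (1, 0); rewrite /= N1 !mulr1 mulr0 ger0_norm.
Qed.

Let N_r s : 0 <= s -> N (0, s) = s.
Proof.
move=> s0; have [_ NM _] := normN; have [_ N1] := unitN.
by have := NM s (0, 1); rewrite /= N1 !mulr1 mulr0 ger0_norm.
Qed.

Let N_ge_l s t : 0 <= s -> 0 <= t -> s <= N (s, t).
Proof. by move=> s0 t0; rewrite -{1}(N_l s0); apply: incrN; rewrite lexx ?s0. Qed.

Let N_ge_r s t : 0 <= s -> 0 <= t -> t <= N (s, t).
Proof. by move=> s0 t0; rewrite -{1}(N_r t0); apply: incrN; rewrite lexx ?t0 ?s0. Qed.

Let speedX (g : R -> X * Y) := metric_speed (@mdist R X) (fun t => (g t).1).
Let speedY (g : R -> X * Y) := metric_speed (@mdist R Y) (fun t => (g t).2).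

Let speedX_ge0 g t : 0 <= speedX g t.
Proof. exact: (metric_speed_ge0 hemimetric_mdist). Qed.

Let speedY_ge0 g t : 0 <= speedY g t.
Proof. exact: (metric_speed_ge0 hemimetric_mdist). Qed.

Let wspeed (g : R -> X * Y) t : \bar R :=
  (N (speedX g t, phi (g t).1 * speedY g t))%:E.

Let wspeed_ge_fst g t : ((speedX g t)%:E <= wspeed g t)%E.
Proof. by rewrite lee_fin; apply: N_ge_l => //; exact: mulr_ge0. Qed.

Let wspeed_ge_snd g t : ((phi (g t).1 * speedY g t)%:E <= wspeed g t)%E.
Proof. by rewrite lee_fin; apply: N_ge_r => //; exact: mulr_ge0. Qed.

Let wspeed_ge0 g t : (0 <= wspeed g t)%E.
Proof. by apply: le_trans (wspeed_ge_fst g t); rewrite lee_fin. Qed.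

Let warped_lengthE a b g : wl a b g = (\int[mu]_(t in `[a, b]) wspeed g t)%E.
Proof. by []. Qed.

Let hemimetric_l1 : hemimetric l1.
Proof.
split; first by move=> z; rewrite /l1_dist !mdistxx addr0.
  by move=> z w; rewrite addr_ge0 ?mdist_ge0.
move=> x y z; rewrite /l1_dist; have := metric_triangle x.1 y.1 z.1.
by have := metric_triangle x.2 y.2 z.2; lra.
Qed.

Let dX_le_l1 p q : mdist p.1 q.1 <= l1 p q.
Proof. by rewrite /l1_dist lerDl mdist_ge0. Qed.

Let dY_le_l1 p q : mdist p.2 q.2 <= l1 p q.
Proof. by rewrite /l1_dist lerDr mdist_ge0. Qed.

Lemma warped_length_ge0 a b g : (0 <= wl a b g)%E.
Proof. by rewrite warped_lengthE integral_ge0. Qed.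

Lemma warped_length_ge_fst a b g t : ac_path l1 a b g -> a <= t <= b ->
  ((mdist (g a).1 (g t).1)%:E <= wl a b g)%E.
Proof.
move=> /(ac_path_dominating hemimetric_l1)[ab [F acF gF]] abt.
rewrite -[mdist _ _]mul1r warped_lengthE.
apply: (speed_integral_ge (gamma := fun t => (g t).1) acF) => //.
  by move=> s u as_ su ub; exact: le_trans (dX_le_l1 _ _) (gF s u as_ su ub).
by move=> s _; rewrite mul1r; exact: wspeed_ge_fst.
Qed.

Lemma warped_length_ge_snd a b g K : ac_path l1 a b g -> 0 <= K ->
  (forall t, a <= t <= b -> K <= phi (g t).1) ->
  ((K * mdist (g a).2 (g b).2)%:E <= wl a b g)%E.
Proof.
move=> /(ac_path_dominating hemimetric_l1)[ab [F acF gF]] K0 Kphi.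
rewrite warped_lengthE.
apply: (speed_integral_ge (gamma := fun t => (g t).2) acF) => //.
- by move=> s u as_ su ub; exact: le_trans (dY_le_l1 _ _) (gF s u as_ su ub).
- by rewrite lexx andbT.
move=> s abs; apply: le_trans (wspeed_ge_snd g s).
by rewrite lee_fin; apply: ler_wpM2r; [exact: speedY_ge0|exact: Kphi].
Qed.

Local Notation wd := (@extended_warped_dist R X Y N phi).

Let wd_ge0 p q : (0 <= wd p q)%E.
Proof. by apply: le_ereal_inf_tmp => _ [a [b [g [_ _ _ ->]]]]; exact: warped_length_ge0. Qed.

Let wd_ge_fst p q : ((mdist p.1 q.1)%:E <= wd p q)%E.
Proof.
apply: le_ereal_inf_tmp => _ [a [b [g [acg <- <- ->]]]].
apply: warped_length_ge_fst => //.
by have [-> _] := ac_path_dominating hemimetric_l1 acg; rewrite lexx.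
Qed.

(** Paths of short warped length starting at p stay in a region where phi is
    bounded below, so that they cannot move in the second factor. *)
Let wd_inj p q : 0 < phi p.1 -> wd p q = 0%E -> p = q.
Proof.
move=> phip pq0.
have pq1 : p.1 = q.1.
  apply: mdist_positivity; apply/eqP; rewrite eq_le mdist_ge0 andbT -lee_fin.
  by apply: (le_trans (wd_ge_fst p q)); rewrite pq0.
suff pq2 : p.2 = q.2 by rewrite [p]surjective_pairing [q]surjective_pairing pq1 pq2.
apply: mdist_positivity; apply/eqP; rewrite eq_le mdist_ge0 andbT.
have phi2 : 0 < phi p.1 / 2 by rewrite divr_gt0.
have [r r0 rP] : exists2 r, 0 < r & forall x, mdist p.1 x < r -> phi p.1 / 2 <= phi x.
  have cp : phi z @[z --> p.1] --> phi p.1 by exact: cphi.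
  move/(@cvgrPdist_lt _ R^o)/(_ _ phi2) : cp => /nbhs_ballP[r /= r0 rP]; exists r => // x px.
  have := rP x; rewrite ballEmdist/= => /(_ px); rewrite ltr_norml; lra.
apply/ler_addgt0Pr => e e0; rewrite add0r.
pose e' := Num.min r (phi p.1 / 2 * e).
have e'0 : 0 < e' by rewrite lt_min r0 mulr_gt0.
have : (wd p q < e'%:E)%E by rewrite pq0 lte_fin.
move=> /ereal_inf_lt[_ [a [b [g [acg ga gb ->]]]] glt].
have Kphi t : a <= t <= b -> phi p.1 / 2 <= phi (g t).1.
  move=> abt; apply: rP; rewrite -ga -lte_fin.
  apply: (le_lt_trans (warped_length_ge_fst acg abt)); apply: (lt_le_trans glt).
  by rewrite lee_fin ge_min lexx.
have := warped_length_ge_snd acg (ltW phi2) Kphi.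
move=> /le_lt_trans/(_ glt); rewrite ga gb lte_fin lt_min => /andP[_].
by rewrite ltr_pM2l// => /ltW.
Qed.

Let wd_le a b g : ac_path l1 a b g -> (wd (g a) (g b) <= wl a b g)%E.
Proof. by move=> acg; apply: ereal_inf_lbound; exists a, b, g. Qed.

Let integral_le_const a b K (f : R -> \bar R) : a <= b -> (forall t, 0 <= f t)%E ->
  (forall t, a < t < b -> (f t <= K%:E)%E) -> 0 <= K ->
  (\int[mu]_(t in `[a, b]) f t <= (K * (b - a))%:E)%E.
Proof.
move=> ab f0 fK K0.
apply: (@le_trans _ _ (\int[mu]_(t in `[a, b]) (cst K%:E) t)%E).
  by apply: le_integral_itv_interior => // t; rewrite lee_fin.
rewrite integral_cst//=.
rewrite lebesgue_measure_itv/= lte_fin; case: ifPn => [_|]; first by rewrite -EFinB -EFinM.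
by rewrite -leNgt mule0 lee_fin mulr_ge0// subr_ge0.
Qed.

Let near_itv a b (t : R) (P : R -> Prop) : a < t < b ->
  (forall u, a <= u <= b -> P u) -> \forall u \near nbhs t, P u.
Proof.
move=> /andP[at_ tb] abP; near=> u; apply: abP; apply/andP.
by split; apply: ltW; near: u; [exact: lt_nbhsr|exact: lt_nbhsl].
Unshelve. all: by end_near. Qed.

(** Moving along the first factor costs its length, whatever phi is. *)
Let wd_horizontal x x' y : (wd (x, y) (x', y) <= (mdist x x')%:E)%E.
Proof.
apply/lee_addgt0Pr => e e0; rewrite -EFinD.
have [l [g [l0 lxx' g0 gl glip]]] := length_space_lipschitz_path x x' lsX e0.
pose h t := (g t, y).
have ach : ac_path l1 0 l h.
  apply: (ac_path_lipschitz hemimetric_l1 (K := 1)) => // s t s0 t0.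
  by rewrite /l1_dist /= mdistxx addr0 mul1r glip.
have := wd_le ach; rewrite /h g0 gl => /le_trans; apply.
apply: (@le_trans _ _ (1 * (l - 0))%:E); last by rewrite lee_fin mul1r subr0 ltW.
apply: integral_le_const => //; first by move=> t; exact: wspeed_ge0.
move=> t t0l.
have -> : metric_speed (@mdist R Y) (fun t => (g t, y).2) t = 0.
  exact: (metric_speed_cst hemimetric_mdist).
rewrite mulr0 lee_fin N_l; last exact: (speedX_ge0 h).
apply: metric_speed_le => //.
apply: (near_itv t0l) => u u0l; rewrite mul1r distrC /=; apply: glip => //.
by case/andP: t0l => /ltW -> /ltW ->.
Qed.

(** Moving along the second factor above a fixed x scales lengths by phi x. *)
Let wd_vertical x y y' : (wd (x, y) (x, y') <= (phi x * mdist y y')%:E)%E.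
Proof.
apply/lee_addgt0Pr => e e0; rewrite -EFinD.
have phi1 : 0 < phi x + 1 by rewrite ltr_wpDl.
have e'0 : 0 < e / (phi x + 1) by rewrite divr_gt0.
have [l [g [l0 lyy' g0 gl glip]]] := length_space_lipschitz_path y y' lsY e'0.
pose h t := (x, g t).
have ach : ac_path l1 0 l h.
  apply: (ac_path_lipschitz hemimetric_l1 (K := 1)) => // s t s0 t0.
  by rewrite /l1_dist /= mdistxx add0r mul1r glip.
have := wd_le ach; rewrite /h g0 gl => /le_trans; apply.
apply: (@le_trans _ _ (phi x * (l - 0))%:E); last first.
  rewrite lee_fin subr0 (@le_trans _ _ (phi x * (mdist y y' + e / (phi x + 1))))//.
    by rewrite ler_wpM2l// ltW.
  rewrite mulrDr lerD2l mulrCA ger_pMr// ler_pdivrMr// mul1r lerDl//.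
apply: integral_le_const => //; first by move=> t; exact: wspeed_ge0.
move=> t t0l.
have -> : metric_speed (@mdist R X) (fun t => (x, g t).1) t = 0.
  exact: (metric_speed_cst hemimetric_mdist).
rewrite lee_fin N_r; last by rewrite mulr_ge0//; exact: (speedY_ge0 h).
apply: ler_piMr => //.
apply: metric_speed_le => //.
apply: (near_itv t0l) => u u0l; rewrite mul1r distrC /=; apply: glip => //.
by case/andP: t0l => /ltW -> /ltW ->.
Qed.

Let l1_sym p q : l1 p q = l1 q p.
Proof. by rewrite /l1_dist metric_sym [mdist p.2 _]metric_sym. Qed.

Section Concatenation.
Variables (a b c e : R) (g1 g2 : R -> X * Y).
Hypotheses (ac1 : ac_path l1 a b g1) (ac2 : ac_path l1 c e g2) (g12 : g1 b = g2 c).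

Let k := c - b.
Let b' := b + (e - c).
Let g t := if t <= b then g1 t else g2 (t + k).

(** The sum of the two dominating functions, each clamped to its own interval,
    dominates the concatenated path. *)
Let ac_concatenation : ac_path l1 a b' g.
Proof.
have [ab [F1 acF1 gF1]] := ac_path_dominating hemimetric_l1 ac1.
have [ce [F2 acF2 gF2]] := ac_path_dominating hemimetric_l1 ac2.
pose F t := F1 (clamp a b t) + F2 (clamp c e (t + k)).
have bb' : b <= b' by rewrite /b' lerDl subr_ge0.
have bk : b + k = c by rewrite /k subrKC.
have b'k : b' + k = e by rewrite /b' /k; ring.
have ab' : a <= b' by exact: le_trans bb'.
have acF : absolutely_continuous a b' F.
  apply: absolutely_continuousD => eps eps0.
    have [r r0 rF] := absolutely_continuous_clamp ab acF1 eps0.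
    by exists r => // n I abI tI Ir; apply: rF => // i; have [] := abI i.
  have [r r0 rF] := absolutely_continuous_clamp ce acF2 eps0.
  exists r => // n I abI tI Ir.
  apply: (rF n (fun i => ((I i).1 + k, (I i).2 + k))) => /=.
  - by move=> i; rewrite lerD2r; have [] := abI i.
  - move/trivIsetP : tI => tI; apply/trivIsetP => i j _ _ ij.
    apply/seteqP; split => // x [] /=; rewrite !in_itv/= => /andP[? ?] /andP[? ?]; 
    have /seteqP[+ _] := tI i j Logic.I Logic.I ij.
    by move/(_ (x - k)); apply; split; rewrite /= in_itv /=; apply/andP; split; lra.
  - apply: le_lt_trans Ir; apply: ler_sum => i _; lra.
apply: (ac_path_dominated hemimetric_l1 ab' acF) => s t as_ st tb.
suff : l1 (g s) (g t) <= F t - F s by rewrite (l1_sym (g t)).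
have clampl u : u <= b -> clamp c e (u + k) = c.
  by move=> ub; apply: max_l; rewrite ge_min -bk lerD2r ub orbT.
have clampr u : b <= u -> clamp a b u = b.
  by move=> bu; rewrite /clamp (min_idPl bu) (max_idPr ab).
have clamp2 u : b <= u -> u <= b' -> clamp c e (u + k) = u + k.
  by move=> bu ub; rewrite clamp_id// -{1}bk -b'k !lerD2r bu.
have clamp1 u : a <= u -> u <= b -> clamp a b u = u by move=> au ub; rewrite clamp_id ?au.
have ck u : b <= u -> c <= u + k by move=> bu; rewrite -bk lerD2r.
have ke u : u <= b' -> u + k <= e by move=> bu; rewrite -b'k lerD2r.
rewrite /g /F; have [tb1|bt] := leP t b.
  have sb := le_trans st tb1; rewrite sb !clampl// !clamp1// ?(le_trans as_)//.
  by rewrite opprD addrACA subrr addr0 gF1.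
have [sb|bs] := leP s b; last first.
  rewrite (clampr s (ltW bs)) (clampr t (ltW bt)) (clamp2 s (ltW bs) (le_trans st tb)).
  rewrite (clamp2 t (ltW bt) tb).
  rewrite opprD addrACA subrr add0r; apply: gF2; rewrite ?lerD2r//.
    exact/ck/ltW.
  exact: ke.
rewrite (clampl s)// (clamp2 t (ltW bt))// (clampr t (ltW bt)) (clamp1 s)//.
rewrite opprD addrACA; case: hemimetric_l1 => _ _ /(_ _ (g1 b) _)/le_trans; apply.
by apply: lerD; [exact: gF1|rewrite g12; apply: gF2 => //; [exact/ck/ltW|exact: ke]].
Qed.

Let wspeed_congr h h' t k' : h t = h' (t + k') ->
  (\forall u \near nbhs t, h u = h' (u + k')) -> wspeed h t = wspeed h' (t + k').
Proof.
move=> ht hu; rewrite /wspeed ht /speedX /speedY.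
rewrite -(metric_speed_shift mdist (fun t => (h' t).1)).
rewrite -(metric_speed_shift mdist (fun t => (h' t).2)).
have hu' Z (f : X * Y -> Z) (d : Z -> Z -> R) : \forall u \near nbhs t,
    d (f (h u)) (f (h t)) = d (f (h' (u + k'))) (f (h' (t + k'))).
  by near=> u; rewrite ht; have -> : h u = h' (u + k') by near: u.
by rewrite (eq_metric_speed (hu' _ fst _)) (eq_metric_speed (hu' _ snd _)).
Unshelve. all: by end_near. Qed.

Lemma extended_warped_dist_concatenation : (wd (g1 a) (g2 e) <= wl a b g1 + wl c e g2)%E.
Proof.
have [ab _] := ac_path_dominating hemimetric_l1 ac1.
have [ce _] := ac_path_dominating hemimetric_l1 ac2.
have bb' : b <= b' by rewrite /b' lerDl subr_ge0.
have bk : b + k = c by rewrite /k subrKC.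
have b'k : b' + k = e by rewrite /b' /k; ring.
have ga : g a = g1 a by rewrite /g ab.
have gb : g b' = g2 e.
  rewrite /g b'k; case: ifPn => // b'b.
  have b'E : b' = b by apply/eqP; rewrite eq_le b'b bb'.
  by rewrite b'E g12; congr g2; move: b'E; rewrite /b'; lra.
apply: (@le_trans _ _ (wl a b' g)); first by rewrite -ga -gb; exact: wd_le.
rewrite !warped_lengthE.
have -> : `[a, b']%classic = `[a, b]%classic `|` `[b, b']%classic.
  apply/seteqP; split => t /=; rewrite !in_itv/=.
    by move=> /andP[at_ tb]; have [?|/ltW ?] := leP t b; [left|right]; apply/andP.
  by case=> /andP[? ?]; apply/andP; split => //; [exact: le_trans bb'|exact: le_trans ab _].
have mI (i : interval R) : measurable ([set` i] : set (measurableTypeR R)).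
  exact: measurable_itv.
apply: (@le_trans _ _ (\int[mu]_(t in `[a, b]) wspeed g t +
    \int[mu]_(t in `[b, b']) wspeed g t)%E).
  by apply: integral_setU_le.
apply: leeD.
  apply: le_integral_itv_interior => // t /andP[at_ tb].
  have gg1 : \forall u \near nbhs t, g u = g1 (u + 0).
    by near=> u; rewrite addr0 /g ifT//; apply: ltW; near: u; exact: lt_nbhsl.
  by rewrite (wspeed_congr _ gg1) addr0// /g ltW.
apply: (@le_trans _ _ (\int[mu]_(t in `[b, b']) wspeed g2 (t + k)%R)%E).
  apply: le_integral_itv_interior => // t /andP[bt tb].
  have gg2 : \forall u \near nbhs t, g u = g2 (u + k).
    by near=> u; rewrite /g leNgt ifN// negbK; near: u; exact: lt_nbhsr.
  by rewrite (wspeed_congr _ gg2)// /g leNgt bt.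
have := integral_shift_le k b b' (wspeed_ge0 g2).
by rewrite bk b'k.
Unshelve. all: by end_near. Qed.

End Concatenation.

Let wd_triangle p q r : (wd p r <= wd p q + wd q r)%E.
Proof.
have [->|pq] := eqVneq (wd p q) +oo%E.
  by rewrite addye ?leey// -ltNye (lt_le_trans _ (wd_ge0 _ _)).
have [->|qr] := eqVneq (wd q r) +oo%E.
  by rewrite addey ?leey// -ltNye (lt_le_trans _ (wd_ge0 _ _)).
have pqfin : wd p q \is a fin_num by rewrite ge0_fin_numE// ltey.
have qrfin : wd q r \is a fin_num by rewrite ge0_fin_numE// ltey.
apply/lee_addgt0Pr => e e0; have e20 : 0 < e / 2 by rewrite divr_gt0.
have : (wd p q < wd p q + (e / 2)%:E)%E by rewrite lteDl// lte_fin.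
move=> /ereal_inf_lt[_ [a [b [g1 [ac1 ga gb ->]]]] lt1].
have : (wd q r < wd q r + (e / 2)%:E)%E by rewrite lteDl// lte_fin.
move=> /ereal_inf_lt[_ [c [f [g2 [ac2 gc gf ->]]]] lt2].
rewrite [X in (_ + X%:E)%E]splitr EFinD addeACA -/(wd p r) -ga -gf.
have gbc : g1 b = g2 c by rewrite gb gc.
apply: (le_trans (extended_warped_dist_concatenation ac1 ac2 gbc)).
by apply: leeD; apply: ltW; rewrite ?ga ?gf.
Qed.

Let wd_fin p q : wd p q \is a fin_num.
Proof.
rewrite ge0_fin_numE//; apply: (le_lt_trans (wd_triangle p (q.1, p.2) q)).
rewrite lte_add_pinfty//.
  by rewrite [p in wd p]surjective_pairing (le_lt_trans (wd_horizontal _ _ _))// ltry.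
by rewrite [q in wd _ q]surjective_pairing (le_lt_trans (wd_vertical _ _ _))// ltry.
Qed.

Local Notation wdist := (@warped_dist R X Y N phi).
Local Notation wclass := (@warped_class R X Y N phi).

Let warped_distE p q : (wdist p q)%:E = wd p q.
Proof. by rewrite /warped_dist fineK//; exact: wd_fin. Qed.

Lemma warped_dist_triangle p q r :
  wdist p r <= wdist p q + wdist q r.
Proof. by rewrite -lee_fin EFinD !warped_distE. Qed.

Lemma warped_dist_ge_fst p q : mdist p.1 q.1 <= wdist p q.
Proof. by rewrite -lee_fin warped_distE. Qed.

Lemma warped_dist_ge0 p q : 0 <= wdist p q.
Proof. by rewrite -lee_fin warped_distE. Qed.

Lemma warped_dist_horizontal x x' y :
  wdist (x, y) (x', y) = mdist x x'.
Proof.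
apply/eqP; rewrite eq_le -lee_fin warped_distE wd_horizontal/=.
exact: (warped_dist_ge_fst (x, y) (x', y)).
Qed.

Lemma warped_dist_vertical x y y' :
  wdist (x, y) (x, y') <= phi x * mdist y y'.
Proof. by rewrite -lee_fin warped_distE. Qed.

Lemma warped_distxx p : wdist p p = 0.
Proof. by case: p => x y; rewrite warped_dist_horizontal mdistxx. Qed.

Lemma warped_dist_eq0 p q : 0 < phi p.1 -> wdist p q = 0 -> p = q.
Proof. by move=> phip pq; apply: wd_inj => //; rewrite -warped_distE pq. Qed.

Local Notation P := (@warped_proj R X Y N phi).
Local Notation dist := (@warped_mdist R X Y N phi).

Let warped_class_refl p : wclass p p.
Proof. exact: warped_distxx. Qed.

Let warped_classK p : wclass (warped_repr (P p)) = wclass p.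
Proof. by rewrite /warped_repr; case: cid => q /= <-. Qed.

(** Both distances between p and the representative of its class vanish, since
    each of the two points lies in the class of the other. *)
Lemma warped_mdist_proj p q : dist (P p) (P q) = wdist p q.
Proof.
have repr_l r : wdist (warped_repr (P r)) r = 0.
  by have := warped_class_refl r; rewrite -{1}warped_classK.
have repr_r r : wdist r (warped_repr (P r)) = 0.
  by have := warped_class_refl (warped_repr (P r)); rewrite {1}warped_classK.
apply/eqP; rewrite eq_le /warped_mdist; apply/andP; split.
  rewrite (le_trans (warped_dist_triangle _ p _))// repr_l add0r.
  by rewrite (le_trans (warped_dist_triangle _ q _))// repr_r addr0.
rewrite (le_trans (warped_dist_triangle _ (warped_repr (P p)) _))// repr_r add0r.
by rewrite (le_trans (warped_dist_triangle _ (warped_repr (P q)) _))// repr_l addr0.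
Qed.

(** Classes are sets packed with a proof of existence; irrelevance of that proof
    identifies them. *)
Lemma warped_proj_surj (A : warped_product Y N phi) : exists p, A = P p.
Proof.
case: A => A [p Ap]; exists p; rewrite /warped_proj.
by move: (ex_intro _ _ _); rewrite Ap => ?; congr exist; exact: Prop_irrelevance.
Qed.

Lemma warped_proj_inj p q : 0 < phi p.1 -> P p = P q -> p = q.
Proof.
by move=> phip pq; apply: warped_dist_eq0 => //; rewrite -warped_mdist_proj pq
  warped_mdist_proj warped_distxx.
Qed.

Lemma hemimetric_warped_mdist : hemimetric dist.
Proof.
split=> [A|A B|A B C].
- by have [p ->] := warped_proj_surj A; rewrite warped_mdist_proj warped_distxx.
- exact: warped_dist_ge0.
- exact: warped_dist_triangle.
Qed.

Lemma warped_proj_horizontal x x' y : dist (P (x, y)) (P (x', y)) = mdist x x'.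
Proof. by rewrite warped_mdist_proj warped_dist_horizontal. Qed.

Lemma warped_proj_vertical x y y' :
  dist (P (x, y)) (P (x, y')) <= phi x * mdist y y'.
Proof. by rewrite warped_mdist_proj warped_dist_vertical. Qed.

Lemma warped_proj_le x x' y y' :
  dist (P (x, y)) (P (x', y')) <= phi x * mdist y y' + mdist x x'.
Proof.
rewrite -(warped_proj_horizontal x x' y').
case: hemimetric_warped_mdist => _ _ /(_ _ (P (x, y')) _)/le_trans; apply.
by rewrite lerD2r warped_proj_vertical.
Qed.

Lemma warped_proj_ge_fst p q : mdist p.1 q.1 <= dist (P p) (P q).
Proof. by rewrite warped_mdist_proj warped_dist_ge_fst. Qed.

End WarpedDistance.

(** * The product outer measure and the product measure *)

Section SigmaFinite.
Context {R : realType} {T : pointedType}.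
Variable mu : {outer_measure set T -> \bar R}.
Hypothesis sf : sigma_finite [set: caratheodory_type mu]
  (mu : set (caratheodory_type mu) -> \bar R).

Let m : {measure set (caratheodory_type mu) -> \bar R} :=
  (mu : set (caratheodory_type mu) -> \bar R).

(** The packed structure under which Fubini applies to an outer measure. *)
Definition sigma_finite_caratheodory :
    {sigma_finite_measure set (caratheodory_type mu) -> \bar R} :=
  HB.pack (Measure.sort m) (Measure_isSigmaFinite.Build _ _ _ (Measure.sort m) sf).

End SigmaFinite.

Lemma ereal_rat_dense {R : realType} (x y : \bar R) : (x < y)%E ->
  exists r : rat, (x < (ratr r)%:E)%E /\ ((ratr r)%:E < y)%E.
Proof.
have key (a b : R) : a < b -> exists r : rat, a < ratr r /\ ratr r < b.
  by move=> /rat_in_itvoo[r]; rewrite in_itv/= => /andP[]; exists r.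
case: x y => [x| |] [y| |]//; rewrite ?lte_fin.
- by move=> /key[r [? ?]]; exists r; rewrite !lte_fin.
- have [|r [xr _]] := key x (x + 1); first by rewrite ltrDl.
  by exists r; rewrite lte_fin ltry.
- have [|r [_ ry]] := key (y - 1) y; first by rewrite gtrBl.
  by exists r; rewrite lte_fin ltNyr.
- by exists 0%Q; rewrite ltNyr ltry.
Qed.

(** [prod_outer_measure] as a bundled outer measure, so that its restriction to
    the Caratheodory sigma-algebra is recognized as a measure. *)
Definition bundled_prod_outer_measure {R : realType} {X Y : Type}
    (muX : {outer_measure set X -> \bar R})
    (muY : {outer_measure set Y -> \bar R}) :
  {outer_measure set (X * Y) -> \bar R} := prod_outer_measure muX muY.

Section ProductOuterMeasureTheory.
Context {R : realType} {X Y : pointedType}.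
Variables (muX : {outer_measure set X -> \bar R})
          (muY : {outer_measure set Y -> \bar R}).
Local Open Scope ereal_scope.
Local Notation TX := (caratheodory_type muX).
Local Notation TY := (caratheodory_type muY).
Local Notation pi := (bundled_prod_outer_measure muX muY).

Let muX_ge0 A : 0 <= muX A. Proof. exact: outer_measure_ge0. Qed.
Let muY_ge0 A : 0 <= muY A. Proof. exact: outer_measure_ge0. Qed.

Lemma prod_outer_measure_cover_le (A : set (X * Y)) (F : nat -> set X * set Y) :
  rectangle_cover muX muY A F -> pi A <= \sum_(k <oo) (muX (F k).1 * muY (F k).2).
Proof. by move=> AF; apply: ereal_inf_lbound; exists F. Qed.

Let setX_split (A1 A : set X) (B1 B : set Y) :
  muX.-caratheodory A -> muY.-caratheodory B ->
  muX A1 * muY B1 = muX (A1 `&` A) * muY (B1 `&` B) +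
   (muX (A1 `&` ~` A) * muY B1 + muX (A1 `&` A) * muY (B1 `&` ~` B)).
Proof.
move=> mA mB; rewrite [in LHS]mA ge0_muleDl// [X in X + _ = _](_ : _ =
  muX (A1 `&` A) * (muY (B1 `&` B) + muY (B1 `&` ~` B))); last by rewrite -mB.
by rewrite ge0_muleDr// -addeA; congr (_ + _); rewrite addeC.
Qed.

(** Each rectangle of a cover of T splits into its part in A * B and two
    rectangles that cover the rest; measurability of the sides makes the
    areas add up ([setX_split]). *)
Lemma caratheodory_setX (A : set X) (B : set Y) :
  muX.-caratheodory A -> muY.-caratheodory B -> pi.-caratheodory (A `*` B).
Proof.
move=> mA mB; apply: le_caratheodory_measurable => T.
apply: le_ereal_inf_tmp => _ [F [mF TF] <-].
pose F0 k := ((F k).1 `&` A, (F k).2 `&` B).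
pose F1 k := ((F k).1 `&` ~` A, (F k).2).
pose F2 k := ((F k).1 `&` A, (F k).2 `&` ~` B).
have mI1 k : muX.-caratheodory ((F k).1 `&` A).
  by apply: caratheodory_measurable_setI => //; have [] := mF k.
have mC1 k : muX.-caratheodory ((F k).1 `&` ~` A).
  by apply: caratheodory_measurable_setI;
    [have [] := mF k|exact: caratheodory_measurable_setC].
have mI2 k : muY.-caratheodory ((F k).2 `&` B).
  by apply: caratheodory_measurable_setI => //; have [] := mF k.
have mC2 k : muY.-caratheodory ((F k).2 `&` ~` B).
  by apply: caratheodory_measurable_setI;
    [have [] := mF k|exact: caratheodory_measurable_setC].
pose S1 := \bigcup_k ((F1 k).1 `*` (F1 k).2).
pose S2 := \bigcup_k ((F2 k).1 `*` (F2 k).2).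
have E0 : pi (T `&` A `*` B) <= \sum_(k <oo) (muX (F0 k).1 * muY (F0 k).2).
  apply: prod_outer_measure_cover_le; split; first by move=> k; split; [exact: mI1|exact: mI2].
  by move=> z [/TF[k _ [Fz1 Fz2]] [Az Bz]]; exists k.
have E1 : pi S1 <= \sum_(k <oo) (muX (F1 k).1 * muY (F1 k).2).
  by apply: prod_outer_measure_cover_le; split => // k; split; [exact: mC1|exact: (mF k).2].
have E2 : pi S2 <= \sum_(k <oo) (muX (F2 k).1 * muY (F2 k).2).
  by apply: prod_outer_measure_cover_le; split => // k; split; [exact: mI1|exact: mC2].
have E12 : pi (T `&` ~` (A `*` B)) <= pi S1 + pi S2.
  apply: le_trans (outer_measureU2 pi S1 S2); apply: le_outer_measure.
  move=> z [/TF[k _ [Fz1 Fz2]] nAB]; have [Az|nAz] := pselect (A z.1).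
    by right; exists k => //; split; split => // Bz; apply: nAB.
  by left; exists k.
have ge0 (G : nat -> set X * set Y) k : 0 <= muX (G k).1 * muY (G k).2.
  by rewrite mule_ge0.
rewrite [leRHS](_ : _ = \sum_(k <oo) (muX (F0 k).1 * muY (F0 k).2) +
    (\sum_(k <oo) (muX (F1 k).1 * muY (F1 k).2) +
     \sum_(k <oo) (muX (F2 k).1 * muY (F2 k).2))); last first.
  rewrite -nneseriesD// -nneseriesD//; last by move=> *; rewrite adde_ge0.
  by apply: eq_eseriesr => k _; exact: setX_split.
by apply: leeD => //; apply: (le_trans E12); exact: leeD.
Qed.

Lemma prod_measurable_caratheodory (A : set (TX * TY)) :
  measurable A -> pi.-caratheodory A.
Proof.
rewrite measurable_prod_measurableType; apply.
split; last by move=> _ [B mB [C mC <-]]; exact: caratheodory_setX.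
have := @sigma_algebra_measurable _ (caratheodory_type pi).
by [].
Qed.

Lemma measurable_id_prod : measurable_fun [set: caratheodory_type pi]
  (id : caratheodory_type pi -> TX * TY).
Proof.
by move=> _ A mA; rewrite setTI preimage_id; exact: prod_measurable_caratheodory.
Qed.

Hypotheses
  (sfX : sigma_finite [set: TX] (muX : set TX -> \bar R))
  (sfY : sigma_finite [set: TY] (muY : set TY -> \bar R)).
Local Notation mX := (sigma_finite_caratheodory sfX).
Local Notation mY := (sigma_finite_caratheodory sfY).
Local Notation nu := (mX \x mY).

Let nu_setX (A : set TX) (B : set TY) : measurable A -> measurable B ->
  nu (A `*` B) = muX A * muY B.
Proof. by move=> mA mB; rewrite product_measure1E. Qed.

(** The outer measure is a measure on the product sigma-algebra that agrees with
    the product measure on rectangles, where the lower bound is the countable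
    subadditivity of the product measure; uniqueness concludes. *)
Lemma prod_outer_measureE (A : set (TX * TY)) : measurable A -> pi A = nu A.
Proof.
move=> mA.
have H (m' : {measure set (TX * TY) -> \bar R}) :
    (forall B, m' B = pi B) -> nu A = m' A.
  move=> m'E; apply: product_measure_unique => // B C mB mC.
  rewrite m'E; apply/eqP; rewrite eq_le; apply/andP; split.
    pose F k := if k is 0%N then (B, C) else (set0, set0).
    apply: (@le_trans _ _ (\sum_(k <oo) (muX (F k).1 * muY (F k).2))).
      apply: prod_outer_measure_cover_le; split.
        by case=> [|k]; split => //; exact: caratheodory_measurable_set0.
      by move=> z BCz; exists 0%N.
    rewrite (nneseries_split _ 1)//=; last by move=> *; rewrite mule_ge0.
    rewrite big_nat1 [X in _ + X]eseries0 ?adde0//= => -[//|k] _ _ /=.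
    by rewrite outer_measure0 mul0e.
  apply: le_ereal_inf_tmp => _ [F [mF BCF] <-].
  rewrite -nu_setX//.
  have mFk k : measurable (((F k).1 : set TX) `*` ((F k).2 : set TY)).
    by apply: measurableX; have [] := mF k.
  apply: (@le_trans _ _ (\sum_(k <oo) nu ((F k).1 `*` (F k).2))).
    apply: measure_sigma_subadditive => //; exact: measurableX.
  by apply: lee_nneseries => // k _; rewrite nu_setX//; have [] := mF k.
by rewrite (H (measure_function_pushforward__canonical__measure_function_Measure
  (pi : set (caratheodory_type pi) -> \bar R) measurable_id_prod)).
Qed.

(** The hull is an intersection of covers whose sums approach pi A. *)
Lemma prod_measurable_hull (A : set (X * Y)) : exists H : set (TX * TY),
  [/\ measurable H, A `<=` H & nu H = pi A].
Proof.
have [Aoo|Aoo] := eqVneq (pi A) +oo.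
  exists setT; split => //; rewrite -prod_outer_measureE// Aoo; apply/eqP.
  by rewrite eq_le leey -Aoo/=; exact: le_outer_measure.
have Afin : pi A \is a fin_num by rewrite ge0_fin_numE ?ltey ?outer_measure_ge0.
have /choice[F FP] n : exists F : nat -> set X * set Y, rectangle_cover muX muY A F /\
    \sum_(k <oo) (muX (F k).1 * muY (F k).2) < pi A + n.+1%:R^-1%:E.
  have : pi A < pi A + n.+1%:R^-1%:E by rewrite lteDl// lte_fin invr_gt0.
  by move=> /ereal_inf_lt[_ [F cF <-] ltF]; exists F.
pose U n : set (TX * TY) := \bigcup_k ((F n k).1 `*` (F n k).2).
have mU n : measurable (U n).
  apply: bigcup_measurable => k _; have [[mF _] _] := FP n.
  by apply: measurableX; have [] := mF k.
pose H := \bigcap_n U n.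
have mH : measurable H by exact: bigcap_measurableType.
have AH : A `<=` H by move=> z Az n _; have [[_ AF] _] := FP n; exact: AF.
exists H; split => //; rewrite -prod_outer_measureE//; apply/eqP; rewrite eq_le.
apply/andP; split; last exact: le_outer_measure.
apply/lee_addgt0Pr => e e0.
have [n ne] : exists n : nat, (n.+1%:R^-1 <= e)%R.
  exists (Num.bound (e^-1)%R); rewrite invf_ple ?posrE//.
  by apply: (le_trans (ltW (archi_boundP _))); rewrite ?invr_ge0 ?(ltW e0)// ler_nat.
apply: (@le_trans _ _ (pi (U n))); first by apply: le_outer_measure => z; exact.
have [[mF AF] ltF] := FP n.
apply: (@le_trans _ _ (\sum_(k <oo) (muX (F n k).1 * muY (F n k).2))).
  by apply: prod_outer_measure_cover_le; split.
by apply: (le_trans (ltW ltF)); rewrite leeD2l// lee_fin.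
Qed.

Let nu_bigcup0 (M : nat -> set (TX * TY)) : (forall n, measurable (M n)) ->
  (forall n, nu (M n) = 0) -> nu (\bigcup_n M n) = 0.
Proof.
move=> mM M0; apply/eqP; rewrite eq_le measure_ge0 andbT.
apply: (@le_trans _ _ (\sum_(k <oo) nu (M k))); last by rewrite eseries0.
by apply: measure_sigma_subadditive => //; exact: bigcup_measurable.
Qed.

Let sigma_finite_nu : exists K : nat -> set (TX * TY),
  [/\ \bigcup_n K n = setT, forall n, measurable (K n) & forall n, nu (K n) < +oo].
Proof.
have /sigma_finiteP[F [TF ndF Foo]] := sigma_finiteT mX.
have /sigma_finiteP[G [TG ndG Goo]] := sigma_finiteT mY.
exists (fun n => F n `*` G n); split.
- rewrite -subTset => -[x y] _.
  have [i _ Fx] : (\bigcup_n F n) x by rewrite -TF.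
  have [j _ Gy] : (\bigcup_n G n) y by rewrite -TG.
  exists (maxn i j) => //; split => /=.
    by move: x Fx; exact/subsetPset/ndF/leq_maxl.
  by move: y Gy; exact/subsetPset/ndG/leq_maxr.
- by move=> n; apply: measurableX; [have [] := Foo n|have [] := Goo n].
- move=> n; have [mF Fn] := Foo n; have [mG Gn] := Goo n.
  by rewrite nu_setX// lte_mul_pinfty// ge0_fin_numE.
Qed.

(** On a piece of finite measure, a measurable hull H of E satisfies
    pi (H \ E) = 0 by the Caratheodory criterion, and H \ E has itself a null
    measurable hull. *)
Lemma caratheodory_prod_measurable (E : set (X * Y)) : pi.-caratheodory E ->
  exists F N : set (TX * TY), [/\ measurable F, measurable N, nu N = 0 &
    forall z, ~ N z -> (E z <-> F z)].
Proof.
move=> mE.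
have [K [KT mK Kfin]] := sigma_finite_nu.
have mEK n : pi.-caratheodory (E `&` K n).
  by apply: caratheodory_measurable_setI => //; exact: prod_measurable_caratheodory.
have /choice[H HP] n : exists H : set (TX * TY),
    [/\ measurable H, E `&` K n `<=` H & nu H = pi (E `&` K n)].
  exact: prod_measurable_hull.
have null n : pi (H n `&` ~` (E `&` K n)) = 0.
  have [mH EH nuH] := HP n.
  have Hfin : pi (H n) \is a fin_num.
    rewrite (prod_outer_measureE mH) ge0_fin_numE// nuH.
    apply: (@le_lt_trans _ _ (pi (K n))); first exact: le_outer_measure.
    by rewrite (prod_outer_measureE (mK n)).
  have HE : pi (H n) = pi (H n) + pi (H n `&` ~` (E `&` K n)).
    have HEK : pi (H n `&` (E `&` K n)) = pi (H n).
      by rewrite (setIidr EH) (prod_outer_measureE mH) nuH.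
    by rewrite -{2}HEK; exact: mEK.
  by rewrite -[LHS](addeK _ Hfin) [X in X - _]addeC -HE subee.
have /choice[M MP] n : exists M : set (TX * TY),
    [/\ measurable M, H n `&` ~` (E `&` K n) `<=` M & nu M = 0].
  by have [M [mM HM nuM]] := prod_measurable_hull (H n `&` ~` (E `&` K n));
    exists M; rewrite nuM null.
exists (\bigcup_n H n), (\bigcup_n M n); split.
- by apply: bigcup_measurable => n _; have [] := HP n.
- by apply: bigcup_measurable => n _; have [] := MP n.
- by apply: nu_bigcup0 => n; have [] := MP n.
- move=> z nM; split => [Ez|[n _ Hz]].
    have [n _ Kz] : (\bigcup_n K n) z by rewrite KT.
    by exists n => //; have [_ EH _] := HP n; exact: EH.
  apply: contrapT => nE; apply: nM; exists n => //; have [_ HM _] := MP n.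
  by apply: HM; split => // -[].
Qed.

(** A function is recovered from its rational superlevel sets, each of which is
    product-measurable off a null set. *)
Lemma caratheodory_fun_prod_measurable (f : X * Y -> \bar R) :
  measurable_fun [set: caratheodory_type pi] (f : caratheodory_type pi -> \bar R) ->
  exists (f' : TX * TY -> \bar R) (N : set (TX * TY)),
    [/\ measurable_fun setT f', measurable N, nu N = 0 &
      forall z, ~ N z -> f z = f' z].
Proof.
move=> mf.
pose q n : R := ratr (odflt 0%Q (unpickle n)).
have /choice[G GP] n : exists G : set (TX * TY) * set (TX * TY),
    [/\ measurable G.1, measurable G.2, nu G.2 = 0 &
    forall z, ~ G.2 z -> ((q n)%:E < f z <-> G.1 z)].
  have mE : pi.-caratheodory [set z | (q n)%:E < f z].
    have := mf measurableT `](q n)%:E, +oo[%classic; rewrite setTI.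
    rewrite (_ : _ @^-1` _ = [set z | (q n)%:E < f z]); last first.
      by apply/seteqP; split => z /=; rewrite in_itv/= andbT.
    by apply; exact: emeasurable_itv.
  have [F [N FN]] := caratheodory_prod_measurable mE.
  by exists (F, N).
pose s n (z : TX * TY) : \bar R := if z \in (G n).1 then (q n)%:E else -oo.
exists (fun z => esups (fun n => s n z) 0%N), (\bigcup_n (G n).2); split.
- apply: measurable_fun_esups => n; rewrite /s.
  have [mG _ _ _] := GP n.
  apply: measurable_fun_if => //.
  + by apply: (measurable_fun_bool true); rewrite setTI preimage_mem_true.
- by apply: bigcup_measurable => n _; have [] := GP n.
- by apply: nu_bigcup0 => n; have [] := GP n.
move=> z nN.
have Gz n : (q n)%:E < f z <-> (G n).1 z.
  by have [_ _ _] := GP n; apply => Gz; apply: nN; exists n.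
apply/eqP; rewrite eq_le; apply/andP; split; last first.
  apply: ge_ereal_sup => _ [n _ <-]; rewrite /s; case: ifPn => [|_]; last exact: leNye.
  by rewrite inE => /Gz /ltW.
rewrite leNgt; apply/negP => fz.
have [r [r1 r2]] := ereal_rat_dense fz.
have : (ratr r)%:E <= esups (fun n => s n z) 0%N.
  apply: ereal_sup_ubound; exists (pickle r) => //.
  by rewrite /s /q pickleK /= ifT// inE; apply/Gz; rewrite /q pickleK.
by rewrite leNgt r1.
Qed.

End ProductOuterMeasureTheory.

(** * Transfer of integrals along a projection *)

Section Transfer.
Context {R : realType} {X Y Z : pointedType}.
Variables (muX : {outer_measure set X -> \bar R})
          (muY : {outer_measure set Y -> \bar R})
          (muZ : {outer_measure set Z -> \bar R}).
Local Open Scope ereal_scope.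
Local Notation TX := (caratheodory_type muX).
Local Notation TY := (caratheodory_type muY).
Local Notation TZ := (caratheodory_type muZ).
Local Notation pi := (bundled_prod_outer_measure muX muY).
Variables (P : X * Y -> Z) (S : set (X * Y)).
Hypotheses (muZE : forall A, muZ A = pi (P @^-1` A))
  (piS : pi S = 0) (injP : forall p q, ~ S p -> P p = P q -> p = q).

Lemma caratheodory_of_preimage (A : set Z) :
  pi.-caratheodory (P @^-1` A) -> muZ.-caratheodory A.
Proof. by move=> mA B; rewrite !muZE preimage_setI preimage_setI preimage_setC. Qed.

(** A test set T splits into a null part and a part off S; the latter is the
    preimage of its image, to which the criterion for A applies. *)
Lemma caratheodory_preimage (A : set Z) :
  muZ.-caratheodory A -> pi.-caratheodory (P @^-1` A).
Proof.
move=> mA; apply: le_caratheodory_measurable => T.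
pose T' := T `&` ~` S.
have PT' : P @^-1` (P @` T') = T'.
  apply/seteqP; split => [q [p [Tp nSp] Ppq]|p]; last by exists p.
  by rewrite -(injP nSp Ppq).
have piT' B : pi (T `&` B) <= pi (T' `&` B).
  apply: (@le_trans _ _ (pi ((T' `&` B) `|` S))).
    apply: le_outer_measure => p [Tp Bp].
    by have [?|?] := pselect (S p); [right|left].
  by apply: (le_trans (outer_measureU2 _ _ _)); rewrite piS adde0.
apply: (@le_trans _ _ (pi T')); last by apply: le_outer_measure; exact: subIsetl.
apply: (le_trans (leeD (piT' _) (piT' _))).
rewrite -{3}PT' -muZE (mA (P @` T')) !muZE.
by rewrite !preimage_setI preimage_setC PT'.
Qed.

Lemma measurable_transfer : measurable_fun [set: caratheodory_type pi]
  (P : caratheodory_type pi -> TZ).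
Proof. by move=> _ A mA; rewrite setTI; exact: caratheodory_preimage. Qed.

Hypotheses
  (sfX : sigma_finite [set: TX] (muX : set TX -> \bar R))
  (sfY : sigma_finite [set: TY] (muY : set TY -> \bar R)).
Local Notation mX := (sigma_finite_caratheodory sfX).
Local Notation mY := (sigma_finite_caratheodory sfY).
Local Notation nu := (mX \x mY).

Lemma transfer_fun (f : Z -> \bar R) :
  measurable_fun [set: TZ] (f : TZ -> \bar R) ->
  exists (f' : TX * TY -> \bar R) (N : set (TX * TY)),
    [/\ measurable_fun setT f', measurable N, nu N = 0 &
      forall z, ~ N z -> f (P z) = f' z].
Proof.
move=> mf; apply: (caratheodory_fun_prod_measurable sfX sfY (f := f \o P)).
exact: (measurableT_comp mf measurable_transfer).
Qed.

(** The measure of Z is the image of the product outer measure, which agrees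
    with the product measure where f' lives. *)
Lemma transfer_integral (f : Z -> \bar R) (f' : TX * TY -> \bar R)
    (N : set (TX * TY)) :
  measurable_fun [set: TZ] (f : TZ -> \bar R) -> (forall z, 0 <= f z) ->
  measurable_fun setT f' -> (forall z, 0 <= f' z) -> measurable N -> nu N = 0 ->
  (forall z, ~ N z -> f (P z) = f' z) ->
  \int[muZ : set TZ -> \bar R]_z f z = \int[nu]_z f' z.
Proof.
move=> mf f0 mf' f'0 mN nuN ff'.
have -> : \int[muZ : set TZ -> \bar R]_z f z =
    \int[pi : set (caratheodory_type pi) -> \bar R]_z f (P z).
  transitivity (\int[pushforward (pi : set (caratheodory_type pi) -> \bar R)
     (P : caratheodory_type pi -> TZ)]_z f z).
    congr (integral _ _ _); apply/funext => A; exact: muZE.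
  by rewrite (ge0_integral_pushforward measurable_transfer)//.
have mN' : measurable (N : set (caratheodory_type pi)).
  exact: prod_measurable_caratheodory.
have mf'' : measurable_fun [set: caratheodory_type pi]
    (f' : caratheodory_type pi -> \bar R).
  exact: (measurableT_comp mf' (@measurable_id_prod _ _ _ muX muY)).
transitivity (\int[pi : set (caratheodory_type pi) -> \bar R]_z f' z).
  apply: ge0_ae_eq_integral => //.
  - exact: (measurableT_comp mf measurable_transfer).
  - exists N; split => //; first exact: etrans (prod_outer_measureE sfX sfY mN) nuN.
    by move=> z /= H; apply: contrapT => nN; apply: H => _; exact: ff'.
transitivity (\int[pushforward (pi : set (caratheodory_type pi) -> \bar R)
     (id : caratheodory_type pi -> TX * TY)]_z f' z).
  by rewrite (ge0_integral_pushforward (@measurable_id_prod _ _ _ muX muY)).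
apply: (@eq_measure_integral _ _ _ _ nu
  (measure_function_pushforward__canonical__measure_function_Measure
    (pi : set (caratheodory_type pi) -> \bar R)
    (@measurable_id_prod _ _ _ muX muY))) => A mA _.
exact: (prod_outer_measureE sfX sfY mA).
Qed.

End Transfer.

(** * Sections of null sets and of integrable functions *)

Section NullSections.
Context d1 d2 (T1 : measurableType d1) (T2 : measurableType d2) (R : realType).
Variables (m1 : {sigma_finite_measure set T1 -> \bar R})
          (m2 : {sigma_finite_measure set T2 -> \bar R}).
Local Open Scope ereal_scope.

Let ae_eq0 d (T : measurableType d) (m : {measure set T -> \bar R})
    (f : T -> \bar R) : measurable_fun setT f -> (forall x, 0 <= f x) ->
  \int[m]_x f x = 0 -> {ae m, forall x, f x = 0}.
Proof.
move=> mf f0 intf.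
have : ae_eq m setT f (cst 0).
  apply/ae_eq_integral_abs => //; rewrite -[RHS]intf.
  by apply: eq_integral => x _; rewrite gee0_abs.
by apply: (@filterS _ _ (ae_filter_ringOfSetsType m)) => x; exact.
Qed.

Lemma ae_finite_integral d (T : measurableType d) (m : {measure set T -> \bar R})
    (f : T -> \bar R) : measurable_fun setT f -> (forall x, 0 <= f x) ->
  \int[m]_x f x < +oo -> {ae m, forall x, f x < +oo}.
Proof.
move=> mf f0 intf.
have : m.-integrable setT f.
  apply/integrableP; split => //; apply: le_lt_trans intf.
  by apply: ge0_le_integral => // [|x _]; [exact: measurableT_comp|rewrite gee0_abs].
move=> /(integrable_ae measurableT).
apply: (@filterS _ _ (ae_filter_ringOfSetsType m)).
by move=> x /(_ Logic.I); rewrite ge0_fin_numE.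
Qed.

Lemma ae_null_xsection (N : set (T1 * T2)) : measurable N -> (m1 \x m2) N = 0 ->
  {ae m1, forall x, m2 (xsection N x) = 0}.
Proof.
move=> mN N0; apply: ae_eq0 => //; first exact: measurable_fun_xsection.
Qed.

Lemma ae_null_ysection (N : set (T1 * T2)) : measurable N -> (m1 \x m2) N = 0 ->
  {ae m2, forall y, m1 (ysection N y) = 0}.
Proof.
move=> mN N0; apply: ae_eq0 => //; first exact: measurable_fun_ysection.
rewrite -[LHS]/((m1 \x^ m2) N) -[RHS]N0; apply/esym; apply: product_measure_unique => //.
by move=> A B mA mB; exact: product_measure2E.
Qed.

End NullSections.

(** * Upper gradients on slices *)

Section UpperGradientPullback.
Context {R : realType} {X : pointedMetricType R} {Z : pointedType}.
Variables (d : Z -> Z -> R) (f : X -> Z) (K : R).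
Hypotheses (qd : hemimetric d) (K0 : 0 <= K)
  (fK : forall x x', d (f x) (f x') <= K * mdist x x') (injf : injective f).

Let dopen_preimage (U : set Z) : dopen d U -> dopen mdist (f @^-1` U).
Proof.
move=> oU x /oU[r r0 rU]; have K1 : 0 < K + 1 by rewrite ltr_wpDl.
exists (r / (K + 1)); first by rewrite divr_gt0.
move=> x' xx'; apply: rU; apply: (le_lt_trans (fK x x')).
move: xx'; rewrite /dball /= ltr_pdivlMr// mulrDr mulr1 mulrC; apply: le_lt_trans.
by rewrite lerDl mdist_ge0.
Qed.

Let ac_path_image a b (gamma : R -> X) :
  ac_path mdist a b gamma -> ac_path d a b (f \o gamma).
Proof.
move=> /(ac_path_dominating hemimetric_mdist)[ab [F acF gF]].
apply: (ac_path_dominated qd (F := fun t => K * F t)) => //.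
  apply: (absolutely_continuous_dominated (c := K)) acF => s t as_ st tb.
  rewrite -mulrBr normrM !ger0_norm// subr_ge0.
  by rewrite -subr_ge0 (le_trans _ (gF s t as_ st tb))// mdist_ge0.
move=> s t as_ st tb; rewrite -mulrBr; split; apply: (le_trans (fK _ _)).
  by rewrite ler_wpM2l// gF.
by rewrite metric_sym ler_wpM2l// gF.
Qed.

Let metric_speed_image (gamma : R -> X) (t m : R) :
  mdist (gamma u) (gamma t) / `|u - t| @[u --> t^'] --> m ->
  metric_speed d (f \o gamma) t <= K * m.
Proof.
move=> cm; rewrite /metric_speed.
set F := fun u => d _ _ / _.
have m0 : 0 <= m.
  rewrite -(cvg_lim (@Rhausdorff R) cm); apply: limr_ge; first by apply/cvg_ex; exists m.
  by apply: nearW => u; rewrite divr_ge0// mdist_ge0.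
have [c|/dvgP->] := pselect (cvg (F u @[u --> t^'])); last by rewrite mulr_ge0.
have cKm : K * (mdist (gamma u) (gamma t) / `|u - t|) @[u --> t^'] --> K * m.
  by apply: cvgM => //; exact: cvg_cst.
apply: (ler_cvg_to c cKm); apply: nearW => u.
by rewrite /F mulrA ler_wpM2r ?invr_ge0// fK.
Qed.

(** Distances, hence speeds, grow by at most a factor K under f. Injectivity
    keeps nonconstant paths nonconstant, which the definition of an upper
    gradient requires of the paths that it tests. *)
Lemma upper_gradient_pullback (u g : Z -> \bar R) : upper_gradient d u g ->
  upper_gradient mdist (u \o f) (fun x => (K%:E * g (f x))%E).
Proof.
move=> [bg g0 ug]; split.
- pose f' : g_sigma_algebraType (dopen (@mdist R X)) -> g_sigma_algebraType (dopen d) := f.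
  have mf : measurable_fun setT f'.
    apply: (@measurability _ _ _ (g_sigma_algebraType (dopen d)) setT f' (dopen d)) => //.
    move=> _ [U oU <-]; rewrite setTI; apply: sub_sigma_algebra.
    exact: dopen_preimage.
  by apply: measurable_funeM; exact: (measurableT_comp bg mf).
- by move=> x; apply: mule_ge0 => //; rewrite lee_fin.
move=> a b gamma acg [s [t [sab tab gst]]].
have : exists s t, [/\ s \in `[a, b]%R, t \in `[a, b]%R
    & (f \o gamma) s <> (f \o gamma) t].
  by exists s, t; split => // /injf.
move=> /(ug _ _ _ (ac_path_image acg))/le_trans; apply.
have [ab [F acF gF]] := ac_path_dominating hemimetric_mdist acg.
have [m [_ m0 _ [S [mS muS nS]]]] := metric_speed_integral ab acF gF.
rewrite /line_integral.
apply: (@le_integral_off_null _ _ _ lebesgue_measure _ (S `|` [set a; b])) => //.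
- by apply: measurableU => //; exact: measurable_set2.
- by rewrite (measureU0 mS (measurable_set2 a b) (lebesgue_measure_set2 a b)).
- by move=> x _; apply: mule_ge0 => //; rewrite lee_fin (metric_speed_ge0 qd).
- move=> x _; apply: mule_ge0; first by apply: mule_ge0 => //; rewrite lee_fin.
  by rewrite lee_fin (metric_speed_ge0 hemimetric_mdist).
move=> x /=; rewrite in_itv/= => abx /not_orP[nSx /not_orP[xa xb]].
have xm : mdist (gamma u) (gamma x) / `|u - x| @[u --> (x : R)^'] --> m x.
  apply: contrapT => mx; apply: nSx; apply: nS => /= H; apply: mx; apply: H.
  move: abx => /andP[ax xb'].
  by rewrite !lt_neqAle ax xb' !andbT; apply/andP; split; apply/eqP => // /esym.
rewrite -muleA muleCA; apply: lee_wpmul2l => //.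
rewrite -EFinM lee_fin [metric_speed mdist gamma x](cvg_lim _ xm)//.
exact: metric_speed_image.
Qed.

End UpperGradientPullback.

(** * Balls of the warped product *)

Lemma countable_bigcup_measurable d (T : measurableType d) (U : Type)
    (D : set U) (F : U -> set T) : countable D ->
  (forall i, D i -> measurable (F i)) -> measurable (\bigcup_(i in D) F i).
Proof.
move=> /countable_injP[f fI] mF.
have -> : \bigcup_(i in D) F i =
    \bigcup_n (\bigcup_(i in D `&` [set i | f i = n]) F i).
  apply/seteqP; split => x; first by move=> [i Di Fi]; exists (f i) => //; exists i.
  by move=> [n _ [i [Di _] Fi]]; exists i.
apply: bigcupT_measurable => n.
have [[i [Di fin]]|none] := pselect (exists i, D i /\ f i = n).
  rewrite (_ : _ `&` _ = [set i]) ?bigcup_set1; first exact: mF.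
  apply/seteqP; split => [j [Dj fjn]|j ->] //=.
  by apply: fI; rewrite ?inE// fin.
rewrite (_ : _ `&` _ = set0) ?bigcup_set0//.
by rewrite -subset0 => i [Di fin]; apply: none; exists i.
Qed.

Section WarpedTopology.
Context {R : realType} {X Y : pointedMetricType R}.
Variables (N : R * R -> R) (phi : X -> R)
  (muX : {outer_measure set X -> \bar R})
  (muY : {outer_measure set Y -> \bar R}).
Hypotheses (normN : is_norm2 N) (unitN : unitary N)
  (incrN : coordinate_increasing N)
  (lsX : length_space (@mdist R X)) (lsY : length_space (@mdist R Y))
  (cphi : continuous phi) (phi0 : forall x, 0 <= phi x)
  (mmsX : metric_measure_space (@mdist R X) muX)
  (mmsY : metric_measure_space (@mdist R Y) muY)
  (muYT : (muY setT < +oo)%E).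

Local Notation TX := (caratheodory_type muX).
Local Notation TY := (caratheodory_type muY).
Local Notation P := (@warped_proj R X Y N phi).
Local Notation dist := (@warped_mdist R X Y N phi).
Local Notation muZ := (warped_measure N phi muX muY).

Lemma dball_open (W : Type) (d : W -> W -> R) z r : hemimetric d ->
  dopen d (dball d z r).
Proof.
move=> [_ _ dT] w zw; exists (r - d z w); first by rewrite subr_gt0.
by move=> v wv; rewrite /dball /= (le_lt_trans (dT _ w _))// -ltrBrDl.
Qed.

Lemma caratheodory_dball (W : pointedType) (d : W -> W -> R)
    (mu : {outer_measure set W -> \bar R}) z r : hemimetric d ->
  borel d `<=` mu.-caratheodory -> mu.-caratheodory (dball d z r).
Proof. by move=> qd; apply; apply: sub_sigma_algebra; exact: dball_open. Qed.

Let mballX x r : measurable (dball mdist x r : set TX).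
Proof. by have [_ bX _ _] := mmsX; exact: (caratheodory_dball _ _ hemimetric_mdist). Qed.

Let mballY y r : measurable (dball mdist y r : set TY).
Proof. by have [_ bY _ _] := mmsY; exact: (caratheodory_dball _ _ hemimetric_mdist). Qed.

(** Balls around a fixed point exhaust the space. *)
Lemma sigma_finite_metric_measure (W : pointedMetricType R)
    (mu : {outer_measure set W -> \bar R}) :
  metric_measure_space (@mdist R W) mu ->
  sigma_finite [set: caratheodory_type mu]
    (mu : set (caratheodory_type mu) -> \bar R).
Proof.
move=> [_ bW _ ball]; exists (fun n => dball mdist (point : W) n.+1%:R).
  apply/esym; rewrite -subTset => w _.
  exists (Num.bound (mdist (point : W) w)) => //.
  rewrite /dball /= (lt_le_trans (archi_boundP _))// ?mdist_ge0//.
  by rewrite ler_nat.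
move=> n; split; first exact: (caratheodory_dball _ _ hemimetric_mdist).
by have /andP[] := ball point n.+1%:R (ltr0Sn _ _).
Qed.

Lemma dball_setX_subset x y r : 0 < r ->
  dball mdist x r `*` dball mdist y r `<=`
  P @^-1` dball dist (P (x, y)) ((phi x + 1) * r).
Proof.
move=> r0 [x' y'] [/= xx' yy']; rewrite /dball /=.
apply: (le_lt_trans (warped_proj_le normN unitN incrN lsX lsY phi0 _ _ _ _)).
rewrite mulrDl mul1r; apply: ler_ltD => //.
by apply: ler_wpM2l => //; exact: ltW.
Qed.

Lemma dball_subset_setX p r :
  P @^-1` dball dist (P p) r `<=` dball mdist p.1 r `*` setT.
Proof.
move=> q; rewrite /dball /= => pq; split => //.
exact: le_lt_trans (warped_proj_ge_fst normN unitN incrN lsX lsY phi0 p q) pq.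
Qed.

(** The preimage of an open set is a countable union of rectangles of balls with
    centers in countable dense sets and rational radii. *)
Lemma dopen_warped_measurable (U : set (warped_product Y N phi)) :
  dopen dist U -> measurable (P @^-1` U : set (TX * TY)).
Proof.
move=> oU.
have [[DX cDX dDX] _ _ _] := mmsX; have [[DY cDY dDY] _ _ _] := mmsY.
pose I := DX `*` DY `*` [set: rat].
pose Q (i : X * Y * rat) : set (X * Y) :=
  dball mdist i.1.1 (ratr i.2) `*` dball mdist i.1.2 (ratr i.2).
pose J := I `&` [set i | Q i `<=` P @^-1` U].
have cJ : countable J.
  apply: (@sub_countable _ _ _ I); first by apply: subset_card_le => i [].
  by apply: countableX; [exact: countableX|exact: countableP].
have -> : P @^-1` U = \bigcup_(i in J) Q i.
  apply/seteqP; split => [[x y] Pxy|z [i [_ Qi] Qz]]; last exact: Qi.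
  have [r r0 rU] := oU _ Pxy.
  pose e := r / (2 * (phi x + 2)).
  have phi2 : 0 < phi x + 2 by rewrite ltr_wpDl.
  have e0 : 0 < e by rewrite divr_gt0// mulr_gt0.
  have [s] := rat_in_itvoo e0; rewrite in_itv/= => /andP[s0 se].
  have [a [xa DXa]] := dDX x _ s0; have [b [yb DYb]] := dDY y _ s0.
  exists (a, b, s); last by rewrite /Q /dball /=; split; rewrite /= metric_sym.
  split => // -[x' y'] [/= ax' by']; apply: rU; rewrite /dball /=.
  apply: (le_lt_trans (warped_proj_le normN unitN incrN lsX lsY phi0 _ _ _ _)).
  have xx' : mdist x x' <= ratr s + ratr s.
    by rewrite (le_trans (metric_triangle _ a _))// lerD// ltW.
  have yy' : mdist y y' <= ratr s + ratr s.
    by rewrite (le_trans (metric_triangle _ b _))// lerD// ltW.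
  apply: (@le_lt_trans _ _ ((phi x + 1) * (ratr s + ratr s))).
    by rewrite mulrDl mul1r lerD// ler_wpM2l.
  apply: (@lt_trans _ _ ((phi x + 2) * (ratr s + ratr s))).
    by rewrite ltr_pM2r ?addr_gt0// ltrD2l ltr1n.
  move: se; rewrite /e ltr_pdivlMr ?mulr_gt0//; lra.
apply: countable_bigcup_measurable => // i _.
by apply: measurableX; [exact: mballX|exact: mballY].
Qed.

Lemma dopen_warped_caratheodory (U : set (warped_product Y N phi)) :
  dopen dist U -> muZ.-caratheodory U.
Proof.
move=> /dopen_warped_measurable mU.
apply: (@caratheodory_of_preimage _ _ _ _ muX muY muZ P) => //.
exact: prod_measurable_caratheodory mU.
Qed.

Lemma caratheodory_warped_dball z r : muZ.-caratheodory (dball dist z r).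
Proof.
apply/dopen_warped_caratheodory/dball_open.
exact: hemimetric_warped_mdist.
Qed.

(** A ball projects into a ball of X, and Y has finite measure. *)
Lemma warped_dball_finite z r : (0 < r)%R -> (muZ (dball dist z r) < +oo)%E.
Proof.
have [p ->] := warped_proj_surj z; move=> r0.
apply: (@le_lt_trans _ _ (prod_outer_measure muX muY (dball mdist p.1 r `*` setT))).
  apply: (le_outer_measure (bundled_prod_outer_measure muX muY)).
  exact: dball_subset_setX.
pose F (k : nat) := if k is 0%N then (dball mdist p.1 r, [set: Y]) else (set0, set0).
apply: (@le_lt_trans _ _ (\sum_(k <oo) (muX (F k).1 * muY (F k).2))%E).
  apply: prod_outer_measure_cover_le; split; last by move=> q pq; exists 0%N.
  case=> [|k]; split => //=; try exact: caratheodory_measurable_set0.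
    exact: mballX.
  exact: (@measurableT _ TY).
have ge0 k : (0 <= muX (F k).1 * muY (F k).2)%E.
  by rewrite mule_ge0// outer_measure_ge0.
rewrite (nneseries_split _ 1)//= big_nat1 [X in (_ + X)%E]eseries0 ?adde0//=; last first.
  by move=> [//|k] _ _; rewrite /= outer_measure0 mul0e.
have [_ _ _ ball] := mmsX.
rewrite lte_mul_pinfty ?outer_measure_ge0//.
by rewrite ge0_fin_numE ?outer_measure_ge0//; have /andP[] := ball p.1 r r0.
Qed.

End WarpedTopology.

(** * Powers, weights and null sets *)

Section LpNorms.
Context {R : realType}.
Local Open Scope ereal_scope.

Lemma lee_poweR (p : R) (x y : \bar R) : (0 < p)%R -> 0 <= x -> 0 <= y ->
  (x `^ p <= y `^ p) = (x <= y).
Proof.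
move=> p0 x0 y0.
have mono (q : R) a b : (0 < q)%R -> 0 <= a -> 0 <= b -> a <= b -> a `^ q <= b `^ q.
  move=> q0 a0 b0 ab; apply: (gt0_ler_poweR (ltW q0)) => //.
    by rewrite in_itv/= a0 leey.
  by rewrite in_itv/= b0 leey.
apply/idP/idP => [xy|]; last exact: mono.
have K z : 0 <= z -> z = (z `^ p) `^ p^-1.
  by move=> z0; rewrite -poweRrM divff ?gt_eqF// poweRe1.
by rewrite (K x)// (K y)// mono ?invr_gt0// poweR_ge0.
Qed.

Variables (T : pointedType) (mu : {outer_measure set T -> \bar R}).
Local Notation muT := (mu : set (caratheodory_type mu) -> \bar R).

Lemma poweR_Lp_norm (D : set T) (p : R) (f : T -> \bar R) : (0 < p)%R ->
  Lp_norm mu D p%:E f `^ p = \int[muT]_(x in D) `|f x| `^ p.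
Proof.
move=> p0; rewrite /Lp_norm poweR_Lnorm ?gt_eqF// [RHS]integral_mkcond.
apply: eq_integral => x _; rewrite !patchE; case: ifP => // _.
by rewrite abse0 poweR0r// gt_eqF.
Qed.

(** Norm inequalities are p-th roots of inequalities between integrals, which is
    the form that Fubini handles. *)
Lemma Lp_norm_lee (D : set T) (p C : R) (f g : T -> \bar R) :
  (0 < p)%R -> (0 <= C)%R ->
  (Lp_norm mu D p%:E f <= C%:E * Lp_norm mu setT p%:E g) =
  (\int[muT]_(x in D) `|f x| `^ p <= (C `^ p)%:E * \int[muT]_x `|g x| `^ p).
Proof.
move=> p0 C0; rewrite -!poweR_Lp_norm// -poweR_EFin -poweRM ?lee_fin ?Lnorm_ge0//.
by rewrite lee_poweR ?mule_ge0 ?Lnorm_ge0 ?lee_fin.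
Qed.

Lemma Lp_norm_lty (D : set T) (p : R) (f : T -> \bar R) : (0 < p)%R ->
  (Lp_norm mu D p%:E f < +oo) = (\int[muT]_(x in D) `|f x| `^ p < +oo).
Proof.
move=> p0; rewrite -poweR_Lp_norm//; apply/idP/idP; first exact: poweR_lty.
by apply: lty_poweRy; rewrite gt_eqF.
Qed.

End LpNorms.

Section PowerInequality.
Context {R : realType}.
Local Open Scope ereal_scope.

(** The distance is at most twice the larger of the two distances to z. Infinite
    values of a or z make the right-hand side infinite. *)
Lemma poweR_dist_le (p c : R) (a z : \bar R) : (0 < p)%R ->
  `|a - c%:E| `^ p <=
  (2 `^ p)%:E * (`|z - a| `^ p + `|z - c%:E| `^ p).
Proof.
move=> p0; have p_neq0 : p != 0%R by rewrite gt_eqF.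
have pow2 : 0 < (2 `^ p)%:E :> \bar R by rewrite lte_fin powR_gt0.
have infty x : `|z - a| = +oo \/ `|z - c%:E| = +oo ->
    x <= (2 `^ p)%:E * (`|z - a| `^ p + `|z - c%:E| `^ p).
  move=> H; rewrite [X in _ * X](_ : _ = +oo) ?gt0_muley ?leey//.
  by case: H => ->; rewrite poweRyr// ?addey ?addye// -ltNye
    (lt_le_trans _ (poweR_ge0 _ _)).
case: z infty => [z|infty|infty]; [|by apply: infty; right..].
case: a => [a _|infty|infty]; [|by apply: infty; left..].
rewrite -!EFinB !abse_EFin !poweR_EFin -EFinD -EFinM lee_fin.
have le_pow (s t : R) : (0 <= s)%R -> (s <= t)%R -> (s `^ p <= t `^ p)%R.
  by move=> s0 st; apply: ge0_ler_powR; rewrite ?nnegrE ?(ltW p0)//; exact: le_trans st.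
have tri : (`|a - c| <= `|z - a| + `|z - c|)%R.
  by rewrite (le_trans (ler_distD z _ _))// [`|a - z|%R]distrC.
have pge0 (s : R) : (0 <= s `^ p)%R by exact: powR_ge0.
have [h|h] := leP `|z - a|%R `|z - c|%R.
  apply: (@le_trans _ _ ((2 * `|z - c|) `^ p)%R).
    by apply: le_pow => //; apply: (le_trans tri); rewrite mulr_natl mulr2n lerD2r.
  by rewrite powRM// ler_pM2l ?powR_gt0// lerDr.
apply: (@le_trans _ _ ((2 * `|z - a|) `^ p)%R).
  by apply: le_pow => //; apply: (le_trans tri); rewrite mulr_natl mulr2n lerD2l ltW.
by rewrite powRM// ler_pM2l ?powR_gt0// lerDl.
Qed.

End PowerInequality.

Section WeightedConstants.
Context {R : realType} d {T : measurableType d}.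
Variable m : {measure set T -> \bar R}.
Local Open Scope ereal_scope.

Lemma measurable_fun_poweR_dist (p : R) (f g : T -> \bar R) :
  measurable_fun setT f -> measurable_fun setT g ->
  measurable_fun setT (fun x => `|f x - g x| `^ p).
Proof.
move=> mf mg; apply: (measurableT_comp (measurable_poweR _)).
by apply: measurableT_comp => //; exact: emeasurable_funB.
Qed.

(** The four finite integrals bound that of W |c1 - c2|^p, by passing from c1 to
    v1, A, v2 and c2. As W is not integrable, c1 and c2 agree. *)
Lemma weighted_constants_eq (p c1 c2 : R) (W A v1 v2 : T -> \bar R) :
  (0 < p)%R -> measurable_fun setT W -> measurable_fun setT A ->
  measurable_fun setT v1 -> measurable_fun setT v2 ->
  (forall x, 0 <= W x) -> \int[m]_x W x = +oo ->
  \int[m]_x (W x * `|v1 x - A x| `^ p) < +oo ->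
  \int[m]_x (W x * `|v2 x - A x| `^ p) < +oo ->
  \int[m]_x (W x * `|v1 x - c1%:E| `^ p) < +oo ->
  \int[m]_x (W x * `|v2 x - c2%:E| `^ p) < +oo ->
  c1 = c2.
Proof.
move=> p0 mW mA mv1 mv2 W0 intW.
have mWp f g : measurable_fun setT f -> measurable_fun setT g ->
    measurable_fun setT (fun x => W x * `|f x - g x| `^ p).
  by move=> mf mg; apply: emeasurable_funM => //; exact: measurable_fun_poweR_dist.
have Wp0 f g x : 0 <= W x * `|f x - g x| `^ p.
  by rewrite mule_ge0// poweR_ge0.
have fin2 (a c z : T -> \bar R) : measurable_fun setT a ->
    measurable_fun setT c -> measurable_fun setT z ->
    (forall x, `|a x - c x| `^ p <=
      (2 `^ p)%:E * (`|z x - a x| `^ p + `|z x - c x| `^ p)) ->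
    \int[m]_x (W x * `|z x - a x| `^ p) < +oo ->
    \int[m]_x (W x * `|z x - c x| `^ p) < +oo ->
    \int[m]_x (W x * `|a x - c x| `^ p) < +oo.
  move=> ma mc mz acz za zc.
  apply: (@le_lt_trans _ _ (\int[m]_x ((2 `^ p)%:E *
      (W x * `|z x - a x| `^ p + W x * `|z x - c x| `^ p)))).
    apply: ge0_le_integral => //.
    - exact: mWp.
    - by apply: measurable_funeM; apply: emeasurable_funD; exact: mWp.
    - move=> x _; rewrite -ge0_muleDr ?poweR_ge0// muleCA.
      exact: lee_wpmul2l.
  rewrite ge0_integralZl//; last 2 first.
  - by apply: emeasurable_funD; exact: mWp.
  - by move=> x _; rewrite adde_ge0.
  rewrite ge0_integralD//; [|exact: mWp..].
  rewrite lte_mul_pinfty ?lee_fin ?powR_ge0//.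
  by rewrite lte_add_pinfty.
have mc (c : R) : measurable_fun setT (fun _ : T => c%:E) by exact: measurable_cst.
move=> vA1 vA2 vc1 vc2.
have Ac1 : \int[m]_x (W x * `|A x - c1%:E| `^ p) < +oo.
  by apply: (fin2 A (fun=> c1%:E) v1) => // x; exact: poweR_dist_le.
have Ac2 : \int[m]_x (W x * `|A x - c2%:E| `^ p) < +oo.
  by apply: (fin2 A (fun=> c2%:E) v2) => // x; exact: poweR_dist_le.
apply/eqP; apply: contrapT => /negP c12.
have : \int[m]_x (W x * `|c1%:E - c2%:E| `^ p) < +oo.
  by apply: (fin2 (fun=> c1%:E) (fun=> c2%:E) A) => // x; exact: poweR_dist_le.
rewrite ge0_integralZr//; last by rewrite poweR_ge0.
rewrite intW gt0_mulye// -EFinB abse_EFin poweR_EFin lte_fin powR_gt0//.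
by rewrite normr_gt0 subr_eq0.
Qed.

End WeightedConstants.

Section CaratheodoryCompleteness.
Context {R : realType} {T : pointedType}.
Variable mu : {outer_measure set T -> \bar R}.
Local Notation muT := (mu : set (caratheodory_type mu) -> \bar R).

(** The Caratheodory measure is complete. *)
Lemma caratheodory_ae_measurable (D : set T) (N : set T) (f g : T -> \bar R) :
  muT.-negligible N -> (forall x, ~ N x -> f x = g x) ->
  mu_measurable mu D f -> mu_measurable mu D g.
Proof.
move=> N0 fg; apply: (ae_measurable_fun (@measure_is_complete_caratheodory _ _ mu)).
apply: negligibleS N0 => x /= H; apply: contrapT => /fg E.
by apply: H.
Qed.

End CaratheodoryCompleteness.

(** * Local constants in length spaces *)

Section Gluing.
Context {R : realType} {Y : pointedMetricType R}.
Variable mu : {outer_measure set Y -> \bar R}.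
Hypotheses (mms : metric_measure_space (@mdist R Y) mu)
  (ls : length_space (@mdist R Y)).
Local Notation muT := (mu : set (caratheodory_type mu) -> \bar R).

(** Any two points are joined by a Lipschitz path, along which the indicator of
    the initial value of k is locally constant, hence has zero derivative. *)
Lemma locally_constant_length_space (U : Type) (k : Y -> U) :
  (forall y, exists2 r, 0 < r & forall z, mdist y z < r -> k z = k y) ->
  forall y z, k y = k z.
Proof.
move=> loc y z.
have [l [g [l0 _ <- <- gL]]] := length_space_lipschitz_path y z ls (ltr01 : (0 < 1 :> R)).
pose q (t : R) : R := (`[< k (g (clamp 0 l t)) = k (g 0) >])%:R.
have q_der t : is_derive t (1 : R) q 0.
  have [r r0 kr] := loc (g (clamp 0 l t)).
  have near_q : \forall u \near t, q t = q u.
    exists r => // u /= tu; rewrite /q (kr (g (clamp 0 l u)))//.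
    apply: le_lt_trans tu; rewrite distrC.
    by apply: le_trans (clamp_dist 0 l t u); apply: gL; exact: clamp_itv.
  by apply: (@near_eq_is_derive _ _ _ (cst (q t))).
have : q 0 = q l by exact: is_derive_0_is_cst.
rewrite /q !clamp_id ?lexx ?l0// (asboolT (erefl (k (g 0)))).
by case: asboolP => // _ /eqP; rewrite oner_eq0.
Qed.

(** The constants of overlapping balls agree because the overlap contains a
    ball, which has positive measure; hence a single constant serves all
    points. Separability then covers the space by countably many balls on which
    c takes that value almost everywhere. *)
Lemma ae_locally_constant (c : Y -> R) :
  (forall y, exists r k, 0 < r /\ {ae muT, forall z, mdist y z < r -> c z = k}) ->
  exists k, {ae muT, forall z, c z = k}.
Proof.
move=> loc; have [[D cD dD] bY _ ballY] := mms.
pose good y (rk : R * R) :=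
  0 < rk.1 /\ {ae muT, forall z, mdist y z < rk.1 -> c z = rk.2}.
have [rk rkP] : {rk : Y -> R * R & forall y, good y (rk y)}.
  by apply: (@choice _ _ good) => y; have [r [k ?]] := loc y; exists (r, k).
pose k y := (rk y).2.
have k_loc y : exists2 r, 0 < r & forall z, mdist y z < r -> k z = k y.
  have [r0 ae_y] := rkP y; exists (rk y).1 => // z yz.
  have [rz0 ae_z] := rkP z.
  pose s := Num.min (rk z).1 ((rk y).1 - mdist y z).
  have s0 : 0 < s by rewrite lt_min rz0 subr_gt0.
  apply: contrapT => kzy.
  have : (0 < mu (dball mdist z s))%E by have /andP[] := ballY z s s0.
  suff H : muT.-negligible (dball mdist z s).
    have mB : measurable (dball mdist z s : set (caratheodory_type mu)).
      exact: (caratheodory_dball _ _ hemimetric_mdist).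
    by rewrite (proj1 (negligibleP _ mB) H) ltxx.
  apply: negligibleS (negligibleU ae_y ae_z) => w; rewrite /dball /=.
  rewrite lt_min => /andP[zw zw'].
  apply: contrapT => /not_orP[/contrapT cy /contrapT cz]; apply: kzy.
  rewrite /k -cz// -cy//.
  by rewrite (le_lt_trans (metric_triangle _ z _))// -ltrBrDl.
have k_cst := locally_constant_length_space k_loc.
have /countable_injP[f fI] := cD.
pose goodb a n := {ae muT, forall z, mdist a z < n.+1%:R^-1 -> c z = k point}.
exists (k point).
(* Balls centered in D of radius 1/(n+1), indexed by natural numbers through
   an injection f of D. *)
have : {ae muT, forall z (j n : nat) a, D a -> f a = j -> goodb a n ->
    mdist a z < n.+1%:R^-1 -> c z = k point}.
  apply/ae_foralln => j; apply/ae_foralln => n.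
  have [[a [Da fa ga]]|none] := pselect (exists a, [/\ D a, f a = j & goodb a n]).
    apply: (@filterS _ _ (ae_filter_ringOfSetsType muT)) ga => z cz b Db fb _.
    by rewrite (fI b a) ?inE// fa.
  apply: aeW => z a Da fa ga; exfalso; apply: none.
  by exists a.
apply: (@filterS _ _ (ae_filter_ringOfSetsType muT)) => y cy.
have [ry0 ae_y] := rkP y.
have [n nr] : exists n : nat, n.+1%:R^-1 < (rk y).1 / 2.
  exists (Num.bound ((rk y).1 / 2)^-1).
  rewrite invf_plt ?posrE ?divr_gt0//.
  rewrite (lt_trans (archi_boundP _))//; first by rewrite invr_ge0 divr_ge0// ltW.
  by rewrite ltr_nat.
have [a [ya Da]] := dD y n.+1%:R^-1 ltac:(by rewrite invr_gt0).
apply: (cy (f a) n a) => //; last by rewrite metric_sym.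
apply: (@filterS _ _ (ae_filter_ringOfSetsType muT)) ae_y => z cz az.
rewrite cz ?(k_cst point y)//.
rewrite (le_lt_trans (metric_triangle _ a _))//.
move: ya; rewrite /dball /=; move: az nr.
move: (n.+1%:R^-1) (mdist y a) (mdist a z) (rk y).1 => e s t r; lra.
Qed.

End Gluing.

(** * Integrals of sections *)

Section ProductSections.
Context d1 d2 (T1 : measurableType d1) (T2 : measurableType d2) (R : realType).
Variables (m1 : {sigma_finite_measure set T1 -> \bar R})
          (m2 : {sigma_finite_measure set T2 -> \bar R}).
Local Open Scope ereal_scope.
Variable f : T1 * T2 -> \bar R.
Hypotheses (mf : measurable_fun setT f) (f0 : forall z, 0 <= f z)
  (fin_f : \int[m1 \x m2]_z f z < +oo).

Lemma ae_finite_xsection_integral : {ae m1, forall x, \int[m2]_y f (x, y) < +oo}.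
Proof.
apply: ae_finite_integral.
- exact: (measurable_fun_fubini_tonelli_F _ mf f0).
- by move=> x; exact: integral_ge0.
- by move: fin_f; rewrite fubini_tonelli1.
Qed.

Lemma ae_finite_ysection_integral : {ae m2, forall y, \int[m1]_x f (x, y) < +oo}.
Proof.
apply: ae_finite_integral.
- exact: (measurable_fun_fubini_tonelli_G _ mf f0).
- by move=> x; exact: integral_ge0.
- by move: fin_f; rewrite fubini_tonelli2.
Qed.

End ProductSections.

(** Positive and negative parts are treated apart, Tonelli being about
    nonnegative functions. *)
Lemma measurable_section_integral d1 d2 (T1 : measurableType d1)
    (T2 : measurableType d2) (R : realType)
    (m2 : {sigma_finite_measure set T2 -> \bar R}) (B : set T2)
    (f : T1 * T2 -> \bar R) : measurable B -> measurable_fun setT f ->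
  measurable_fun setT (fun x => \int[m2]_(y in B) f (x, y))%E.
Proof.
move=> mB mf.
have mTB : measurable ([set: T1] `*` B) by exact: measurableX.
have patchE (h : T1 * T2 -> \bar R) x :
    (\int[m2]_(y in B) h (x, y) = \int[m2]_y (h \_ (setT `*` B)) (x, y))%E.
  rewrite integral_mkcond; apply: eq_integral => y _.
  by rewrite !patchE in_setX in_setT.
have mpatch (h : T1 * T2 -> \bar R) : measurable_fun setT h ->
    (forall z, 0 <= h z)%E ->
    measurable_fun setT (fun x => \int[m2]_(y in B) h (x, y))%E.
  move=> mh h0; under eq_fun do rewrite patchE.
  apply: (measurable_fun_fubini_tonelli_F (h \_ (setT `*` B))).
    by apply/(measurable_restrictT _ mTB); exact: measurable_funS mh.
  by move=> z; apply: erestrict_ge0 => w _; exact: h0.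
have mpos := mpatch _ (measurable_funepos mf) (fun z => funepos_ge0 f z).
have mneg := mpatch _ (measurable_funeneg mf) (fun z => funeneg_ge0 f z).
apply: eq_measurable_fun (emeasurable_funB mpos mneg) => x _.
by rewrite [RHS]integralE; congr (_ - _)%E; apply: eq_integral => y _; rewrite ?funeposE ?funenegE.
Qed.

(** * The weight *)

Section NonintegrableWeight.
Context {R : realType} {T : pointedType}.
Variables (mu : {outer_measure set T -> \bar R}) (E : set T) (w : T -> R).
Local Notation muT := (mu : set (caratheodory_type mu) -> \bar R).
Local Open Scope ereal_scope.
Hypotheses (muT0 : 0 < mu setT) (mE : mu.-caratheodory E)
  (w0 : forall x, (0 <= w x)%R) (wE : in_Lp mu E +oo (EFin \o w))
  (nwE : ~ in_Lp mu E 1%:E (EFin \o w)).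

Lemma measurable_weight :
  measurable_fun [set: caratheodory_type mu] ((EFin \o w) \_ E).
Proof. case: wE => mw _; apply/(measurable_restrictT (EFin \o w : caratheodory_type mu -> \bar R) (mE : measurable (E : set (caratheodory_type mu)))). exact: mw. Qed.

Lemma weight_ge0 x : 0 <= ((EFin \o w) \_ E) x.
Proof. by apply: erestrict_ge0 => y _; rewrite lee_fin. Qed.

Lemma integral_weight : \int[muT]_x ((EFin \o w) \_ E) x = +oo.
Proof.
apply/eqP; rewrite -leye_eq leNgt; apply/negP => fin_w; apply: nwE.
split; first by case: wE.
rewrite /Lp_norm Lnorm1; apply: le_lt_trans fin_w.
by rewrite le_eqVlt; apply/orP; left; apply/eqP; apply: eq_integral => x _;
   rewrite gee0_abs// weight_ge0.
Qed.

Lemma weight_bounded : exists2 M : R, (0 <= M)%R &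
  {ae muT, forall x, ((EFin \o w) \_ E) x <= M%:E}.
Proof.
case: wE => _; rewrite /Lp_norm unlock muT0.
set W := _ \_ E => finW.
have aeW := ess_sup_ge muT (abse \o W).
exists (Num.max 0 (fine (ess_sup muT (abse \o W))))%R; first by rewrite le_max lexx.
apply: (@filterS _ _ (ae_filter_ringOfSetsType muT)) aeW => x.
move=> /(le_trans (lee_abs _))/le_trans; apply.
case: ess_sup finW => [r| |]// _; first by rewrite lee_fin le_max lexx orbT.
exact: leNye.
Qed.

End NonintegrableWeight.

(** * Functions up to additive constants *)

Section AddConstant.
Context {R : realType} {Z : pointedType}.
Variables (d : Z -> Z -> R) (mu : {outer_measure set Z -> \bar R}).
Local Notation muZ := (mu : set (caratheodory_type mu) -> \bar R).
Local Open Scope ereal_scope.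

(** Differences of values do not see constants; infinite values stay infinite. *)
Lemma upper_gradient_add_constant (u g : Z -> \bar R) (c : R) :
  upper_gradient d u g -> upper_gradient d (fun z => u z + c%:E) g.
Proof.
move=> [bg g0 ug]; split => // a b gamma acg ncst.
apply: le_trans (ug a b gamma acg ncst).
case: (u (gamma b)) (u (gamma a)) => [s| |] [t| |]//=.
by rewrite lee_fin opprD addrACA subrr addr0.
Qed.

Hypotheses (mball : forall z r, mu.-caratheodory (dball d z r))
  (fin_ball : forall z r, (0 < r)%R -> mu (dball d z r) < +oo).

Lemma D1_add_constant (p c : R) (u : Z -> \bar R) :
  D1 d mu p u -> D1 d mu p (fun z => u z + c%:E).
Proof.
move=> [mu_u ball_u [g ug gp]]; split.
- by apply: emeasurable_funD => //; exact: measurable_cst.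
- move=> z r r0.
  have mB : measurable (dball d z r : set (caratheodory_type mu)) := mball z r.
  have ic : muZ.-integrable (dball d z r) (cst c%:E).
    apply/integrableP; split => //.
    by rewrite integral_cst// lte_mul_pinfty ?fin_ball.
  exact: (@integrableD _ _ _ muZ _ mB u (cst c%:E) (ball_u z r r0) ic).
- by exists g => //; exact: upper_gradient_add_constant.
Qed.

(** Subtracting from u its Sobolev-Poincare constant leaves a function in L^p. *)
Lemma D1_eq_N1_plus_constants (p C : R) : (0 < p)%R ->
  sobolev_poincare d mu p p C -> D1 d mu p = N1_plus_constants d mu p.
Proof.
move=> p0 [C0 sp]; apply/seteqP; split => [u Du|u [v [c [[Dv _] ->]]]]; last first.
  exact: D1_add_constant.
have [mu_u ball_u [g ug gp]] := Du.
have [c uc] := sp u g Du ug gp.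
exists (fun z => u z - c%:E), c; split; last first.
  by apply/funext => z; rewrite subeK.
split; first exact: D1_add_constant.
rewrite -Lp_norm_lty//; apply: le_lt_trans uc _.
have [_ fin_g] := gp.
by rewrite lte_mul_pinfty ?lee_fin ?(ltW C0).
Qed.

End AddConstant.

(** * Slices and assembly *)

Section AlmostEverywhereEqual.
Context {R : realType} {W : pointedMetricType R}.
Variables (mu : {outer_measure set W -> \bar R}) (v v' : W -> \bar R) (A : set W).
Local Notation muW := (mu : set (caratheodory_type mu) -> \bar R).
Local Open Scope ereal_scope.
Hypotheses (mms : metric_measure_space (@mdist R W) mu)
  (nA : muW.-negligible A) (vv' : forall w, ~ A w -> v w = v' w)
  (mv' : mu_measurable mu setT v').

Lemma ae_eq_mu_measurable : mu_measurable mu setT v.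
Proof. by apply: (caratheodory_ae_measurable nA _ mv') => w /vv'. Qed.

Lemma ae_eq_ge0_integral (D : set W) (h h' : W -> \bar R) :
  mu.-caratheodory D -> mu_measurable mu setT h -> mu_measurable mu setT h' ->
  (forall w, 0 <= h w) -> (forall w, 0 <= h' w) ->
  (forall w, ~ A w -> h w = h' w) ->
  \int[muW]_(w in D) h w = \int[muW]_(w in D) h' w.
Proof.
move=> mD mh mh' h0 h'0 hh'; apply: ge0_ae_eq_integral => //.
- exact: measurable_funS mh.
- exact: measurable_funS mh'.
- by apply: negligibleS nA => w /= H; apply: contrapT => /hh' E; apply: H.
Qed.

(** Every ball lies in a large enough ball around the base point. *)
Lemma ae_eq_integrable_over_balls :
  (forall m, exists2 n, (m <= n)%N &
    \int[muW]_(w in dball mdist point n.+1%:R) `|v' w| < +oo) ->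
  integrable_over_balls mdist mu v.
Proof.
move=> fin_v' w r r0.
have mball z s : measurable (dball mdist z s : set (caratheodory_type mu)).
  by have [_ bW _ _] := mms; exact: (caratheodory_dball _ _ hemimetric_mdist).
have mav : mu_measurable mu setT (abse \o v).
  by apply: measurableT_comp => //; exact: ae_eq_mu_measurable.
have mav' : mu_measurable mu setT (abse \o v') by exact: measurableT_comp.
apply/integrableP; split; first exact: measurable_funS ae_eq_mu_measurable.
have [n nb fin_n] := fin_v' (Num.bound (mdist point w + r)).
rewrite (ae_eq_ge0_integral (mball w r) mav mav'); last 3 first.
- by move=> z; exact: abse_ge0.
- by move=> z; exact: abse_ge0.
- by move=> z /vv' /= ->.
apply: le_lt_trans fin_n; apply: ge0_subset_integral => //.
  exact: measurable_funS mav'.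
  by move=> z _; exact: abse_ge0.
move=> z; rewrite /dball /= => wz.
apply: (@lt_le_trans _ _ (mdist point w + r)%R).
  by rewrite (le_lt_trans (metric_triangle _ w _))// ltrD2l.
apply: (@le_trans _ _ (Num.bound (mdist point w + r))%:R).
  by rewrite ltW// archi_boundP// addr_ge0 ?mdist_ge0 ?ltW.
by rewrite ler_nat ltnW.
Qed.

End AlmostEverywhereEqual.

Section WarpedSobolevPoincare.
Context {R : realType} {X Y : pointedMetricType R}.
Variables (muX : {outer_measure set X -> \bar R})
          (muY : {outer_measure set Y -> \bar R})
          (N : R * R -> R) (p C : R) (phi : X -> R).
Hypotheses (mmsX : metric_measure_space (@mdist R X) muX)
  (mmsY : metric_measure_space (@mdist R Y) muY)
  (lsX : length_space (@mdist R X)) (lsY : length_space (@mdist R Y))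
  (normN : is_norm2 N) (unitN : unitary N) (incrN : coordinate_increasing N)
  (p0 : 0 < p) (cphi : continuous phi) (phi0 : forall x, 0 <= phi x)
  (ae_phi : {ae (muX : set (caratheodory_type muX) -> \bar R),
    forall x, 0 < phi x}).
Local Open Scope ereal_scope.

Local Notation TX := (caratheodory_type muX).
Local Notation TY := (caratheodory_type muY).
Local Notation P := (@warped_proj R X Y N phi).
Local Notation dist := (@warped_mdist R X Y N phi).
Local Notation muZ := (warped_measure N phi muX muY).
Local Notation TZ := (caratheodory_type muZ).
Local Notation pi := (bundled_prod_outer_measure muX muY).
Let sfX := sigma_finite_metric_measure mmsX.
Let sfY := sigma_finite_metric_measure mmsY.
Local Notation mX := (sigma_finite_caratheodory sfX).
Local Notation mY := (sigma_finite_caratheodory sfY).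
Local Notation nu := (mX \x mY).

Let qdist : hemimetric dist.
Proof. exact: hemimetric_warped_mdist. Qed.

Let mballX x r : measurable (dball mdist x r : set TX).
Proof. by have [_ bX _ _] := mmsX; exact: (caratheodory_dball _ _ hemimetric_mdist). Qed.

Let mballY y r : measurable (dball mdist y r : set TY).
Proof. by have [_ bY _ _] := mmsY; exact: (caratheodory_dball _ _ hemimetric_mdist). Qed.

(* P is injective off S, which is null since phi is positive almost everywhere. *)
Let S : set (X * Y) := [set q | ~ (0 < phi q.1)%R].

Let piS : pi S = 0.
Proof.
have [A [mA muA SA]] := ae_phi.
have mAT : measurable (A `*` setT : set (TX * TY)) by exact: measurableX.
apply/eqP; rewrite eq_le outer_measure_ge0 andbT.
apply: (@le_trans _ _ (pi (A `*` setT))).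
  by apply: le_outer_measure => q Sq; split => //; exact: SA.
rewrite (prod_outer_measureE sfX sfY mAT) product_measure1E//.
by rewrite [X in X * _]muA mul0e.
Qed.

Let injP q q' : ~ S q -> P q = P q' -> q = q'.
Proof. by move=> /contrapT; exact: warped_proj_inj. Qed.

Let muZE (A : set (warped_product Y N phi)) : muZ A = pi (P @^-1` A).
Proof. by []. Qed.

Section Slices.
(* The functions u' and g' are product-measurable versions of u and g pulled back
   to X * Y, and Nul is a null set off which they agree. *)
Variables (u g : warped_product Y N phi -> \bar R) (u' g' : TX * TY -> \bar R)
  (Nul : set (TX * TY)).
Hypotheses (mu : mu_measurable muZ setT u) (bu : integrable_over_balls dist muZ u)
  (ug : upper_gradient dist u g) (gp : in_Lp muZ setT p%:E g)
  (mu' : measurable_fun setT u') (mg' : measurable_fun setT g')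
  (mNul : measurable Nul) (Nul0 : nu Nul = 0)
  (uu' : forall z, ~ Nul z -> u (P z) = u' z)
  (gg' : forall z, ~ Nul z -> g (P z) = g' z).

Let Gp z := `|g' z| `^ p.

Let mGp : measurable_fun setT Gp.
Proof.
by apply: (measurableT_comp (measurable_poweR _)); exact: measurableT_comp.
Qed.

Let Gp0 z : 0 <= Gp z. Proof. exact: poweR_ge0. Qed.

Let intGp : \int[muZ : set TZ -> \bar R]_z `|g z| `^ p = \int[nu]_z Gp z.
Proof.
apply: (transfer_integral muZE piS injP _ _ mGp Gp0 mNul Nul0).
- have [mg _] := gp.
  by apply: (measurableT_comp (measurable_poweR _)); exact: measurableT_comp.
- by move=> z; exact: poweR_ge0.
- by move=> z /gg' gz; rewrite /Gp gz.
Qed.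

Let fin_Gp : \int[nu]_z Gp z < +oo.
Proof. by rewrite -intGp -Lp_norm_lty//; have [] := gp. Qed.

Let BX n : set X := dball mdist point n.+1%:R.
Let BY n : set Y := dball mdist point n.+1%:R.

Let m_restr_u' A : measurable A -> measurable_fun [set: TX * TY] (abse \o u' \_ A).
Proof.
move=> mA; apply: measurableT_comp => //.
by apply/(measurable_restrictT _ mA); exact: measurable_funS mu'.
Qed.

Let m_patch_u' n :
  measurable_fun [set: TX * TY] (abse \o u' \_ (BX n `*` BY n)).
Proof. by apply: m_restr_u'; apply: measurableX; [exact: mballX|exact: mballY]. Qed.

(** A product of balls lies in the preimage of a ball of the warped product, over
    which u is integrable. *)
Let fin_u' n : \int[nu]_z (abse \o u' \_ (BX n `*` BY n)) z < +oo.
Proof.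
pose D := dball dist (P (point, point)) ((phi point + 1) * n.+1%:R)%R.
have r0 : (0 < (phi point + 1) * n.+1%:R)%R by rewrite mulr_gt0// ltr_wpDl.
have mD : measurable (P @^-1` D : set (TX * TY)).
  by apply: (dopen_warped_measurable normN unitN incrN lsX lsY phi0 mmsX mmsY);
    exact: dball_open.
have mDZ : measurable (D : set TZ).
  exact: (caratheodory_warped_dball normN unitN incrN lsX lsY phi0 mmsX mmsY).
apply: (@le_lt_trans _ _ (\int[nu]_z (abse \o u' \_ (P @^-1` D)) z)).
  apply: ge0_le_integral => //; try exact: m_restr_u'; try exact: m_patch_u'.
    by move=> z _ /=; exact: abse_ge0.
  move=> z _ /=; rewrite !patchE; case: ifPn => [|_]; last by rewrite abse0 abse_ge0.
  move=> /set_mem Bz; rewrite ifT//; apply/mem_set.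
  exact: (dball_setX_subset normN unitN incrN lsX lsY phi0 (ltr0Sn R n)).
have abs_patch : (fun z => `|u z|) \_ D = (fun z => `|(u \_ D) z|).
  by apply/funext => z; rewrite !patchE; case: ifP => //; rewrite abse0.
have muD : measurable_fun [set: TZ] (fun z : TZ => `|(u \_ D) z|).
  rewrite -abs_patch; apply/(measurable_restrictT (fun z : TZ => `|u z|) mDZ).
  have mau : measurable_fun [set: TZ] (fun z : TZ => `|u z|) by exact: measurableT_comp mu.
  exact: measurable_funTS mau.
have uD0 (z : warped_product Y N phi) : 0 <= `|(u \_ D) z| by exact: abse_ge0.
have <- : \int[muZ : set TZ -> \bar R]_z `|(u \_ D) z| =
    \int[nu]_z (abse \o u' \_ (P @^-1` D)) z.
  apply: (transfer_integral muZE piS injP muD uD0 (m_restr_u' mD) _ mNul Nul0).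
    by move=> z; exact: abse_ge0.
  by move=> z /uu' uz; rewrite /= !patchE uz.
have /integrableP[_] := bu (P (point, point)) r0.
by rewrite integral_mkcond abs_patch.
Qed.

(** The slices over which the integrability assumptions on u and g, and the
    agreement with u' and g', pass to X. *)
Let good_y y := [/\ muX (ysection Nul y) = 0, \int[mX]_x Gp (x, y) < +oo &
  forall n, BY n y -> \int[mX]_(x in BX n) `|u' (x, y)| < +oo].

Let ae_good_y : {ae mY, forall y, good_y y}.
Proof.
have h1 := ae_null_ysection mNul Nul0.
have h2 := ae_finite_ysection_integral mGp Gp0 fin_Gp.
have h3 : {ae mY, forall y n, BY n y -> \int[mX]_(x in BX n) `|u' (x, y)| < +oo}.
  apply/ae_foralln => n.
  have := ae_finite_ysection_integral (m_patch_u' n) (fun z => abse_ge0 _) (fin_u' n).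
  apply: (@filterS _ _ (ae_filter_ringOfSetsType mY)) => y + By.
  apply: le_lt_trans; rewrite le_eqVlt; apply/orP; left; apply/eqP.
  rewrite integral_mkcond; congr (integral _ _ _); apply/funext => x.
  by rewrite /= !patchE in_setX (mem_set By) andbT; case: ifP => //; rewrite abse0.
apply: (@filterS3 _ _ (ae_filter_ringOfSetsType mY)) h1 h2 h3 => y.
by move=> ? ? ?; split.
Qed.

Let good_x x := muY (xsection Nul x) = 0 /\
  forall n, BX n x -> \int[mY]_(y in BY n) `|u' (x, y)| < +oo.

Let ae_good_x : {ae mX, forall x, good_x x}.
Proof.
have h1 := ae_null_xsection mNul Nul0.
have h3 : {ae mX, forall x n, BX n x -> \int[mY]_(y in BY n) `|u' (x, y)| < +oo}.
  apply/ae_foralln => n.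
  have := ae_finite_xsection_integral (m_patch_u' n) (fun z => abse_ge0 _) (fin_u' n).
  apply: (@filterS _ _ (ae_filter_ringOfSetsType mX)) => x + Bx.
  apply: le_lt_trans; rewrite le_eqVlt; apply/orP; left; apply/eqP.
  rewrite integral_mkcond; congr (integral _ _ _); apply/funext => y.
  by rewrite /= !patchE in_setX (mem_set Bx); case: ifP => //; rewrite abse0.
by apply: (@filterS2 _ _ (ae_filter_ringOfSetsType mX)) h1 h3 => x.
Qed.

Let mu'_y y : mu_measurable muX setT (fun x => u' (x, y)).
Proof. exact: measurable_fun_pair1. Qed.

Let mu'_x x : mu_measurable muY setT (fun y => u' (x, y)).
Proof. exact: measurable_fun_pair2. Qed.

Let mball_lt (W : pointedMetricType R) (w : W) m : exists2 n, (m <= n)%N &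
  dball mdist (point : W) n.+1%:R w.
Proof.
exists (maxn m (Num.bound (mdist point w))); first exact: leq_maxl.
rewrite /dball /=; apply: (@lt_le_trans _ _ (Num.bound (mdist point w))%:R).
  by rewrite archi_boundP ?mdist_ge0.
by rewrite ler_nat leqW// leq_maxr.
Qed.

Hypothesis spX : sobolev_poincare (@mdist R X) muX p p C.

(** The slice at y is isometric to X, so the Sobolev-Poincare inequality of X
    applies to u there. *)
Let horizontal_poincare y : good_y y -> exists c : R,
  \int[mX]_x `|u' (x, y) - c%:E| `^ p <= (C `^ p)%:E * \int[mX]_x Gp (x, y).
Proof.
move=> [Ny fin_y fin_uy]; have [C0 sp] := spX.
have nNy : (muX : set TX -> \bar R).-negligible (ysection Nul y).
  by apply/negligibleP; [exact: measurable_ysection|exact: Ny].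
have off (x : X) : ~ ysection Nul y x -> ~ Nul (x, y).
  by move=> + Nxy; apply; rewrite /ysection /= inE.
pose v x := u (P (x, y)).
pose h x := 1%:E * g (P (x, y)).
have vu' x : ~ ysection Nul y x -> v x = u' (x, y) by move=> /off/uu'.
have hg' x : ~ ysection Nul y x -> h x = g' (x, y).
  by move=> /off/gg'; rewrite /h mul1e.
have mv := ae_eq_mu_measurable nNy vu' (mu'_y y).
have mg'_y : mu_measurable muX setT (fun x => g' (x, y)) by exact: measurable_fun_pair1.
have mh := ae_eq_mu_measurable nNy hg' mg'_y.
have bv : integrable_over_balls mdist muX v.
  apply: (ae_eq_integrable_over_balls mmsX nNy vu' (mu'_y y)) => m.
  by have [n mn /fin_uy] := mball_lt y m; exists n.
have vh : upper_gradient mdist v h.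
  apply: (upper_gradient_pullback qdist (ler01 : (0 <= 1 :> R)%R) (f := fun x => P (x, y))) ug.
    by move=> x x'; rewrite (warped_proj_horizontal normN unitN incrN lsX lsY phi0) mul1r.
  move=> x x' /= Pxx'.
  apply/mdist_positivity.
  rewrite -(warped_proj_horizontal normN unitN incrN lsX lsY phi0 x x' y) Pxx'.
  by have [-> _ _] := qdist.
have inth : \int[mX]_x `|h x| `^ p = \int[mX]_x Gp (x, y).
  apply: (ae_eq_ge0_integral nNy) => //.
  - exact: (@measurableT _ TX).
  - by apply: (measurableT_comp (measurable_poweR _)); exact: measurableT_comp.
  - by apply: (measurableT_comp (measurable_poweR _)); exact: measurableT_comp.
  - by move=> x; exact: poweR_ge0.
  - by move=> x /hg'; rewrite /Gp => ->.
have hp : in_Lp muX setT p%:E h.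
  by split => //; rewrite Lp_norm_lty// [X in X < _]inth.
have [c] := sp v h (And3 mv bv (ex_intro2 _ _ h vh hp)) vh hp.
rewrite Lp_norm_lee ?(ltW C0)// [X in _ <= _ * X -> _]inth => vc.
exists c; apply: le_trans vc; rewrite le_eqVlt; apply/orP; left; apply/eqP.
have mc : mu_measurable muX setT (fun=> c%:E) by exact: measurable_cst.
apply: (ae_eq_ge0_integral nNy) => //.
- exact: (@measurableT _ TX).
- exact: (measurable_fun_poweR_dist _ (mu'_y y) mc).
- exact: (measurable_fun_poweR_dist _ mv mc).
- by move=> x; exact: poweR_ge0.
- by move=> x; exact: poweR_ge0.
- by move=> x /vu' ->.
Qed.

Let constant y : R := xget 0%R [set c | \int[mX]_x `|u' (x, y) - c%:E| `^ p
  <= (C `^ p)%:E * \int[mX]_x Gp (x, y)].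

Let constantP y : good_y y -> \int[mX]_x `|u' (x, y) - (constant y)%:E| `^ p
  <= (C `^ p)%:E * \int[mX]_x Gp (x, y).
Proof.
move=> gy; have := @xgetPex _ 0%R _ (horizontal_poincare gy).
exact.
Qed.

Variables (W : TX -> \bar R) (M : R).
Hypotheses (mW : measurable_fun setT W) (W0 : forall x, 0 <= W x)
  (M0 : (0 <= M)%R) (WM : {ae mX, forall x, W x <= M%:E})
  (intW : \int[mX]_x W x = +oo)
  (W_phi : forall x, W x * (phi x `^ p)%:E <= 1).

(** The weight W is bounded. *)
Let weighted_constant y : good_y y ->
  \int[mX]_x (W x * `|u' (x, y) - (constant y)%:E| `^ p) < +oo.
Proof.
move=> gy; have [_ fin_y _] := gy.
have mc : mu_measurable muX setT (fun=> (constant y)%:E) by exact: measurable_cst.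
have muc := measurable_fun_poweR_dist p (mu'_y y) mc.
apply: (@le_lt_trans _ _ (M%:E * \int[mX]_x `|u' (x, y) - (constant y)%:E| `^ p)).
  rewrite -ge0_integralZl//; last by move=> x _; exact: poweR_ge0.
  apply: ae_ge0_le_integral => //.
  - by move=> x _; rewrite mule_ge0// poweR_ge0.
  - exact: emeasurable_funM.
  - by move=> x _; rewrite mule_ge0 ?lee_fin// poweR_ge0.
  - exact: measurable_funeM.
  apply: (@filterS _ _ (ae_filter_ringOfSetsType mX)) WM => x Wx _.
  by rewrite lee_wpmul2r// poweR_ge0.
rewrite lte_mul_pinfty ?lee_fin//.
apply: le_lt_trans (constantP gy) _.
by rewrite lte_mul_pinfty// lee_fin powR_ge0.
Qed.

Section LocalBall.
Variables (y0 : Y) (K r : R).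
Hypotheses (K0 : (0 < K)%R) (r0 : (0 < r)%R)
  (poincareY : forall v h, mu_measurable muY setT v ->
    integrable_over_balls mdist muY v -> upper_gradient mdist v h ->
    Lp_norm muY (dball mdist y0 r) p%:E
      (fun z => v z - average muY (dball mdist y0 r) v)
    <= K%:E * Lp_norm muY setT p%:E h).
Let B : set TY := dball mdist y0 r.
Let A x := average muY B (fun y => u' (x, y)).

(** The slice at x maps Y to the warped product with Lipschitz constant phi x,
    and injectively as phi x is positive. *)
Let vertical_poincare x : good_x x -> (0 < phi x)%R ->
  \int[mY]_(y in B) `|u' (x, y) - A x| `^ p <=
  ((K `^ p) * (phi x `^ p))%:E * \int[mY]_y Gp (x, y).
Proof.
move=> [Nx fin_ux] phix.
have nNx : (muY : set TY -> \bar R).-negligible (xsection Nul x).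
  by apply/negligibleP; [exact: measurable_xsection|exact: Nx].
have off (y : Y) : ~ xsection Nul x y -> ~ Nul (x, y).
  by move=> + Nxy; apply; rewrite /xsection /= inE.
pose v y := u (P (x, y)).
pose h y := (phi x)%:E * g (P (x, y)).
have vu' y : ~ xsection Nul x y -> v y = u' (x, y) by move=> /off/uu'.
have mv := ae_eq_mu_measurable nNx vu' (mu'_x x).
have mg'_x : mu_measurable muY setT (fun y => g' (x, y)) by exact: measurable_fun_pair2.
have hg' y : ~ xsection Nul x y -> h y = (phi x)%:E * g' (x, y).
  by move=> /off/gg'; rewrite /h => ->.
have mh' : mu_measurable muY setT (fun y => (phi x)%:E * g' (x, y)).
  exact: measurable_funeM.
have mh := ae_eq_mu_measurable nNx hg' mh'.
have bv : integrable_over_balls mdist muY v.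
  apply: (ae_eq_integrable_over_balls mmsY nNx vu' (mu'_x x)) => m.
  by have [n mn /fin_ux] := mball_lt x m; exists n.
have vh : upper_gradient mdist v h.
  apply: (upper_gradient_pullback qdist (phi0 x) (f := fun y => P (x, y))) ug.
    by move=> y y'; exact: warped_proj_vertical.
  move=> y y' Pyy'.
  by have [] := @warped_proj_inj _ _ _ N phi normN unitN incrN lsX lsY cphi phi0
    (x, y) (x, y') phix Pyy'.
have inth : \int[mY]_y `|h y| `^ p = (phi x `^ p)%:E * \int[mY]_y Gp (x, y).
  rewrite -ge0_integralZl//; last 2 first.
  - exact: measurable_fun_pair2.
  - by rewrite lee_fin powR_ge0.
  apply: (ae_eq_ge0_integral nNx) => //.
  - exact: (@measurableT _ TY).
  - by apply: (measurableT_comp (measurable_poweR _)); exact: measurableT_comp.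
  - by apply: measurable_funeM; exact: measurable_fun_pair2.
  - by move=> y; exact: poweR_ge0.
  - by move=> y; rewrite mule_ge0// lee_fin powR_ge0.
  - move=> y /hg' ->; rewrite abseM abse_EFin poweRM// poweR_EFin.
    by rewrite ger0_norm.
have mB : muY.-caratheodory B := mballY y0 r.
have avE : average muY B v = A x.
  congr (_ * _); apply: ae_eq_integral => //.
  - exact: measurable_funS mv.
  - exact: measurable_funS (mu'_x x).
  - by apply: negligibleS nNx => y /= H; apply: contrapT => /vu' E; apply: H.
have := poincareY mv bv vh.
rewrite Lp_norm_lee ?(ltW K0)// [X in _ <= _ * X -> _]inth avE muleA -EFinM.
apply: le_trans; rewrite le_eqVlt; apply/orP; left; apply/eqP.
have mc : mu_measurable muY setT (fun=> A x) by exact: measurable_cst.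
apply: (ae_eq_ge0_integral nNx) => //.
- exact: (measurable_fun_poweR_dist _ (mu'_x x) mc).
- exact: (measurable_fun_poweR_dist _ mv mc).
- by move=> y; exact: poweR_ge0.
- by move=> y; exact: poweR_ge0.
- by move=> y /vu' ->.
Qed.

Let mA : measurable_fun setT (A : TX -> \bar R).
Proof.
apply: measurable_funeM.
exact: (@measurable_section_integral _ _ _ _ _ mY _ _ (mballY y0 r) mu').
Qed.

Let F z := W z.1 * `|u' z - A z.1| `^ p.

Let mF : measurable_fun setT F.
Proof.
apply: emeasurable_funM; first exact: measurableT_comp.
by apply: measurable_fun_poweR_dist => //; exact: measurableT_comp.
Qed.

Let F0 z : 0 <= F z. Proof. by rewrite mule_ge0// poweR_ge0. Qed.

(** The weight compensates the factor phi of the vertical upper gradient, so that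
    the total weighted deviation is at most a multiple of the integral of g^p;
    Tonelli's theorem then reads it slice by slice in y. *)
Let ae_weighted_average :
  {ae mY, forall y, B y -> \int[mX]_x (W x * `|u' (x, y) - A x| `^ p) < +oo}.
Proof.
have mTB : measurable ([set: TX] `*` B).
  by apply: measurableX => //; exact: mballY.
pose FB := F \_ ([set: TX] `*` B).
have mFB : measurable_fun setT FB.
  by apply/(measurable_restrictT _ mTB); exact: measurable_funS mF.
have FB0 z : 0 <= FB z by apply: erestrict_ge0 => w _; exact: F0.
have finFB : \int[nu]_z FB z < +oo.
  apply: (@le_lt_trans _ _ ((K `^ p)%:E * \int[nu]_z Gp z)); last first.
    by rewrite lte_mul_pinfty// lee_fin powR_ge0.
  rewrite !fubini_tonelli1// -ge0_integralZl//; last 3 first.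
  - exact: (measurable_fun_fubini_tonelli_F _ mGp Gp0).
  - by move=> x _; exact: integral_ge0.
  - by rewrite lee_fin powR_ge0.
  apply: ae_ge0_le_integral => //.
  - by move=> x _; exact: integral_ge0.
  - exact: (measurable_fun_fubini_tonelli_F _ mFB FB0).
  - by move=> x _; rewrite mule_ge0 ?lee_fin ?powR_ge0//; exact: integral_ge0.
  - by apply: measurable_funeM; exact: (measurable_fun_fubini_tonelli_F _ mGp Gp0).
  apply: (@filterS2 _ _ (ae_filter_ringOfSetsType mX)) ae_good_x ae_phi => x gx px _.
  rewrite /fubini_F.
  have -> : \int[mY]_y FB (x, y) = W x * \int[mY]_(y in B) `|u' (x, y) - A x| `^ p.
    rewrite -ge0_integralZl//; last 3 first.
    - exact: (mballY y0 r).
    - apply: measurable_funTS.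
      have mc : mu_measurable muY setT (fun=> A x) by exact: measurable_cst.
      exact: (measurable_fun_poweR_dist _ (mu'_x x) mc).
    - by move=> y _; exact: poweR_ge0.
    rewrite [RHS]integral_mkcond; apply: eq_integral => y _.
    by rewrite /FB !patchE in_setX in_setT.
  apply: le_trans (lee_wpmul2l (W0 x) (vertical_poincare gx px)) _.
  rewrite EFinM -muleA muleCA lee_wpmul2l ?lee_fin ?powR_ge0// muleA.
  rewrite -[leRHS]mul1e lee_wpmul2r//; exact: integral_ge0.
have := ae_finite_ysection_integral mFB FB0 finFB.
apply: (@filterS _ _ (ae_filter_ringOfSetsType mY)) => y + By.
apply: le_lt_trans; rewrite le_eqVlt; apply/orP; left; apply/eqP.
by apply: eq_integral => x _; rewrite /FB patchE in_setX in_setT (mem_set By).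
Qed.

(** Any point of B with finite integrals fixes the constant, and the others
    agree with it as W is not integrable. *)
Lemma ball_constant : exists k, {ae mY, forall y, B y -> constant y = k}.
Proof.
pose best y := [/\ good_y y, B y &
  \int[mX]_x (W x * `|u' (x, y) - A x| `^ p) < +oo].
have [[y1 [gy1 By1 fin1]]|none] := pselect (exists y, best y).
  exists (constant y1).
  apply: (@filterS2 _ _ (ae_filter_ringOfSetsType mY)) ae_good_y ae_weighted_average.
  move=> y gy fin_y By.
  exact: (weighted_constants_eq p0 mW mA (mu'_y y) (mu'_y y1) W0 intW (fin_y By)
    fin1 (weighted_constant gy) (weighted_constant gy1)).
exists 0%R.
apply: (@filterS2 _ _ (ae_filter_ringOfSetsType mY)) ae_good_y ae_weighted_average.
by move=> y gy fin_y By; exfalso; apply: none; exists y; split => //; exact: fin_y.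
Qed.

End LocalBall.

(** With c(y) = k for almost every y, the inequalities of the horizontal slices
    integrate over y. *)
Lemma slices_poincare : weak_local_poincare (@mdist R Y) muY p p ->
  exists k : R, \int[muZ : set TZ -> \bar R]_z `|u z - k%:E| `^ p <=
    (C `^ p)%:E * \int[muZ : set TZ -> \bar R]_z `|g z| `^ p.
Proof.
move=> wlp.
have [k ck] : exists k, {ae mY, forall y, constant y = k}.
  apply: (ae_locally_constant mmsY lsY) => y.
  have [K [r [K0 r0 pY]]] := wlp y.
  have [k ck] := @ball_constant y K r K0 pY.
  by exists r, k.
exists k.
have mk : measurable_fun [set: TX * TY] (fun=> k%:E) by exact: measurable_cst.
have muk := measurable_fun_poweR_dist p mu' mk.
have muk0 z : 0 <= `|u' z - k%:E| `^ p by exact: poweR_ge0.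
rewrite intGp (transfer_integral (f' := fun z => `|u' z - k%:E| `^ p)
  muZE piS injP _ _ muk muk0 mNul Nul0); last 3 first.
- by apply: measurable_fun_poweR_dist => //; exact: measurable_cst.
- by move=> z; exact: poweR_ge0.
- by move=> z /uu' ->.
rewrite !fubini_tonelli2// -ge0_integralZl//; last 3 first.
- exact: (measurable_fun_fubini_tonelli_G _ mGp Gp0).
- by move=> y _; exact: integral_ge0.
- by rewrite lee_fin powR_ge0.
apply: ae_ge0_le_integral => //.
- by move=> y _; exact: integral_ge0.
- exact: (measurable_fun_fubini_tonelli_G _ muk muk0).
- by move=> y _; rewrite mule_ge0 ?lee_fin ?powR_ge0//; exact: integral_ge0.
- by apply: measurable_funeM; exact: (measurable_fun_fubini_tonelli_G _ mGp Gp0).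
apply: (@filterS2 _ _ (ae_filter_ringOfSetsType mY)) ae_good_y ck => y gy cy _.
by rewrite /fubini_G -cy; exact: constantP.
Qed.

End Slices.
(** The function phi^(-p) 1_E serves as weight; where phi vanishes, its value is
    0 by convention. *)
Lemma warped_sobolev_poincare (E : set X) : muX setT = +oo ->
  muX.-caratheodory E ->
  in_Lp muX E +oo (fun x => (phi x `^ (- p))%:E) ->
  ~ in_Lp muX E 1%:E (fun x => (phi x `^ (- p))%:E) ->
  sobolev_poincare (@mdist R X) muX p p C ->
  weak_local_poincare (@mdist R Y) muY p p ->
  sobolev_poincare dist muZ p p C.
Proof.
move=> muXT mE phiE nphiE spX wlpY; have [C0 _] := spX; split => // u g [mu bu _] ug gp.
have [mg _] := gp.
have [u' [Nu [mu' mNu Nu0 uu']]] := transfer_fun muZE piS injP sfX sfY mu.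
have [g' [Ng [mg' mNg Ng0 gg']]] := transfer_fun muZE piS injP sfX sfY mg.
have mN : measurable (Nu `|` Ng) by exact: measurableU.
have N0 : nu (Nu `|` Ng) = 0 by rewrite measureU0.
have uu'N z : ~ (Nu `|` Ng) z -> u (P z) = u' z by move=> /not_orP[/uu'].
have gg'N z : ~ (Nu `|` Ng) z -> g (P z) = g' z by move=> /not_orP[_ /gg'].
pose w x := (phi x `^ (- p))%R.
have w0 x : (0 <= w x)%R by exact: powR_ge0.
have muX0 : 0 < muX setT by rewrite muXT.
have [M M0 WM] := weight_bounded muX0 phiE.
have W_phi x : ((EFin \o w) \_ E) x * (phi x `^ p)%:E <= 1.
  rewrite patchE; case: ifP => _; last by rewrite mul0e.
  rewrite /= -EFinM lee_fin /w powRN.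
  have [->|phipn0] := eqVneq (phi x `^ p)%R 0%R; first by rewrite mulr0.
  by rewrite mulVf.
have [k uk] := slices_poincare mu bu ug gp mu' mg' mN N0 uu'N gg'N spX
  (measurable_weight mE phiE) (weight_ge0 E w0) M0 WM
  (integral_weight w0 phiE nphiE) W_phi wlpY.
by exists k; rewrite Lp_norm_lee// ltW.
Qed.

End WarpedSobolevPoincare.

Theorem theorem1p6 (R : realType) (X Y : pointedMetricType R)
    (muX : {outer_measure set X -> \bar R})
    (muY : {outer_measure set Y -> \bar R})
    (N : R * R -> R) (p C : R) (phi : X -> R) :
  metric_measure_space (@mdist R X) muX ->
  metric_measure_space (@mdist R Y) muY ->
  length_space (@mdist R X) ->
  length_space (@mdist R Y) ->
  is_norm2 N -> unitary N -> coordinate_increasing N ->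
  muX setT = +oo%E ->
  (muY setT < +oo)%E ->
  1 <= p ->
  continuous phi ->
  (forall x, 0 <= phi x) ->
  {ae (muX : set (caratheodory_type muX) -> \bar R), forall x, 0 < phi x} ->
  sobolev_poincare (@mdist R X) muX p p C ->
  weak_local_poincare (@mdist R Y) muY p p ->
  (exists E : set X,
    [/\ muX.-caratheodory E, (0 < muX E)%E,
        in_Lp muX E +oo%E (fun x => (phi x `^ (- p))%:E)
      & ~ in_Lp muX E 1%:E (fun x => (phi x `^ (- p))%:E)]) ->
  sobolev_poincare (warped_mdist X Y N phi)
    (warped_measure N phi muX muY) p p C /\
  D1 (warped_mdist X Y N phi) (warped_measure N phi muX muY) p =
    N1_plus_constants (warped_mdist X Y N phi)
      (warped_measure N phi muX muY) p.
Proof.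
move=> mmsX mmsY lsX lsY normN unitN incrN muXT muYT p1 cphi phi0 ae_phi spX wlpY.
move=> [E [mE _ phiE nphiE]].
have p0 : 0 < p := lt_le_trans ltr01 p1.
have spZ := warped_sobolev_poincare mmsX mmsY lsX lsY normN unitN incrN p0 cphi phi0
  ae_phi muXT mE phiE nphiE spX wlpY.
split=> //; apply: D1_eq_N1_plus_constants p0 spZ => z r.
  exact: caratheodory_warped_dball.
exact: warped_dball_finite.
Qed.
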